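(* Let $q\ge0$ be an integer and let $J_q$ be the Bessel function of the first kind of order $q$. Let $0<z_1<z_2<\cdots$ be the positive zeros of $\frac{d}{dz}J_q$ and $z_{-k}=-z_k$ for $k\ge1$. Then for every $z\in\mathbb{C}$ with $J_q^{(1)}(z)\neq0$, $$J_q(z)=\frac{A^{(0,num)}(z)+\sum_{k=-\infty,\,k\ne0}^{\infty}\left(\frac{a_{-2}^{(k,num)}}{(z-z_k)^2}+\frac{a_{-1}^{(k,num)}}{z-z_k}\right)}{1+A^{(0,den)}(z)+\sum_{k=-\infty,\,k\ne0}^{\infty}\left(\frac{a_{-2}^{(k,den)}}{(z-z_k)^2}+\frac{a_{-1}^{(k,den)}}{z-z_k}\right)},$$ where for $k\neq0$ $$a_{-2}^{(k,num)}=\frac{J_q(z_k)}{(J_q^{(2)}(z_k))^2},\qquad a_{-1}^{(k,num)}=\frac{J_q^{(1)}(z_k)}{(J_q^{(2)}(z_k))^2}-\frac{J_q(z_k)J_q^{(3)}(z_k)}{(J_q^{(2)}(z_k))^3},$$ $$a_{-2}^{(k,den)}=\frac{1}{(J_q^{(2)}(z_k))^2},\qquad a_{-1}^{(k,den)}=-\frac{J_q^{(3)}(z_k)}{(J_q^{(2)}(z_k))^3},$$ and $$A^{(0,num)}(z)=\begin{cases}\frac{4}{z^2}, & q=0,\\ 0, & q=1,\\ \sum_{n=1}^{q-2}\frac{a_{-n}^{(0,num)}}{z^n}, & q\ge2,\end{cases}\qquad A^{(0,den)}(z)=\begin{cases}\frac{4}{z^2}, & q=0,\\ 0, & q=1,\\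 \sum_{n=1}^{2(q-1)}\frac{a_{-n}^{(0,den)}}{z^n}, & q\ge2,\end{cases}$$ with $a_{-n}^{(0,num)}$ and $a_{-n}^{(0,den)}$ the coefficients of $z^{-n}$ in the Laurent expansions about $z=0$ of $J_q(z)/(J_q^{(1)}(z))^2$ and $1/(J_q^{(1)}(z))^2$ respectively.
   Context: $J_q^{(n)}$ denotes the $n$th derivative of $J_q$. Bi-infinite sums are understood as limits of symmetric partial sums, $\sum_{k=-\infty,k\neq0}^\infty=\lim_{N\to\infty}\sum_{1\le|k|\le N}$; empty sums are $0$. *)

(* Defs.v *)
From Stdlib Require Import Reals ZArith.
From Coquelicot Require Import Coquelicot.

Open Scope C_scope.

(* The value of a convergent complex series (junk value if it diverges). *)
Definition C_series (a : nat -> C) : C :=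
  @iota C_CompleteNormedModule
    (fun l : C => @is_series C_AbsRing C_NormedModule a l).

(* [C_derive] is a total operator: it is the complex derivative wherever that
   exists, in particular everywhere for the entire functions used below. *)
Definition C_derive_n (f : C -> C) (n : nat) : C -> C := Nat.iter n C_derive f.

Definition BesselJ (q : nat) (z : C) : C :=
  C_series (fun m : nat =>
    (-1) ^ m / (INR (fact m) * INR (fact (m + q))) * (z / 2) ^ (2 * m + q)).

Definition dBesselJ (q n : nat) : C -> C := C_derive_n (BesselJ q) n.

(* [c : Z -> C] is the family of coefficients of the Laurent expansion of [f]
   on some punctured disc about 0; the analytic and principal parts are required
   to converge separately. *)
Definition is_Laurent_expansion_0 (f : C -> C) (c : Z -> C) : Prop :=
  exists r : R, (0 < r)%R /\
    forall w : C, w <> 0 -> (Cmod w < r)%R ->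
      exists l1 l2 : C,
        @is_series C_AbsRing C_NormedModule
          (fun n : nat => c (Z.of_nat n) * w ^ n) l1 /\
        @is_series C_AbsRing C_NormedModule
          (fun n : nat => c (- Z.of_nat (S n))%Z / w ^ S n) l2 /\
        f w = l1 + l2.

(* Coefficient of [z ^ n], [n : Z]; meaningful when [f] has an isolated
   singularity at 0, the expansion then existing and being unique. *)
Definition Laurent_coef_0 (f : C -> C) (n : Z) : C :=
  @iota C_CompleteNormedModule
    (fun a : C => exists c : Z -> C, is_Laurent_expansion_0 f c /\ c n = a).

Definition sym_partial_sum (t : Z -> C) (N : nat) : C :=
  @sum_n_m C_AbelianMonoid
    (fun k : nat => t (Z.of_nat k) + t (- Z.of_nat k)%Z) 1 N.

Definition is_bi_infinite_sum (t : Z -> C) (l : C) : Prop :=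
  filterlim (sym_partial_sum t) eventually (@locally C_UniformSpace l).

Definition num_fun (q : nat) (w : C) : C := BesselJ q w / (dBesselJ q 1 w) ^ 2.

Definition den_fun (q : nat) (w : C) : C := 1 / (dBesselJ q 1 w) ^ 2.

Definition a2_num (q : nat) (w : C) : C := BesselJ q w / (dBesselJ q 2 w) ^ 2.

Definition a1_num (q : nat) (w : C) : C :=
  dBesselJ q 1 w / (dBesselJ q 2 w) ^ 2
  - BesselJ q w * dBesselJ q 3 w / (dBesselJ q 2 w) ^ 3.

Definition a2_den (q : nat) (w : C) : C := 1 / (dBesselJ q 2 w) ^ 2.

Definition a1_den (q : nat) (w : C) : C :=
  - (dBesselJ q 3 w / (dBesselJ q 2 w) ^ 3).

(* [sum_n_m f 1 0 = 0] gives the empty sum for [q = 2]. *)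
Definition A0_num (q : nat) (z : C) : C :=
  match q with
  | 0%nat => 4 / z ^ 2
  | 1%nat => 0
  | _ => @sum_n_m C_AbelianMonoid
           (fun n : nat => Laurent_coef_0 (num_fun q) (- Z.of_nat n)%Z / z ^ n)
           1 (q - 2)
  end.

Definition A0_den (q : nat) (z : C) : C :=
  match q with
  | 0%nat => 4 / z ^ 2
  | 1%nat => 0
  | _ => @sum_n_m C_AbelianMonoid
           (fun n : nat => Laurent_coef_0 (den_fun q) (- Z.of_nat n)%Z / z ^ n)
           1 (2 * (q - 1))
  end.

(* [zk k], [k >= 1], lists all the positive real zeros of [f] in increasing
   order, extended to negative indices by oddness; [zk 0] is unconstrained. *)
Definition enumerates_zeros (f : C -> C) (zk : Z -> R) : Prop :=
  (forall k : Z, (1 <= k)%Z -> (0 < zk k)%R) /\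
  (forall k : Z, (1 <= k)%Z -> (zk k < zk (k + 1)%Z)%R) /\
  (forall x : R, (0 < x)%R ->
     (f (RtoC x) = 0 <-> exists k : Z, (1 <= k)%Z /\ zk k = x)) /\
  (forall k : Z, (1 <= k)%Z -> zk (- k)%Z = (- zk k)%R).

(* Main.v *)
Require Import Defs.
From Stdlib Require Import Reals ZArith.
From Stdlib Require Import Lia Lra Psatz Classical IndefiniteDescription.
From Coquelicot Require Import Coquelicot.

(** Both [f = J_q / J_q'^2] and [f = 1 / J_q'^2] are meromorphic. By Bessel's equation the
zeros of [J_q'] other than 0 are real and simple, so the poles of [f] are double poles at
the [z_k], and possibly a pole at 0. Hence the mean over [|w| = r] of [w / (w - z) f w] is
[f z] minus the principal parts at [z] of the poles inside the circle, and it remains to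
find the limit of this mean, which is 0 for [J_q / J_q'^2] and 1 for [1 / J_q'^2]: this is
the 1 in the denominator. The quotient of the two expansions is [J_q].

The radii [r] are zeros of [J_q] lying between consecutive [z_k]. There, in the first
quadrant, [sqrt w J_q' w = v cos (w - r)] up to a relative error [O(1/r)], where
[v = sqrt r J_q' r], and the other quadrants follow by symmetry. So [f] decays away from the
real axis; the numerator mean is [O(1 / sqrt r)], while the denominator mean reduces to the
integral of [w / (v cos (w - r))^2], which is explicit and gives [2 / (PI v^2)].

Finally [v^2] tends to [2 / PI]. The value of this connection constant is obtained by
following the solution along the quarter circle to the imaginary axis, where
[J_0 (i r) = I_0 r] is asymptotic to [exp r / sqrt (2 PI r)] because the Wallis product
controls the quotient of its Taylor coefficients by those of [cosh]. *)

(** The symmetric partial sums need no separate proof of convergence. For each contour, the sum over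
    the enclosed poles equals [f z] minus the part at 0 minus the mean, exactly; convergence and
    value both follow from the limit of the mean. The kernel is [w / (w - z)] because the mean of a
    holomorphic function over a circle is its value at the centre, and a function holomorphic
    outside has its value at infinity as mean; poles inside then contribute 0. The mean value
    property comes from differentiating in the radius.

    The denominator is the delicate case: [1 / J_q'^2] has size [r] on arcs of angle about [1 / r]
    next to the real axis. This part does not vanish in the limit, so its leading term is integrated
    exactly. At a zero [r] of [J_q] the amplitudes of both exponentials are [v exp (- i r)] and
    [v exp (i r)], so the phase of [J_q] at infinity is never computed, only its amplitude. The
    limit of the amplitude is the same for all [q], since on the imaginary axis consecutive orders
    differ by a factor [i] up to lower order. *)

Open Scope C_scope.

(** * Caratheodory derivatives *)

(* [ring] does not recognize [C] when it appears as the carrier of a structure. *)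
Ltac cring :=
  cbv beta;
  repeat match goal with x : UniformSpace.sort _ |- _ => change C in (type of x) end;
  match goal with |- @eq _ ?a ?b => change (@eq C a b) end; ring.

(** An epsilon form in [Cmod] over any uniform space: the same estimates serve on [C], on [R], and
    on the product [R * R] that occurs in differentiation under the integral sign. *)
Definition cont {X : UniformSpace} (f : X -> C) (x : X) : Prop :=
  forall eps : R, (0 < eps)%R -> locally x (fun y => (Cmod (f y - f x) < eps)%R).

(* [e] is the identity of [C] or the embedding of [R], so that complex derivatives
   and derivatives of curves obey the same rules. *)
Definition cara {X : UniformSpace} (e f : X -> C) (x : X) (l : C) : Prop :=
  exists phi : X -> C, cont phi x /\ phi x = l /\
    locally x (fun y => f y = f x + phi y * (e y - e x)).

Definition cderiv (f : C -> C) (z l : C) : Prop :=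
  @cara C_UniformSpace (fun w => w) f z l.

Definition rderiv (g : R -> C) (t : R) (l : C) : Prop :=
  @cara R_UniformSpace RtoC g t l.

Lemma Ceq_dec (x y : C) : {x = y} + {x <> y}.
Proof.
  destruct x as [a b], y as [c d].
  destruct (Req_EM_T a c) as [->|N]; [destruct (Req_EM_T b d) as [->|N]|].
  - now left.
  - right. intro E. now injection E.
  - right. intro E. now injection E.
Qed.

Lemma Cmult_integral (x y : C) : x * y = 0 -> x = 0 \/ y = 0.
Proof.
  intros E. destruct (Ceq_dec x 0) as [H|H]; auto. destruct (Ceq_dec y 0) as [K|K]; auto.
  exfalso. now apply (Cmult_neq_0 x y).
Qed.

Lemma Cminus_eq_0 (x y : C) : x - y = 0 -> x = y.
Proof. intros E. replace x with (x - y + y) by ring. rewrite E. ring. Qed.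

Lemma Cmod_triangle_sub (x y : C) : (Cmod (x - y) <= Cmod x + Cmod y)%R.
Proof.
  unfold Cminus. rewrite <- (Cmod_opp y). apply Cmod_triangle.
Qed.

Lemma Cmod_sub_sym (x y : C) : Cmod (x - y) = Cmod (y - x).
Proof. rewrite <- Cmod_opp. f_equal. ring. Qed.

Lemma Cmod_triangle_inv (x y : C) : (Cmod x - Cmod y <= Cmod (x - y))%R.
Proof.
  generalize (Cmod_triangle (x - y) y). replace (x - y + y) with x by ring. lra.
Qed.

(** The uniform structure of [C] is the product one, whose balls are squares; the factor [sqrt 2]
    compares a square with a disc. *)
Lemma locally_Cmod (z : C) (P : C -> Prop) :
  @locally C_UniformSpace z P <->
  exists d : R, (0 < d)%R /\ forall w, (Cmod (w - z) < d)%R -> P w.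
Proof.
  split.
  - intros [d H]. exists (pos d). split; [apply cond_pos|].
    intros w Hw. apply H. apply (C_NormedModule_mixin_compat1 z w). exact Hw.
  - intros [d [Hd H]].
    assert (H2 : (0 < sqrt 2)%R) by (apply sqrt_lt_R0; lra).
    assert (Hd' : (0 < d / sqrt 2)%R) by (apply Rdiv_lt_0_compat; lra).
    exists (mkposreal _ Hd'). intros w Hw. apply H.
    generalize (C_NormedModule_mixin_compat2 z w _ Hw). simpl.
    replace (sqrt 2 * (d / sqrt 2))%R with d by (field; lra). intro K; exact K.
Qed.

Lemma locally_Rabs (x : R) (P : R -> Prop) :
  @locally R_UniformSpace x P <->
  exists d : R, (0 < d)%R /\ forall y, (Rabs (y - x) < d)%R -> P y.
Proof.
  split.
  - intros [d H]. exists (pos d). split; [apply cond_pos|]. intros y Hy. apply H, Hy.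
  - intros [d [Hd H]]. exists (mkposreal d Hd). intros y Hy. apply H, Hy.
Qed.

Lemma cont_continuous {X : UniformSpace} (f : X -> C) (x : X) :
  cont f x <-> @continuous X C_UniformSpace f x.
Proof.
  split.
  - intros H P HP. apply locally_Cmod in HP. destruct HP as [d [Hd HP]].
    specialize (H d Hd). unfold filtermap. revert H. apply filter_imp. intros y. apply HP.
  - intros H eps He.
    assert (K : @locally C_UniformSpace (f x) (fun w => (Cmod (w - f x) < eps)%R)).
    { apply locally_Cmod. exists eps. split; auto. }
    exact (H _ K).
Qed.

Section Generic.
Context {X : UniformSpace}.
Implicit Types (f g e : X -> C) (x : X).

Lemma cont_const (c : C) x : cont (fun _ : X => c) x.
Proof.
  intros eps He. apply filter_forall. intros _. replace (c - c) with (RtoC 0) by ring. rewrite Cmod_0; auto.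
Qed.

Lemma cont_ext_loc f g x : locally x (fun y => f y = g y) -> cont f x -> cont g x.
Proof.
  intros E H eps He. assert (E0 := locally_singleton _ _ E).
  generalize (filter_and _ _ E (H eps He)). apply filter_imp.
  intros y [Ey Hy]. now rewrite <- Ey, <- E0.
Qed.

Lemma cont_bounded f x : cont f x -> locally x (fun y => (Cmod (f y) < Cmod (f x) + 1)%R).
Proof.
  intros H. generalize (H 1%R Rlt_0_1). apply filter_imp. intros y Hy.
  generalize (Cmod_triangle_inv (f y) (f x)). lra.
Qed.

Lemma cont_plus f g x : cont f x -> cont g x -> cont (fun y => f y + g y) x.
Proof.
  intros Hf Hg eps He. assert (He2 : (0 < eps / 2)%R) by lra.
  generalize (filter_and _ _ (Hf _ He2) (Hg _ He2)). apply filter_imp. intros y [A B].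
  replace (f y + g y - (f x + g x)) with ((f y - f x) + (g y - g x)) by ring.
  generalize (Cmod_triangle (f y - f x) (g y - g x)). lra.
Qed.

Lemma cont_mult f g x : cont f x -> cont g x -> cont (fun y => f y * g y) x.
Proof.
  intros Hf Hg eps He.
  assert (Mf := Cmod_ge_0 (f x)). assert (Mg := Cmod_ge_0 (g x)).
  set (d := (eps / (2 * (Cmod (f x) + Cmod (g x) + 1)))%R).
  assert (Hd : (0 < d)%R) by (apply Rdiv_lt_0_compat; lra).
  generalize (filter_and _ _ (cont_bounded f x Hf) (filter_and _ _ (Hf _ Hd) (Hg _ Hd))).
  apply filter_imp. intros y [B [A1 A2]].
  replace (f y * g y - f x * g x) with (f y * (g y - g x) + g x * (f y - f x)) by ring.
  eapply Rle_lt_trans; [apply Cmod_triangle|]. rewrite !Cmod_mult.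
  assert (P1 := Cmod_ge_0 (f y)). assert (P2 := Cmod_ge_0 (g y - g x)). assert (P3 := Cmod_ge_0 (f y - f x)).
  assert ((Cmod (f y) * Cmod (g y - g x) <= (Cmod (f x) + 1) * d)%R) by (apply Rmult_le_compat; lra).
  assert ((Cmod (g x) * Cmod (f y - f x) <= Cmod (g x) * d)%R) by (apply Rmult_le_compat; lra).
  assert (((Cmod (f x) + Cmod (g x) + 1) * d = eps / 2)%R) by (unfold d; field; lra).
  nra.
Qed.

Lemma cont_opp f x : cont f x -> cont (fun y => - f y) x.
Proof.
  intros H. apply cont_ext_loc with (fun y => (-1) * f y).
  - apply filter_forall. intros; ring.
  - apply cont_mult; auto. apply cont_const.
Qed.

Lemma cont_minus f g x : cont f x -> cont g x -> cont (fun y => f y - g y) x.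
Proof. intros Hf Hg. apply cont_plus; auto. now apply cont_opp. Qed.

Lemma cont_lower f x : cont f x -> f x <> 0 ->
  locally x (fun y => (Cmod (f x) / 2 < Cmod (f y))%R).
Proof.
  intros H H0. apply Cmod_gt_0 in H0. assert (He : (0 < Cmod (f x) / 2)%R) by lra.
  generalize (H _ He). apply filter_imp. intros y Hy.
  generalize (Cmod_triangle_inv (f x) (f y)). rewrite Cmod_sub_sym. lra.
Qed.

Lemma cont_neq_0 f x : cont f x -> f x <> 0 -> locally x (fun y => f y <> 0).
Proof.
  intros H H0. generalize (cont_lower f x H H0). apply filter_imp. intros y Hy E.
  rewrite E, Cmod_0 in Hy. generalize (Cmod_ge_0 (f x)). lra.
Qed.

Lemma cont_inv f x : cont f x -> f x <> 0 -> cont (fun y => / f y) x.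
Proof.
  intros H H0 eps He. assert (H1 := proj1 (Cmod_gt_0 (f x)) H0).
  set (m := Cmod (f x)) in *.
  set (d := (eps * (m * m) / 2)%R).
  assert (Hd : (0 < d)%R) by (apply Rdiv_lt_0_compat; [apply Rmult_lt_0_compat; nra|lra]).
  generalize (filter_and _ _ (cont_neq_0 f x H H0) (filter_and _ _ (cont_lower f x H H0) (H _ Hd))).
  apply filter_imp. intros y [Hn [Hl Hy]]. fold m in Hl.
  replace (/ f y - / f x) with ((f x - f y) / (f y * f x)) by (field; auto).
  rewrite Cmod_div, Cmod_mult by (intro E; apply Cmult_integral in E; tauto). fold m.
  rewrite Cmod_sub_sym. apply Rlt_div_l; [apply Rmult_lt_0_compat; lra|].
  eapply Rlt_le_trans; [exact Hy|]. unfold d.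
  assert ((eps * (m/2*m) <= eps * (Cmod (f y) * m))%R); [|lra].
  apply Rmult_le_compat_l; [lra|]. apply Rmult_le_compat_r; lra.
Qed.

Lemma cont_div f g x : cont f x -> cont g x -> g x <> 0 -> cont (fun y => f y / g y) x.
Proof. intros. apply cont_mult; auto. now apply cont_inv. Qed.

Lemma cont_pow f x n : cont f x -> cont (fun y => f y ^ n) x.
Proof.
  intros H. induction n as [|n IH]; simpl.
  - apply cont_const.
  - now apply cont_mult.
Qed.

Lemma cara_cont e f x l : cont e x -> cara e f x l -> cont f x.
Proof.
  intros He [phi [Hp [_ E]]].
  apply cont_ext_loc with (fun y => f x + phi y * (e y - e x)).
  - revert E. apply filter_imp. auto.
  - apply cont_plus; [apply cont_const|]. apply cont_mult; auto.
    apply cont_minus; auto. apply cont_const.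
Qed.

Lemma cara_const e (c : C) x : cara e (fun _ => c) x 0.
Proof.
  exists (fun _ => 0). split; [apply cont_const|split; auto].
  apply filter_forall. intros; ring.
Qed.

Lemma cara_id e x : cara e e x 1.
Proof.
  exists (fun _ => 1). split; [apply cont_const|split; auto].
  apply filter_forall. intros; ring.
Qed.

Lemma cara_ext_loc e f g x l : locally x (fun y => f y = g y) -> cara e f x l -> cara e g x l.
Proof.
  intros E [phi [Hp [H1 H2]]]. exists phi. split; auto. split; auto.
  assert (E0 := locally_singleton _ _ E).
  generalize (filter_and _ _ E H2). apply filter_imp. intros y [A B]. now rewrite <- A, <- E0.
Qed.

Lemma cara_plus e f g x l m : cara e f x l -> cara e g x m -> cara e (fun y => f y + g y) x (l + m).
Proof.
  intros [p [P1 [P2 P3]]] [q [Q1 [Q2 Q3]]]. exists (fun y => p y + q y).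
  split; [now apply cont_plus|]. split; [now rewrite P2, Q2|].
  generalize (filter_and _ _ P3 Q3). apply filter_imp. intros y [A B]. rewrite A, B; ring.
Qed.

Lemma cara_mult e f g x l m : cont e x -> cara e f x l -> cara e g x m ->
  cara e (fun y => f y * g y) x (l * g x + f x * m).
Proof.
  intros He Hf Hg. assert (Cg := cara_cont _ _ _ _ He Hg).
  destruct Hf as [p [P1 [P2 P3]]], Hg as [q [Q1 [Q2 Q3]]].
  exists (fun y => p y * g y + f x * q y). split.
  { apply cont_plus; apply cont_mult; auto. apply cont_const. }
  split; [now rewrite P2, Q2|].
  generalize (filter_and _ _ P3 Q3). apply filter_imp. intros y [A B]. rewrite A.
  replace (g x) with (g y - q y * (e y - e x)) by (rewrite B; ring). ring.
Qed.

Lemma cara_scal e f x (c l : C) : cara e f x l -> cara e (fun y => c * f y) x (c * l).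
Proof.
  intros [p [P1 [P2 P3]]]. exists (fun y => c * p y). split.
  { apply cont_mult; auto. apply cont_const. }
  split; [now rewrite P2|]. revert P3. apply filter_imp. intros y A. rewrite A; ring.
Qed.

Lemma cara_opp e f x l : cara e f x l -> cara e (fun y => - f y) x (- l).
Proof.
  intros [p [P1 [P2 P3]]]. exists (fun y => - p y). split; [now apply cont_opp|].
  split; [now rewrite P2|]. revert P3. apply filter_imp. intros y A. rewrite A; ring.
Qed.

Lemma cara_minus e f g x l m : cara e f x l -> cara e g x m -> cara e (fun y => f y - g y) x (l - m).
Proof. intros. apply cara_plus; auto. now apply cara_opp. Qed.

Lemma cara_inv e f x l : cont e x -> cara e f x l -> f x <> 0 ->
  cara e (fun y => / f y) x (- l / (f x * f x)).
Proof.
  intros He Hf H0. assert (Cf := cara_cont _ _ _ _ He Hf).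
  destruct Hf as [p [P1 [P2 P3]]]. exists (fun y => - p y / (f y * f x)). split.
  { apply cont_div; [now apply cont_opp| |].
    - apply cont_mult; auto. apply cont_const.
    - intro E; apply Cmult_integral in E; tauto. }
  split; [now rewrite P2|].
  generalize (filter_and _ _ P3 (cont_neq_0 _ _ Cf H0)). apply filter_imp. intros y [A B].
  replace (/ f x + - p y / (f y * f x) * (e y - e x)) with
     ((f y - p y * (e y - e x)) / (f y * f x)) by (field; auto).
  replace (f y - p y * (e y - e x)) with (f x) by (rewrite A; ring). field; auto.
Qed.

Lemma cara_div e f g x l m : cont e x -> cara e f x l -> cara e g x m -> g x <> 0 ->
  cara e (fun y => f y / g y) x ((l * g x - f x * m) / (g x * g x)).
Proof.
  intros He Hf Hg H0.
  replace ((l * g x - f x * m) / (g x * g x)) with (l * / g x + f x * (- m / (g x * g x))) by (field; auto).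
  apply cara_mult; auto. now apply cara_inv.
Qed.

(** The slope of the composite is the product [P (f y) * q y]. No quotient occurs, so points with
    [f y = f x] need no separate case. *)
Lemma cara_comp e f x l (F : C -> C) (L : C) : cont e x -> cara e f x l -> cderiv F (f x) L ->
  cara e (fun y => F (f y)) x (L * l).
Proof.
  intros He Hf [P [P1 [P2 P3]]]. assert (Cf := cara_cont _ _ _ _ He Hf).
  destruct Hf as [q [Q1 [Q2 Q3]]].
  exists (fun y => P (f y) * q y). split.
  { apply cont_mult; auto. apply cont_continuous.
    apply continuous_comp with (g := P); now apply cont_continuous. }
  split; [now rewrite P2, Q2|].
  apply cont_continuous in Cf. specialize (Cf _ P3). unfold filtermap in Cf.
  generalize (filter_and _ _ Q3 Cf). apply filter_imp. intros y [A B]. rewrite B.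
  replace (e y - e x) with (e y - e x) by ring.
  replace (f y - f x) with (q y * (e y - e x)) by (rewrite A; ring). ring.
Qed.

Lemma cont_comp f x (F : C -> C) : cont f x -> @cont C_UniformSpace F (f x) -> cont (fun y => F (f y)) x.
Proof.
  intros Hf HF. apply cont_continuous. apply continuous_comp with (g := F); now apply cont_continuous.
Qed.

Lemma cont_conj f x : cont f x -> cont (fun y => Cconj (f y)) x.
Proof.
  intros H eps He. generalize (H eps He). apply filter_imp. intros y Hy.
  now rewrite <- Cminus_conj, Cmod_conj.
Qed.

End Generic.

Lemma cont_idC (z : C) : @cont C_UniformSpace (fun w => w) z.
Proof. apply cont_continuous. apply continuous_id. Qed.

Lemma cont_RtoC (t : R) : @cont R_UniformSpace RtoC t.
Proof.
  intros eps He. apply locally_Rabs. exists eps. split; auto. intros y Hy.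
  now rewrite <- RtoC_minus, Cmod_R.
Qed.
#[global] Hint Resolve cont_idC cont_RtoC : core.

Lemma cara_unique_C (f : C -> C) (z l m : C) : cderiv f z l -> cderiv f z m -> l = m.
Proof.
  intros [p [P1 [P2 P3]]] [q [Q1 [Q2 Q3]]].
  destruct (Ceq_dec l m) as [E|E]; auto. exfalso.
  assert (D : @cont C_UniformSpace (fun w => p w - q w) z) by now apply cont_minus.
  assert (N : p z - q z <> 0) by (rewrite P2, Q2; intro; apply E; now apply Cminus_eq_0).
  generalize (filter_and _ _ (cont_neq_0 _ _ D N) (filter_and _ _ P3 Q3)).
  intros H. apply locally_Cmod in H. destruct H as [d [Hd H]].
  destruct (H (z + RtoC (d/2))) as [A [B B']].
  { replace (z + RtoC (d/2) - z) with (RtoC (d/2)) by ring. rewrite Cmod_R, Rabs_pos_eq; lra. }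
  apply A. rewrite B in B'. replace (z + RtoC (d / 2) - z) with (RtoC (d/2)) in B' by ring.
  assert (N2 : RtoC (d/2) <> 0) by (intro K; apply RtoC_inj in K; lra).
  assert (K : (p (z + RtoC (d/2)) - q (z + RtoC (d/2))) * RtoC (d/2) = 0).
  { assert (K : p (z + RtoC (d / 2)) * RtoC (d/2) = q (z + RtoC (d / 2)) * RtoC (d/2)).
    { replace (p (z + RtoC (d / 2)) * RtoC (d / 2)) with (f z + p (z + RtoC (d / 2)) * RtoC (d / 2) - f z) by ring.
      rewrite B'. ring. }
    rewrite Cmult_comm. unfold Cminus. rewrite Cmult_plus_distr_l, Cmult_comm, K. ring. }
  apply Cmult_integral in K. tauto.
Qed.

Lemma is_derive_cderiv (f : C -> C) (z l : C) :
  cderiv f z l -> @is_derive C_AbsRing C_NormedModule f z l.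
Proof.
  intros [p [P1 [P2 P3]]]. split; [apply is_linear_scal_l|].
  intros x Hx eps.
  assert (x = z) as ->.
  { symmetry. apply (@is_filter_lim_locally_unique C_AbsRing (AbsRing_NormedModule C_AbsRing) z x).
    exact Hx. }
  generalize (filter_and _ _ P3 (P1 eps (cond_pos eps))). intros H.
  apply locally_C. revert H. apply filter_imp. intros w [A B].
  change (Cmod (f w - f z - (w - z) * l) <= eps * Cmod (w - z))%R.
  replace (f w - f z - (w - z) * l) with ((p w - l) * (w - z)) by (rewrite A; ring).
  rewrite Cmod_mult. apply Rmult_le_compat_r; [apply Cmod_ge_0|]. rewrite <- P2. lra.
Qed.

Lemma C_derive_cderiv (f : C -> C) (z l : C) : cderiv f z l -> C_derive f z = l.
Proof. intros H. apply is_C_derive_unique, is_derive_cderiv, H. Qed.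

Lemma cderiv_ext (f g : C -> C) z l : (forall w, f w = g w) -> cderiv f z l -> cderiv g z l.
Proof. intros E. apply cara_ext_loc. now apply filter_forall. Qed.

Lemma rderiv_ext (f g : R -> C) t l : (forall w, f w = g w) -> rderiv f t l -> rderiv g t l.
Proof. intros E. apply cara_ext_loc. now apply filter_forall. Qed.

Lemma cderiv_cont f z l : cderiv f z l -> @cont C_UniformSpace f z.
Proof. apply cara_cont. auto. Qed.

Lemma rderiv_cont f t l : rderiv f t l -> @cont R_UniformSpace f t.
Proof. apply cara_cont. auto. Qed.

Lemma rderiv_comp (g : R -> C) t l F L :
  rderiv g t l -> cderiv F (g t) L -> rderiv (fun s => F (g s)) t (L * l).
Proof. apply cara_comp. auto. Qed.

Lemma rderiv_mult (f g : R -> C) t l m :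
  rderiv f t l -> rderiv g t m -> rderiv (fun s => f s * g s) t (l * g t + f t * m).
Proof. apply cara_mult. auto. Qed.

Lemma rderiv_conj (f : R -> C) t l : rderiv f t l -> rderiv (fun s => Cconj (f s)) t (Cconj l).
Proof.
  intros [p [P1 [P2 P3]]]. exists (fun y => Cconj (p y)). split; [now apply cont_conj|].
  split; [now rewrite P2|]. revert P3. apply filter_imp. intros y A.
  rewrite A, Cplus_conj, Cmult_conj, Cminus_conj. f_equal. f_equal.
  unfold Cconj, RtoC, Cminus, Cplus, Copp; simpl; f_equal; ring.
Qed.

Lemma rderiv_Re (f : R -> C) t l : rderiv f t l -> is_derive (fun s => Re (f s)) t (Re l).
Proof.
  intros [p [P1 [P2 P3]]]. split; [apply is_linear_scal_l|].
  intros x Hx eps.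
  assert (x = t) as -> by (symmetry; exact (is_filter_lim_locally_unique t x Hx)).
  generalize (filter_and _ _ P3 (P1 eps (cond_pos eps))). apply filter_imp. intros y [A B].
  change (Rabs (Re (f y) - Re (f t) - (y - t) * Re l) <= eps * Rabs (y - t))%R.
  replace (Re (f y) - Re (f t) - (y - t) * Re l)%R with (Re (p y - l) * (y - t))%R.
  - rewrite Rabs_mult. apply Rmult_le_compat_r; [apply Rabs_pos|].
    eapply Rle_trans; [apply re_le_Cmod|]. rewrite <- P2. lra.
  - rewrite A. destruct (p y), l, (f t); unfold Re, Cmult, Cplus, Cminus, Copp, RtoC; simpl; ring.
Qed.

Lemma rderiv_Im (f : R -> C) t l : rderiv f t l -> is_derive (fun s => Im (f s)) t (Im l).
Proof.
  intros H. assert (K := cara_scal _ _ _ (- Ci) _ H). apply rderiv_Re in K.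
  replace (Im l) with (Re (- Ci * l)) by (destruct l; unfold Re, Im, Ci, Cmult, Copp; simpl; ring).
  revert K. apply is_derive_ext. intros s.
  destruct (f s); unfold Re, Im, Ci, Cmult, Copp; simpl; ring.
Qed.

Lemma rderiv_RtoC (f : R -> R) t l : is_derive f t l -> rderiv (fun s => RtoC (f s)) t (RtoC l).
Proof.
  intros [_ H]. specialize (H t (fun P HP => HP)).
  (* The difference quotient completed by the derivative at [t]; its continuity at [t] is exactly
     differentiability. *)
  exists (fun s => if Req_EM_T s t then RtoC l else RtoC ((f s - f t) / (s - t))).
  split; [|split].
  - intros eps He. assert (He2 : (0 < eps / 2)%R) by lra.
    generalize (H (mkposreal _ He2)). apply filter_imp. intros s Hs.
    destruct (Req_EM_T t t) as [_|N]; [|congruence].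
    destruct (Req_EM_T s t) as [E|E].
    + replace (RtoC l - RtoC l) with (RtoC 0) by ring. now rewrite Cmod_0.
    + rewrite <- RtoC_minus, Cmod_R.
      change (Rabs (f s - f t - (s - t) * l) <= eps / 2 * Rabs (s - t))%R in Hs.
      replace ((f s - f t) / (s - t) - l)%R with ((f s - f t - (s - t) * l) / (s - t))%R by (field; lra).
      assert (0 < Rabs (s - t))%R by (apply Rabs_pos_lt; lra).
      unfold Rdiv. rewrite Rabs_mult, Rabs_inv. apply Rlt_div_l; auto.
      eapply Rle_lt_trans; [exact Hs|]. apply Rmult_lt_compat_r; lra.
  - destruct (Req_EM_T t t); congruence.
  - apply filter_forall. intros s. destruct (Req_EM_T s t) as [->|E].
    + rewrite <- RtoC_minus. replace (t - t)%R with 0%R by ring. ring.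
    + rewrite <- RtoC_minus, <- RtoC_mult, <- RtoC_plus. f_equal. field. lra.
Qed.

Lemma rderiv_C_R (f : R -> C) t l :
  rderiv f t l -> @is_derive R_AbsRing C_R_NormedModule f t l.
Proof.
  intros [p [P1 [P2 P3]]]. split; [apply is_linear_scal_l|].
  intros x Hx eps.
  assert (x = t) as -> by (symmetry; exact (is_filter_lim_locally_unique t x Hx)).
  generalize (filter_and _ _ P3 (P1 eps (cond_pos eps))). apply filter_imp. intros y [A B].
  assert (E : @norm R_AbsRing C_R_NormedModule (minus (minus (f y) (f t)) (scal (minus y t) l)) = Cmod (f y - f t - RtoC (y - t) * l)).
  { rewrite Cmod_norm. unfold C_R_NormedModule. f_equal.
    destruct (f y) as [a1 a2], (f t) as [b1 b2], l as [c1 c2]; apply injective_projections.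
    - change (a1 + - b1 + - ((y + - t) * c1) = a1 + - b1 + - ((y - t) * c1 - 0 * c2))%R. ring.
    - change (a2 + - b2 + - ((y + - t) * c2) = a2 + - b2 + - ((y - t) * c2 + 0 * c1))%R. ring. }
  eapply Rle_trans; [right; exact E|].
  change (Cmod (f y - f t - RtoC (y - t) * l) <= eps * Rabs (y - t))%R.
  rewrite RtoC_minus.
  replace (f y - f t - (RtoC y - RtoC t) * l) with ((p y - l) * (RtoC y - RtoC t)) by (rewrite A; ring).
  rewrite Cmod_mult, <- RtoC_minus, Cmod_R. apply Rmult_le_compat_r; [apply Rabs_pos|]. rewrite <- P2. lra.
Qed.

(** * Locally holomorphic functions and iterated divided differences *)

(** Continuity of the derivative is built in because the mean value property is obtained by
    differentiating under the integral sign. *)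
Definition hol (f : C -> C) (a : C) : Prop :=
  exists df : C -> C, @locally C_UniformSpace a (fun w => cderiv f w (df w)) /\
    @cont C_UniformSpace df a.

(* In the absence of Goursat's theorem, iterated divided differences at [a] play the
   role of analyticity: [An n f a] allows [n] factors [w - a] to be divided out. *)
Fixpoint An (n : nat) (f : C -> C) (a : C) : Prop :=
  match n with
  | O => hol f a
  | S n => exists g, An n g a /\
      @locally C_UniformSpace a (fun w => f w = f a + (w - a) * g w)
  end.

Lemma hol_ext f g a : @locally C_UniformSpace a (fun w => f w = g w) -> hol f a -> hol g a.
Proof.
  intros E [df [D1 D2]]. exists df. split; auto.
  apply locally_locally in E. generalize (filter_and _ _ E D1). apply filter_imp.
  intros w [A B]. now apply cara_ext_loc with f.
Qed.

Lemma hol_cderiv f a : hol f a -> exists l, cderiv f a l.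
Proof. intros [df [D _]]. exists (df a). exact (locally_singleton _ _ D). Qed.

Lemma hol_cont f a : hol f a -> @cont C_UniformSpace f a.
Proof. intros H. destruct (hol_cderiv _ _ H) as [l Hl]. eapply cderiv_cont, Hl. Qed.

Lemma hol_const c a : hol (fun _ => c) a.
Proof.
  exists (fun _ => 0). split; [|apply cont_const]. apply filter_forall. intros w. apply cara_const.
Qed.

Lemma hol_id a : hol (fun w => w) a.
Proof.
  exists (fun _ => 1). split; [|apply cont_const]. apply filter_forall. intros w. apply cara_id.
Qed.

Lemma hol_plus f g a : hol f a -> hol g a -> hol (fun w => f w + g w) a.
Proof.
  intros [df [D1 D2]] [dg [G1 G2]]. exists (fun w => df w + dg w). split.
  - generalize (filter_and _ _ D1 G1). apply filter_imp. intros w [A B]. now apply cara_plus.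
  - now apply cont_plus.
Qed.

Lemma hol_mult f g a : hol f a -> hol g a -> hol (fun w => f w * g w) a.
Proof.
  intros Hf Hg. assert (Cf := hol_cont _ _ Hf). assert (Cg := hol_cont _ _ Hg).
  destruct Hf as [df [D1 D2]], Hg as [dg [G1 G2]]. exists (fun w => df w * g w + f w * dg w). split.
  - generalize (filter_and _ _ D1 G1). apply filter_imp. intros w [A B]. apply cara_mult; auto.
  - apply cont_plus; now apply cont_mult.
Qed.

Lemma hol_inv f a : hol f a -> f a <> 0 -> hol (fun w => / f w) a.
Proof.
  intros Hf H0. assert (Cf := hol_cont _ _ Hf).
  destruct Hf as [df [D1 D2]]. exists (fun w => - df w / (f w * f w)). split.
  - generalize (filter_and _ _ D1 (cont_neq_0 _ _ Cf H0)). apply filter_imp.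
    intros w [A B]. apply cara_inv; auto.
  - apply cont_div; [now apply cont_opp|now apply cont_mult|].
    intro E; apply Cmult_integral in E; tauto.
Qed.

Lemma hol_opp f a : hol f a -> hol (fun w => - f w) a.
Proof.
  intros H. apply hol_ext with (fun w => (-1) * f w).
  - apply filter_forall; intros; ring.
  - apply hol_mult; auto. apply hol_const.
Qed.

Lemma hol_minus f g a : hol f a -> hol g a -> hol (fun w => f w - g w) a.
Proof. intros. apply hol_plus; auto. now apply hol_opp. Qed.

Lemma hol_div f g a : hol f a -> hol g a -> g a <> 0 -> hol (fun w => f w / g w) a.
Proof. intros. apply hol_mult; auto. now apply hol_inv. Qed.

Lemma hol_pow f a n : hol f a -> hol (fun w => f w ^ n) a.
Proof. intros H. induction n as [|n IH]; simpl; [apply hol_const|now apply hol_mult]. Qed.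

Lemma An_ext n f g a : @locally C_UniformSpace a (fun w => f w = g w) -> An n f a -> An n g a.
Proof.
  destruct n as [|n]; simpl; [apply hol_ext|].
  intros E [h [H1 H2]]. exists h. split; auto. assert (E0 := locally_singleton _ _ E).
  generalize (filter_and _ _ E H2). apply filter_imp. intros w [A B]. now rewrite <- A, <- E0.
Qed.

Lemma An_const n c a : An n (fun _ => c) a.
Proof.
  revert c; induction n as [|n IH]; intros c; simpl; [apply hol_const|].
  exists (fun _ => 0). split; auto. apply filter_forall; intros; ring.
Qed.

Lemma An_id n a : An n (fun w => w) a.
Proof.
  destruct n as [|n]; simpl; [apply hol_id|].
  exists (fun _ => 1). split; [apply An_const|]. apply filter_forall; intros; cring.
Qed.

Lemma An_S n f a : An (S n) f a -> An n f a.
Proof.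
  revert f; induction n as [|n IH]; intros f [g [G1 G2]]; simpl in *.
  - apply hol_ext with (fun w => f a + (w - a) * g w).
    + revert G2. apply filter_imp. auto.
    + apply hol_plus; [apply hol_const|]. apply hol_mult; auto.
      apply hol_minus; [apply hol_id|apply hol_const].
  - exists g. split; auto.
Qed.

Lemma An_le n m f a : (m <= n)%nat -> An n f a -> An m f a.
Proof. intros H; induction H; auto. intros K. apply IHle. now apply An_S. Qed.

Lemma An_plus n f g a : An n f a -> An n g a -> An n (fun w => f w + g w) a.
Proof.
  revert f g; induction n as [|n IH]; intros f g; simpl; [apply hol_plus|].
  intros [p [P1 P2]] [q [Q1 Q2]]. exists (fun w => p w + q w). split; [now apply IH|].
  generalize (filter_and _ _ P2 Q2). apply filter_imp. intros w [A B]. rewrite A, B. ring.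
Qed.

Lemma An_mult n f g a : An n f a -> An n g a -> An n (fun w => f w * g w) a.
Proof.
  revert f g; induction n as [|n IH]; intros f g; [simpl; apply hol_mult|].
  intros Hf Hg. assert (Hg' := An_S _ _ _ Hg). revert Hf Hg; simpl.
  intros [p [P1 P2]] [q [Q1 Q2]]. exists (fun w => p w * g w + f a * q w). split.
  - apply An_plus; apply IH; auto. apply An_const.
  - generalize (filter_and _ _ P2 Q2). apply filter_imp. intros w [A B]. 
    replace (f a) with (f w - (w - a) * p w) by (rewrite A; ring).
    replace (g a) with (g w - (w - a) * q w) by (rewrite B; ring). ring.
Qed.

(** [1 / f w - 1 / f a = - (w - a) * p w / (f a * f w)]: the slope contains [1 / f] again, but only
    to one order less, so the induction applies. *)
Lemma An_inv n f a : An n f a -> f a <> 0 -> An n (fun w => / f w) a.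
Proof.
  revert f; induction n as [|n IH]; intros f; [simpl; apply hol_inv|].
  intros Hf H0. assert (Hf' := An_S _ _ _ Hf).
  assert (Cf : @cont C_UniformSpace f a) by (apply hol_cont; apply (An_le n 0); [lia|auto]).
  revert Hf; simpl. intros [p [P1 P2]].
  exists (fun w => ((-1) * / f a) * (p w * / f w)). split.
  - apply An_mult; [apply An_const|]. apply An_mult; auto.
  - generalize (filter_and _ _ P2 (cont_neq_0 _ _ Cf H0)). apply filter_imp. intros w [A B].
    replace (/ f a + (w - a) * (-1 * / f a * (p w * / f w))) with
      ((f w - (w - a) * p w) / (f a * f w)) by (field; auto).
    replace (f w - (w - a) * p w) with (f a) by (rewrite A; ring). field; auto.
Qed.

Lemma An_opp n f a : An n f a -> An n (fun w => - f w) a.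
Proof.
  intros H. apply An_ext with (fun w => (-1) * f w).
  - apply filter_forall; intros; ring.
  - apply An_mult; auto. apply An_const.
Qed.

Lemma An_minus n f g a : An n f a -> An n g a -> An n (fun w => f w - g w) a.
Proof. intros. apply An_plus; auto. now apply An_opp. Qed.

Lemma An_div n f g a : An n f a -> An n g a -> g a <> 0 -> An n (fun w => f w / g w) a.
Proof. intros. apply An_mult; auto. now apply An_inv. Qed.

Lemma An_pow n f a k : An n f a -> An n (fun w => f w ^ k) a.
Proof. intros H. induction k as [|k IH]; simpl; [apply An_const|now apply An_mult]. Qed.

Lemma An_hol n f a : An n f a -> hol f a.
Proof. apply (An_le n 0). lia. Qed.

(** * Entire power series *)

Notation Csum := (@sum_n C_AbelianMonoid).
Notation is_Cseries := (@is_series C_AbsRing C_NormedModule).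

Lemma Csum_O (a : nat -> C) : Csum a 0 = a 0%nat.
Proof. apply sum_O. Qed.

Lemma Csum_S (a : nat -> C) n : Csum a (S n) = Csum a n + a (S n).
Proof. exact (sum_Sn a n). Qed.

Lemma Csum_zero (a : nat -> C) n : (forall k, (k <= n)%nat -> a k = 0) -> Csum a n = RtoC 0.
Proof.
  induction n as [|n IH]; intros H.
  - rewrite Csum_O. auto.
  - rewrite Csum_S, IH, H by auto. cring.
Qed.

Lemma filterlim_Cseq (u : nat -> C) (l : C) :
  filterlim u eventually (@locally C_UniformSpace l) <->
  forall eps : R, (0 < eps)%R -> exists N, forall n, (N <= n)%nat -> (Cmod (u n - l) < eps)%R.
Proof.
  split.
  - intros H eps He. apply (H (fun w => (Cmod (w - l) < eps)%R)).
    apply locally_Cmod. exists eps; auto.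
  - intros H P HP. apply locally_Cmod in HP. destruct HP as [d [Hd HP]].
    destruct (H d Hd) as [N HN]. exists N. intros n Hn. apply HP. auto.
Qed.

Lemma is_Cseries_eps (a : nat -> C) (l : C) :
  is_Cseries a l <->
  forall eps : R, (0 < eps)%R -> exists N, forall n, (N <= n)%nat -> (Cmod (Csum a n - l) < eps)%R.
Proof. exact (filterlim_Cseq (Csum a) l). Qed.

Lemma Cseq_lim_unique (u : nat -> C) (l m : C) :
  (forall eps : R, (0 < eps)%R -> exists N, forall n, (N <= n)%nat -> (Cmod (u n - l) < eps)%R) ->
  (forall eps : R, (0 < eps)%R -> exists N, forall n, (N <= n)%nat -> (Cmod (u n - m) < eps)%R) ->
  l = m.
Proof.
  intros Hl Hm. apply Cminus_eq_0, Cmod_eq_0.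
  destruct (Rle_lt_or_eq_dec 0 _ (Cmod_ge_0 (l - m))) as [H|H]; [|lra]. exfalso.
  assert (H2 : (0 < Cmod (l - m) / 2)%R) by lra.
  destruct (Hl _ H2) as [N HN], (Hm _ H2) as [K HK].
  specialize (HN (N + K)%nat ltac:(lia)). specialize (HK (N + K)%nat ltac:(lia)).
  generalize (Cmod_triangle_sub (u (N + K)%nat - m) (u (N + K)%nat - l)).
  replace (u (N + K)%nat - m - (u (N + K)%nat - l)) with (l - m) by ring. lra.
Qed.

Lemma is_Cseries_unique (a : nat -> C) (l m : C) : is_Cseries a l -> is_Cseries a m -> l = m.
Proof. rewrite !is_Cseries_eps. apply Cseq_lim_unique. Qed.

Lemma C_series_unique (a : nat -> C) (l : C) : is_Cseries a l -> C_series a = l.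
Proof.
  intros H. unfold C_series. apply (@iota_unique C_AbsRing C_CompleteNormedModule).
  - intros y Hy. exact (is_Cseries_unique a y l Hy H).
  - exact H.
Qed.

Lemma is_Cseries_ext (a b : nat -> C) l : (forall n, a n = b n) -> is_Cseries a l -> is_Cseries b l.
Proof. intros E. now apply is_series_ext. Qed.

Lemma is_Cseries_plus (a b : nat -> C) l m :
  is_Cseries a l -> is_Cseries b m -> is_Cseries (fun n => a n + b n) (l + m).
Proof. intros H K. exact (is_series_plus a b l m H K). Qed.

Lemma is_Cseries_scal (c : C) (a : nat -> C) l :
  is_Cseries a l -> is_Cseries (fun n => c * a n) (c * l).
Proof. intros H. exact (@is_series_scal C_AbsRing C_NormedModule c a l H). Qed.

Lemma is_Cseries_minus (a b : nat -> C) l m :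
  is_Cseries a l -> is_Cseries b m -> is_Cseries (fun n => a n - b n) (l - m).
Proof. intros H K. exact (is_series_minus a b l m H K). Qed.

Lemma is_Cseries_decr_1 (a : nat -> C) (l : C) :
  is_Cseries (fun n => a (S n)) l -> is_Cseries a (a 0%nat + l).
Proof.
  rewrite !is_Cseries_eps. intros H eps He. destruct (H eps He) as [N HN]. exists (S N).
  intros n Hn. destruct n as [|n]; [lia|]. specialize (HN n ltac:(lia)).
  replace (Csum a (S n) - (a 0%nat + l)) with (Csum (fun k => a (S k)) n - l); auto.
  clear HN Hn. induction n as [|n IH].
  - rewrite Csum_S, !Csum_O. ring.
  - rewrite Csum_S. rewrite (Csum_S a (S n)).
    replace (Csum (fun k : nat => a (S k)) n + a (S (S n)) - l)
      with (Csum (fun k : nat => a (S k)) n - l + a (S (S n))) by ring. rewrite IH. ring.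
Qed.

Lemma is_Cseries_term_0 (a : nat -> C) (l : C) : is_Cseries a l ->
  forall eps : R, (0 < eps)%R -> exists N, forall n, (N <= n)%nat -> (Cmod (a n) < eps)%R.
Proof.
  rewrite is_Cseries_eps. intros H eps He. destruct (H (eps / 2)%R ltac:(lra)) as [N HN].
  exists (S N). intros [|n] Hn; [lia|].
  generalize (HN n ltac:(lia)) (HN (S n) ltac:(lia)) (Cmod_triangle_sub (Csum a (S n) - l) (Csum a n - l)).
  rewrite Csum_S. replace (Csum a n + a (S n) - l - (Csum a n - l)) with (a (S n)) by ring. lra.
Qed.

Lemma Cmod_Csum_le (a : nat -> C) (b : nat -> R) n :
  (forall k, (k <= n)%nat -> (Cmod (a k) <= b k)%R) -> (Cmod (Csum a n) <= sum_n b n)%R.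
Proof.
  induction n as [|n IH]; intros H.
  - rewrite Csum_O, sum_O. auto.
  - rewrite Csum_S, sum_Sn. eapply Rle_trans; [apply Cmod_triangle|].
    apply Rplus_le_compat; auto.
Qed.

Lemma is_Cseries_le (a : nat -> C) (b : nat -> R) :
  (forall n, (Cmod (a n) <= b n)%R) -> ex_series b ->
  is_Cseries a (C_series a) /\ (Cmod (C_series a) <= Series b)%R.
Proof.
  intros H Hb.
  destruct (@ex_series_le C_AbsRing C_CompleteNormedModule a b H Hb) as [l Hl].
  change (is_Cseries a l) in Hl. rewrite (C_series_unique a l Hl). split; auto.
  apply le_epsilon. intros eps He. rewrite is_Cseries_eps in Hl.
  destruct (Hl eps He) as [N HN]. specialize (HN N ltac:(lia)).
  assert (S1 : (Cmod (Csum a N) <= sum_n b N)%R) by (apply Cmod_Csum_le; auto).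
  assert (S2 : (sum_n b N <= Series b)%R).
  { apply Series_correct in Hb.
    apply (is_lim_seq_incr_compare (sum_n b)); [exact Hb|].
    intros n. rewrite sum_Sn. generalize (H (S n)) (Cmod_ge_0 (a (S n))). unfold plus; simpl. lra. }
  generalize (Cmod_triangle_inv l (Csum a N)). rewrite Cmod_sub_sym. lra.
Qed.

Lemma Rle_mult_div (a b c : R) : (0 < c)%R -> (a * c <= b)%R -> (a <= b / c)%R.
Proof. intros Hc H. now apply Rle_div_r. Qed.

(** Infinite radius of convergence, stated as boundedness of [c n * r ^ n] for every [r]. This form
    passes easily to shifts, derivatives and synthetic division. *)
Definition ecoef (c : nat -> C) : Prop :=
  forall r : R, (0 < r)%R -> exists M : R, forall n, (Cmod (c n) * r ^ n <= M)%R.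

Definition PS (c : nat -> C) (z : C) : C := C_series (fun n => c n * z ^ n).

Lemma geom_half : is_series (fun n => (/ 2) ^ n)%R 2%R.
Proof.
  assert (H : is_series (fun n => (/ 2) ^ n)%R (/ (1 - / 2))%R).
  { apply is_series_geom. rewrite Rabs_pos_eq; lra. }
  now replace (/ (1 - / 2))%R with 2%R in H by lra.
Qed.

(** Within half the radius the terms are dominated by [M * (1/2)^n], whose sum is [2 * M]. The
    explicit bound later gives the growth of divided differences and continuity. *)
Lemma PS_le (c : nat -> C) (r M : R) (z : C) :
  (0 < r)%R -> (forall n, (Cmod (c n) * r ^ n <= M)%R) -> (Cmod z <= r / 2)%R ->
  is_Cseries (fun n => c n * z ^ n) (PS c z) /\ (Cmod (PS c z) <= 2 * M)%R.
Proof.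
  intros Hr H Hz.
  assert (G := is_series_scal M _ _ geom_half).
  destruct (is_Cseries_le (fun n => c n * z ^ n) (fun n => (M * (/ 2) ^ n)%R)) as [A B].
  - intros n. rewrite Cmod_mult, Cmod_pow.
    apply Rle_trans with (Cmod (c n) * (r ^ n * (/ 2) ^ n))%R.
    + apply Rmult_le_compat_l; [apply Cmod_ge_0|]. rewrite <- Rpow_mult_distr.
      apply pow_incr. split; [apply Cmod_ge_0|lra].
    + rewrite <- Rmult_assoc. apply Rmult_le_compat_r; auto. apply pow_le; lra.
  - eexists. exact G.
  - split; auto. fold (PS c z) in B. eapply Rle_trans; [exact B|]. right.
    replace (2 * M)%R with (M * 2)%R by ring. exact (is_series_unique _ _ G).
Qed.

Lemma PS_is (c : nat -> C) (z : C) : ecoef c -> is_Cseries (fun n => c n * z ^ n) (PS c z).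
Proof.
  intros H. assert (P := Cmod_ge_0 z). assert (Hr : (0 < 2 * Cmod z + 1)%R) by lra.
  destruct (H _ Hr) as [M HM].
  apply (PS_le c (2 * Cmod z + 1) M z Hr HM). lra.
Qed.

Lemma ecoef_shift (c : nat -> C) k : ecoef c -> ecoef (fun n => c (k + n)%nat).
Proof.
  intros H r Hr. destruct (H r Hr) as [M HM]. exists (M / r ^ k)%R. intros n.
  apply Rle_mult_div; [now apply pow_lt|]. specialize (HM (k + n)%nat). cbv beta. rewrite pow_add in HM. lra.
Qed.

Lemma INR_le_pow2 n : (INR n <= 2 ^ n)%R.
Proof.
  induction n as [|n IH]; [simpl; lra|]. rewrite S_INR. simpl.
  assert (1 <= 2 ^ n)%R by (apply pow_R1_Rle; lra). lra.
Qed.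

Lemma ecoef_INR (c : nat -> C) : ecoef c -> ecoef (fun n => RtoC (INR n) * c n).
Proof.
  intros H r Hr. destruct (H (2 * r)%R ltac:(lra)) as [M HM]. exists M. intros n.
  eapply Rle_trans; [|apply (HM n)]. rewrite Cmod_mult, Cmod_R, Rabs_pos_eq by apply pos_INR.
  rewrite Rpow_mult_distr.
  assert (A := INR_le_pow2 n). assert (B := Cmod_ge_0 (c n)). assert (D : (0 <= r ^ n)%R) by (apply pow_le; lra).
  replace (INR n * Cmod (c n) * r ^ n)%R with (INR n * (Cmod (c n) * r ^ n))%R by ring.
  replace (Cmod (c n) * (2 ^ n * r ^ n))%R with (2 ^ n * (Cmod (c n) * r ^ n))%R by ring.
  apply Rmult_le_compat_r; auto. now apply Rmult_le_pos.
Qed.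

Lemma PS_shift (c : nat -> C) (z : C) : ecoef c ->
  PS c z = c 0%nat + z * PS (fun n => c (S n)) z.
Proof.
  intros H. apply C_series_unique.
  assert (K := is_Cseries_scal z _ _ (PS_is _ z (ecoef_shift c 1 H))). simpl in K.
  replace (c 0%nat) with (c 0%nat * z ^ 0) by (simpl; ring).
  apply (is_Cseries_decr_1 (fun n => c n * z ^ n)).
  revert K. apply is_Cseries_ext. intros n. simpl. ring.
Qed.

(* Synthetic division of a power series by [z - a]. *)
Definition ddiff (c : nat -> C) (a : C) (n : nat) : C := PS (fun i => c (S n + i)%nat) a.

Lemma PS_ext (c d : nat -> C) z : ecoef c -> (forall n, c n = d n) -> PS c z = PS d z.
Proof.
  intros H E. symmetry. apply C_series_unique. generalize (PS_is c z H). apply is_Cseries_ext.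
  intros n. now rewrite E.
Qed.

Lemma ddiff_rec (c : nat -> C) a n : ecoef c -> ddiff c a n = c (S n) + a * ddiff c a (S n).
Proof.
  intros H. unfold ddiff. rewrite PS_shift by now apply (ecoef_shift c (S n)).
  replace (S n + 0)%nat with (S n) by lia. f_equal. f_equal. apply PS_ext.
  - intros r Hr. destruct (ecoef_shift c (S (S n)) H r Hr) as [M HM]. exists M. intros i.
    specialize (HM i). now replace (S n + S i)%nat with (S (S n) + i)%nat by lia.
  - intros i. f_equal. lia.
Qed.

Lemma ecoef_ddiff (c : nat -> C) a : ecoef c -> ecoef (ddiff c a).
Proof.
  intros H r Hr. assert (P := Cmod_ge_0 a). set (s := (r + 2 * Cmod a)%R).
  assert (Hs : (0 < s)%R) by (unfold s; lra).
  destruct (H s Hs) as [M HM]. exists (2 * M / s)%R. intros n.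
  destruct (PS_le (fun i => c (S n + i)%nat) s (M / s ^ S n) a Hs) as [_ B].
  - intros i. apply Rle_mult_div; [now apply pow_lt|]. specialize (HM (S n + i)%nat).
    rewrite pow_add in HM. lra.
  - unfold s; lra.
  - fold (ddiff c a n) in B.
    assert (Q : (0 <= M / s ^ S n)%R) by (generalize (Cmod_ge_0 (ddiff c a n)); lra).
    apply Rle_trans with (2 * (M / s ^ S n) * s ^ n)%R.
    + apply Rmult_le_compat; auto. apply Cmod_ge_0. apply pow_le; lra.
      apply pow_incr. unfold s; lra.
    + right. simpl. field. split; [lra|apply pow_nonzero; lra].
Qed.

(** The coefficients [d] of the quotient satisfy [d n = c (S n) + a * d (S n)] by [ddiff_rec], so
    that multiplication by [z - a] telescopes. *)
Lemma PS_ddiff (c : nat -> C) a z : ecoef c -> PS c z = PS c a + (z - a) * PS (ddiff c a) z.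
Proof.
  intros H. assert (G := ecoef_ddiff c a H).
  assert (E1 : PS c z - a * ddiff c a 0 + a * PS (ddiff c a) z = c 0%nat + z * PS (ddiff c a) z).
  { rewrite (PS_shift (ddiff c a) z G) at 1.
    rewrite (PS_shift c z H).
    replace (c 0%nat + z * PS (fun n => c (S n)) z - a * ddiff c a 0 +
      a * (ddiff c a 0%nat + z * PS (fun n => ddiff c a (S n)) z)) with
      (c 0%nat + z * (PS (fun n => c (S n)) z + a * PS (fun n => ddiff c a (S n)) z)) by ring.
    f_equal. f_equal. symmetry. apply C_series_unique.
    apply is_Cseries_ext with (fun n => c (S n) * z ^ n + a * (ddiff c a (S n) * z ^ n)).
    - intros n. rewrite (ddiff_rec c a n H). ring.
    - apply is_Cseries_plus; [apply (PS_is _ z (ecoef_shift c 1 H))|].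
      apply is_Cseries_scal, (PS_is _ z (ecoef_shift _ 1 G)). }
  assert (E2 : PS c a = c 0%nat + a * ddiff c a 0).
  { rewrite (PS_shift c a H). f_equal. }
  replace ((z - a) * PS (ddiff c a) z) with (z * PS (ddiff c a) z - a * PS (ddiff c a) z) by ring.
  replace (z * PS (ddiff c a) z) with (c 0%nat + z * PS (ddiff c a) z - c 0%nat) by ring.
  rewrite <- E1, E2. ring.
Qed.

Definition PSd (c : nat -> C) (n : nat) : C := RtoC (INR (S n)) * c (S n).

Lemma ecoef_PSd c : ecoef c -> ecoef (PSd c).
Proof. intros H. exact (ecoef_shift _ 1 (ecoef_INR c H)). Qed.

(** Abel summation: the partial sum of the divided differences at [a] is that of the derivative plus
    [(N + 1) * d (N + 1) * a^(N + 1)], which tends to 0 as a term of a convergent series. *)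
Lemma PS_ddiff_diag c a : ecoef c -> PS (ddiff c a) a = PS (PSd c) a.
Proof.
  intros H. assert (G := ecoef_ddiff c a H).
  assert (E : forall N, Csum (fun n => ddiff c a n * a ^ n) N =
     Csum (fun n => PSd c n * a ^ n) N + RtoC (INR (S N)) * ddiff c a (S N) * a ^ S N).
  { induction N as [|N IH].
    - rewrite !Csum_O, ddiff_rec by auto. unfold PSd. simpl. ring.
    - rewrite !Csum_S, IH. rewrite (ddiff_rec c a (S N) H). unfold PSd.
      rewrite (S_INR (S N)), RtoC_plus. rewrite (Cpow_S a (S N)). cring. }
  apply Cseq_lim_unique with (Csum (fun n => ddiff c a n * a ^ n)).
  - apply is_Cseries_eps. now apply PS_is.
  - intros eps He.
    assert (K := PS_is _ a (ecoef_PSd c H)). rewrite is_Cseries_eps in K.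
    destruct (K (eps / 2)%R ltac:(lra)) as [N1 H1].
    destruct (is_Cseries_term_0 _ _ (PS_is _ a (ecoef_INR _ G)) (eps / 2)%R ltac:(lra)) as [N2 H2].
    exists (N1 + N2)%nat. intros n Hn. rewrite E.
    specialize (H1 n ltac:(lia)). specialize (H2 (S n) ltac:(lia)).
    generalize (Cmod_triangle (Csum (fun n => PSd c n * a ^ n) n - PS (PSd c) a)
       (RtoC (INR (S n)) * ddiff c a (S n) * a ^ S n)).
    replace (Csum (fun n0 : nat => PSd c n0 * a ^ n0) n - PS (PSd c) a + INR (S n) * ddiff c a (S n) * a ^ S n)
     with (Csum (fun n0 : nat => PSd c n0 * a ^ n0) n + INR (S n) * ddiff c a (S n) * a ^ S n - PS (PSd c) a) by ring.
    cbv beta in H2. lra.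
Qed.

Lemma PS_cont c a : ecoef c -> @cont C_UniformSpace (PS c) a.
Proof.
  intros H eps He. assert (G := ecoef_ddiff c a H). assert (P := Cmod_ge_0 a).
  set (r := (2 * (Cmod a + 1))%R). assert (Hr : (0 < r)%R) by (unfold r; lra).
  destruct (G r Hr) as [M HM].
  assert (M0 : (0 <= M)%R).
  { specialize (HM 0%nat). simpl in HM. generalize (Cmod_ge_0 (ddiff c a 0)). lra. }
  apply locally_Cmod. exists (Rmin 1 (eps / (2 * M + 1)))%R. split.
  { apply Rmin_pos; [lra|]. apply Rdiv_lt_0_compat; lra. }
  intros w Hw.
  assert (W1 : (Cmod (w - a) < 1)%R) by (eapply Rlt_le_trans; [exact Hw|apply Rmin_l]).
  assert (W2 : (Cmod (w - a) < eps / (2 * M + 1))%R) by (eapply Rlt_le_trans; [exact Hw|apply Rmin_r]).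
  destruct (PS_le (ddiff c a) r M w Hr HM) as [_ B].
  { generalize (Cmod_triangle_inv w a). unfold r. lra. }
  rewrite (PS_ddiff c a w H). replace (PS c a + (w - a) * PS (ddiff c a) w - PS c a) with ((w - a) * PS (ddiff c a) w) by ring.
  rewrite Cmod_mult. apply Rlt_div_r in W2; [|lra].
  generalize (Cmod_ge_0 (w - a)) (Cmod_ge_0 (PS (ddiff c a) w)). nra.
Qed.

Lemma PS_cderiv c a : ecoef c -> cderiv (PS c) a (PS (PSd c) a).
Proof.
  intros H. exists (PS (ddiff c a)). split; [now apply PS_cont, ecoef_ddiff|].
  split; [now apply PS_ddiff_diag|]. apply filter_forall. intros w. rewrite (PS_ddiff c a w H). cring.
Qed.

Lemma PS_An n c a : ecoef c -> An n (PS c) a.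
Proof.
  revert c; induction n as [|n IH]; intros c H; simpl.
  - exists (PS (PSd c)). split; [|now apply PS_cont, ecoef_PSd].
    apply filter_forall. intros w. now apply PS_cderiv.
  - exists (PS (ddiff c a)). split; [now apply IH, ecoef_ddiff|].
    apply filter_forall. intros w. now apply PS_ddiff.
Qed.

Lemma Cpow_m1_sqr n : (-1) ^ n * (-1) ^ n = 1.
Proof. rewrite <- Cpow_mult_l. replace (-1 * -1) with (RtoC 1) by ring. apply Cpow_1_l. Qed.

Lemma Cpow_opp (z : C) n : (- z) ^ n = (-1) ^ n * z ^ n.
Proof. rewrite <- Cpow_mult_l. f_equal. ring. Qed.

Lemma Cpow_m1_even n : Nat.even n = true -> (-1) ^ n = 1.
Proof.
  intros H. apply Nat.even_spec in H. destruct H as [k ->]. rewrite Cpow_mult_r.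
  replace ((-1) ^ 2) with (RtoC 1) by (simpl; ring). apply Cpow_1_l.
Qed.

Lemma PS_parity c q z : ecoef c -> (forall n, Nat.even (n + q) = false -> c n = 0) ->
  PS c (- z) = (-1) ^ q * PS c z.
Proof.
  intros H E. apply C_series_unique.
  apply is_Cseries_ext with (fun n => (-1) ^ q * (c n * z ^ n)).
  - intros n. rewrite Cpow_opp. destruct (Nat.even (n + q)) eqn:K.
    + apply Cpow_m1_even in K. rewrite Cpow_add_r in K.
      replace ((-1) ^ n) with ((-1) ^ n * (-1) ^ q * (-1) ^ q).
      * rewrite K. ring.
      * rewrite <- Cmult_assoc, Cpow_m1_sqr. ring.
    + rewrite E by auto. ring.
  - now apply is_Cseries_scal, PS_is.
Qed.

Lemma PS_conj c z : ecoef c -> (forall n, Cconj (c n) = c n) -> PS c (Cconj z) = Cconj (PS c z).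
Proof.
  intros H E. apply C_series_unique. apply is_Cseries_eps. intros eps He.
  assert (K := PS_is c z H). rewrite is_Cseries_eps in K. destruct (K eps He) as [N HN].
  exists N. intros n Hn. rewrite <- Cmod_conj, Cminus_conj, Cconj_conj.
  replace (Cconj (Csum (fun k => c k * Cconj z ^ k) n)) with (Csum (fun k => c k * z ^ k) n); auto.
  clear HN Hn. induction n as [|n IH].
  - rewrite !Csum_O, Cmult_conj, E, Cpow_conj, Cconj_conj. reflexivity.
  - rewrite !Csum_S, Cplus_conj, <- IH, Cmult_conj, E, Cpow_conj, Cconj_conj. reflexivity.
Qed.

(** * Bessel functions as entire power series *)

(** The defining series of [BesselJ] runs over the exponents [2 m + q] only. Filling the gaps with
    zeros makes [J_q] a power series in [z], to which [PS] applies. *)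
Definition bc (q n : nat) : C :=
  if andb (q <=? n)%nat (Nat.even (n - q)) then
    RtoC ((-1) ^ Nat.div2 (n - q) /
      (INR (fact (Nat.div2 (n - q))) * INR (fact (Nat.div2 (n - q) + q)) * 2 ^ n))%R
  else 0.

Lemma bc_den_neq_0 m k n : (INR (fact m) * INR (fact k) * 2 ^ n)%R <> 0%R.
Proof.
  apply Rmult_integral_contrapositive_currified; [|apply pow_nonzero; lra].
  apply Rmult_integral_contrapositive_currified; apply INR_fact_neq_0.
Qed.

Lemma bc_small q n : (n < q)%nat -> bc q n = 0.
Proof.
  intros H. unfold bc. replace (q <=? n)%nat with false; auto.
  symmetry. apply Nat.leb_gt. lia.
Qed.

Lemma bc_even q m : bc q (2 * m + q) =
  RtoC ((-1) ^ m / (INR (fact m) * INR (fact (m + q)) * 2 ^ (2 * m + q)))%R.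
Proof.
  unfold bc. replace (2 * m + q - q)%nat with (2 * m)%nat by lia.
  replace (q <=? 2 * m + q)%nat with true by (symmetry; apply Nat.leb_le; lia).
  rewrite Nat.even_mul, Nat.div2_double. reflexivity.
Qed.

Lemma bc_odd q m : bc q (S (2 * m + q)) = 0.
Proof.
  unfold bc. replace (S (2 * m + q) - q)%nat with (S (2 * m)) by lia.
  replace (Nat.even (S (2 * m))) with false.
  - now rewrite Bool.andb_false_r.
  - rewrite Nat.even_succ, <- Nat.negb_even, Nat.even_mul. reflexivity.
Qed.

Lemma bc_cases (q n : nat) :
  (n < q)%nat \/ (exists m, n = (2 * m + q)%nat) \/ (exists m, n = S (2 * m + q)).
Proof.
  destruct (Nat.lt_ge_cases n q) as [H|H]; auto. right.
  destruct (Nat.Even_or_Odd (n - q)) as [[m K]|[m K]]; [left|right]; exists m; lia.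
Qed.

Lemma pow_div_fact_le_exp (x : R) m : (0 <= x)%R -> (x ^ m / INR (fact m) <= exp x)%R.
Proof.
  intros Hx. eapply Rle_trans; [|apply (exp_ge_taylor x m Hx)].
  destruct m as [|m]; [right; reflexivity|]. rewrite tech5.
  match goal with |- (?a <= ?b + ?a)%R => assert (0 <= b)%R; [|lra] end.
  apply cond_pos_sum. intros k. apply Rdiv_le_0_compat; [now apply pow_le|apply INR_fact_lt_0].
Qed.

Lemma INR_fact_ge_1 n : (1 <= INR (fact n))%R.
Proof. apply (le_INR 1). generalize (lt_O_fact n). lia. Qed.

Lemma ecoef_bc q : ecoef (bc q).
Proof.
  (* The term of exponent [2 m + q] is at most [(r/2)^q * ((r/2)^2)^m / m!], and a single term of
     the exponential series is at most its sum. *)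
  intros r Hr. exists ((r / 2) ^ q * exp ((r / 2) ^ 2))%R. intros n.
  assert (P : (0 <= (r / 2) ^ q * exp ((r / 2) ^ 2))%R).
  { apply Rmult_le_pos; [apply pow_le; lra|left; apply exp_pos]. }
  destruct (bc_cases q n) as [H|[[m ->]|[m ->]]].
  - now rewrite bc_small, Cmod_0, Rmult_0_l.
  - set (B := ((r / 2) ^ q * exp ((r / 2) ^ 2))%R).
    rewrite bc_even, Cmod_R. unfold Rdiv. rewrite Rabs_mult, <- RPow_abs.
    replace (Rabs (-1)) with 1%R by (rewrite Rabs_left; lra). rewrite pow1, Rmult_1_l.
    assert (F1 := INR_fact_ge_1 m). assert (F2 := INR_fact_ge_1 (m + q)).
    assert (T : (0 < 2 ^ (2 * m + q))%R) by (apply pow_lt; lra).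
    rewrite Rabs_pos_eq.
    2:{ left. apply Rinv_0_lt_compat. apply Rmult_lt_0_compat; auto. apply Rmult_lt_0_compat; lra. }
    replace (/ (INR (fact m) * INR (fact (m + q)) * 2 ^ (2 * m + q)) * r ^ (2 * m + q))%R
      with ((r / 2) ^ q * (((r / 2) ^ 2) ^ m / INR (fact m)) * / INR (fact (m + q)))%R.
    2:{ rewrite <- pow_mult. unfold Rdiv. rewrite !Rpow_mult_distr, !pow_inv, !pow_add.
        field. repeat split; try apply pow_nonzero; lra. }
    rewrite <- (Rmult_1_r B). unfold B. apply Rmult_le_compat.
    + apply Rmult_le_pos; [apply pow_le; lra|]. apply Rdiv_le_0_compat; [|lra]. apply pow_le, pow_le. lra.
    + left. apply Rinv_0_lt_compat. lra.
    + apply Rmult_le_compat_l; [apply pow_le; lra|]. apply pow_div_fact_le_exp. apply pow_le; lra.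
    + rewrite <- Rinv_1. apply Rinv_le_contravar; lra.
  - now rewrite bc_odd, Cmod_0, Rmult_0_l.
Qed.

Lemma BesselJ_PS q z : BesselJ q z = PS (bc q) z.
Proof.
  unfold BesselJ. apply C_series_unique. apply is_Cseries_eps. intros eps He.
  assert (K := PS_is _ z (ecoef_bc q)). rewrite is_Cseries_eps in K.
  destruct (K eps He) as [N HN]. exists N. intros n Hn.
  (* The partial sum of the Bessel series up to [n] is the partial sum of the power series up to
     [2 n + q]. *)
  specialize (HN (2 * n + q)%nat ltac:(lia)).
  match goal with |- (Cmod (?A - _) < _)%R => replace A with (Csum (fun n0 => bc q n0 * z ^ n0) (2 * n + q)); auto end.
  assert (T : forall m, bc q (2 * m + q) * z ^ (2 * m + q) =
     (-1) ^ m / (INR (fact m) * INR (fact (m + q))) * (z / 2) ^ (2 * m + q)).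
  { intros m. rewrite bc_even. unfold Cdiv. rewrite Cpow_mult_l, Cpow_inv by (intro E; apply RtoC_inj in E; lra).
    assert (F1 := INR_fact_neq_0 m). assert (F2 := INR_fact_neq_0 (m + q)).
    assert (F3 : (2 ^ (2 * m + q) <> 0)%R) by (apply pow_nonzero; lra).
    rewrite RtoC_div by (repeat apply Rmult_integral_contrapositive_currified; auto).
    rewrite !RtoC_mult, !RtoC_pow. 
    assert (G1 : RtoC (INR (fact m)) <> 0) by (intro E; apply RtoC_inj in E; auto).
    assert (G2 : RtoC (INR (fact (m + q))) <> 0) by (intro E; apply RtoC_inj in E; auto).
    assert (G3 : RtoC 2 ^ (2 * m + q) <> 0) by (apply Cpow_nz; intro E; apply RtoC_inj in E; lra).
    field. auto. }
  clear HN Hn K. induction n as [|n IH].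
  - rewrite Csum_O, <- (T 0%nat). replace (2 * 0 + q)%nat with q by lia. destruct q as [|q].
    + now rewrite Csum_O.
    + rewrite Csum_S, Csum_zero; [cring|]. intros k Hk. rewrite bc_small by lia. ring.
  - replace (2 * S n + q)%nat with (S (S (2 * n + q))) at 1 by lia.
    rewrite !Csum_S, IH, bc_odd. rewrite <- (T (S n)).
    replace (2 * S n + q)%nat with (S (S (2 * n + q))) by lia. cring.
Qed.

Definition bcd (q k : nat) : nat -> C := Nat.iter k PSd (bc q).

Lemma ecoef_bcd q k : ecoef (bcd q k).
Proof. induction k as [|k IH]; [apply ecoef_bc|]. now apply ecoef_PSd. Qed.
#[global] Hint Resolve ecoef_bc ecoef_bcd : core.

Lemma dBesselJ_PS q k z : dBesselJ q k z = PS (bcd q k) z.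
Proof.
  revert z. induction k as [|k IH]; intros z; [apply BesselJ_PS|].
  unfold dBesselJ, C_derive_n. simpl. apply C_derive_cderiv.
  apply cderiv_ext with (PS (bcd q k)).
  - intros w. symmetry. apply IH.
  - now apply PS_cderiv.
Qed.

Notation J := BesselJ.
Notation J1 q := (dBesselJ q 1).
Notation J2 q := (dBesselJ q 2).
Notation J3 q := (dBesselJ q 3).

Lemma dBesselJ_cderiv q k z : cderiv (dBesselJ q k) z (dBesselJ q (S k) z).
Proof.
  rewrite dBesselJ_PS. apply cderiv_ext with (PS (bcd q k)).
  - intros w. now rewrite dBesselJ_PS.
  - now apply (PS_cderiv (bcd q k)).
Qed.

Lemma BesselJ_cderiv q z : cderiv (J q) z (J1 q z).
Proof. exact (dBesselJ_cderiv q 0 z). Qed.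

Lemma dBesselJ_An n q k z : An n (dBesselJ q k) z.
Proof.
  apply An_ext with (PS (bcd q k)); [|now apply PS_An].
  apply filter_forall. intros w. now rewrite dBesselJ_PS.
Qed.

Lemma bcd_real q k n : Cconj (bcd q k n) = bcd q k n.
Proof.
  revert n. induction k as [|k IH]; intros n.
  - simpl. unfold bc. destruct (andb _ _); unfold Cconj, RtoC; simpl; f_equal; ring.
  - simpl. unfold PSd. rewrite Cmult_conj, IH. f_equal.
    unfold Cconj, RtoC; simpl; f_equal; ring.
Qed.

Lemma dBesselJ_conj q k z : dBesselJ q k (Cconj z) = Cconj (dBesselJ q k z).
Proof. rewrite !dBesselJ_PS. apply PS_conj; auto. intros n. apply bcd_real. Qed.

Lemma bcd_parity q k n : Nat.even (n + (q + k)) = false -> bcd q k n = 0.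
Proof.
  revert n. induction k as [|k IH]; intros n H.
  - simpl. rewrite Nat.add_0_r in H. destruct (bc_cases q n) as [K|[[m ->]|[m ->]]].
    + now apply bc_small.
    + exfalso. replace (2 * m + q + q)%nat with (2 * (m + q))%nat in H by lia.
      rewrite Nat.even_mul in H. discriminate.
    + apply bc_odd.
  - simpl. unfold PSd. rewrite IH; [ring|]. now replace (S n + (q + k))%nat with (n + (q + S k))%nat by lia.
Qed.

Lemma dBesselJ_opp q k z : dBesselJ q k (- z) = (-1) ^ (q + k) * dBesselJ q k z.
Proof. rewrite !dBesselJ_PS. apply PS_parity; auto. apply bcd_parity. Qed.

Lemma BesselJ_opp q z : J q (- z) = (-1) ^ q * J q z.
Proof. generalize (dBesselJ_opp q 0 z). now rewrite Nat.add_0_r. Qed.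

Lemma dBesselJ_real q k (x : R) : dBesselJ q k x = RtoC (Re (dBesselJ q k x)).
Proof.
  assert (H := dBesselJ_conj q k x).
  replace (Cconj x) with (RtoC x) in H by (unfold Cconj, RtoC; simpl; f_equal; ring).
  destruct (dBesselJ q k x) as [a b]. unfold Cconj in H. simpl in H. injection H. intros.
  unfold RtoC, Re; simpl. f_equal. lra.
Qed.

Lemma BesselJ_real q (x : R) : J q x = RtoC (Re (J q x)).
Proof. exact (dBesselJ_real q 0 x). Qed.

(** * Recurrences and Bessel's equation *)

(** The Euler operator [z d/dz] acts diagonally on coefficients, so the recurrences between orders
    become identities between coefficients. *)
Lemma PS_mult_id c z : ecoef c -> z * PS (PSd c) z = PS (fun n => RtoC (INR n) * c n) z.
Proof.
  intros H. rewrite (PS_shift (fun n => RtoC (INR n) * c n)) by now apply ecoef_INR.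
  simpl (INR 0). unfold PSd. ring.
Qed.

Lemma PS_lin a b c d z : ecoef c -> ecoef d ->
  PS (fun n => a * c n + b * d n) z = a * PS c z + b * PS d z.
Proof.
  intros Hc Hd. apply C_series_unique.
  apply is_Cseries_ext with (fun n => a * (c n * z ^ n) + b * (d n * z ^ n)); [intros; ring|].
  apply is_Cseries_plus; apply is_Cseries_scal; now apply PS_is.
Qed.

Lemma RtoC_neq_0 (x : R) : x <> 0%R -> RtoC x <> 0.
Proof. intros H E. apply RtoC_inj in E. auto. Qed.

(** Coefficient form of [z J_q' = q J_q - z J_(q+1)]; [bc_rec_down] is that of
    [z J_(q+1)' = z J_q - (q + 1) J_(q+1)]. *)
Lemma bc_rec_up q n : (RtoC (INR (S n)) - RtoC (INR q)) * bc q (S n) = - bc (S q) n.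
Proof.
  destruct (bc_cases (S q) n) as [H|[[m ->]|[m ->]]].
  - rewrite (bc_small (S q)) by auto. destruct (Nat.eq_dec (S n) q) as [<-|N]; [ring|].
    destruct (Nat.eq_dec n q) as [->|N2].
    + change (S q) with (S (2 * 0 + q)); rewrite (bc_odd q 0). ring.
    + rewrite bc_small by lia. ring.
  - rewrite bc_even. replace (S (2 * m + S q)) with (2 * S m + q)%nat by lia. rewrite bc_even.
    rewrite <- RtoC_minus, <- RtoC_mult, <- RtoC_opp. f_equal.
    replace (m + S q)%nat with (S m + q)%nat by lia.
    replace (2 * S m + q)%nat with (S (2 * m + S q)) by lia.
    rewrite S_INR, !plus_INR, !mult_INR, (S_INR q), <- !tech_pow_Rmult.
    rewrite fact_simpl, mult_INR, S_INR. rewrite ?S_INR; change (INR 0) with 0%R.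
    assert (F1 := INR_fact_neq_0 m). assert (F2 := INR_fact_neq_0 (S m + q)).
    assert (F3 : (2 ^ (2 * m + S q) <> 0)%R) by (apply pow_nonzero; lra).
    assert (F4 := pos_INR m).
    field. repeat split; auto; lra.
  - rewrite (bc_odd (S q)). replace (S (S (2 * m + S q))) with (S (2 * S m + q)) by lia.
    rewrite bc_odd. ring.
Qed.

Lemma bc_rec_down q n : (RtoC (INR (S n)) + RtoC (INR (S q))) * bc (S q) (S n) = bc q n.
Proof.
  destruct (bc_cases q n) as [H|[[m ->]|[m ->]]].
  - rewrite !bc_small by lia. ring.
  - rewrite bc_even. replace (S (2 * m + q)) with (2 * m + S q)%nat by lia. rewrite bc_even.
    rewrite <- RtoC_plus, <- RtoC_mult. f_equal.
    replace (m + S q)%nat with (S (m + q))%nat by lia.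
    replace (2 * m + S q)%nat with (S (2 * m + q)) by lia.
    rewrite (S_INR (2 * m + q)), !plus_INR, !mult_INR, (S_INR q), <- !tech_pow_Rmult.
    rewrite (fact_simpl (m + q)), mult_INR, ?S_INR, ?plus_INR, ?mult_INR. rewrite ?S_INR; change (INR 0) with 0%R.
    assert (F1 := INR_fact_neq_0 m). assert (F2 := INR_fact_neq_0 (m + q)).
    assert (F3 : (2 ^ (2 * m + q) <> 0)%R) by (apply pow_nonzero; lra).
    assert (F4 := pos_INR m). assert (F5 := pos_INR q).
    field. repeat split; auto; lra.
  - rewrite (bc_odd q). replace (S (S (2 * m + q))) with (S (2 * m + S q)) by lia.
    rewrite bc_odd. ring.
Qed.

Lemma BesselJ_rec_up q z : z * J1 q z = RtoC (INR q) * J q z - z * J (S q) z.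
Proof.
  rewrite dBesselJ_PS, !BesselJ_PS. simpl. rewrite PS_mult_id by auto.
  assert (E : PS (fun n => 1 * (RtoC (INR n) * bc q n) + (- RtoC (INR q)) * bc q n) z = - z * PS (bc (S q)) z).
  { assert (G : ecoef (fun n => 1 * (RtoC (INR n) * bc q n) + (- RtoC (INR q)) * bc q n)).
    { intros r Hr. destruct (ecoef_INR (bc q) (ecoef_bc q) r Hr) as [M HM].
      destruct (ecoef_bc q r Hr) as [M' HM']. exists (M + INR q * M')%R. intros n.
      specialize (HM n). specialize (HM' n). cbv beta in HM. assert (Q := pos_INR q).
      assert (P : (0 <= r ^ n)%R) by (apply pow_le; lra).
      eapply Rle_trans; [apply Rmult_le_compat_r; [auto|apply Cmod_triangle]|].
      rewrite Cmult_1_l, (Cmod_mult (- _)), Cmod_opp, (Cmod_R (INR q)), (Rabs_pos_eq (INR q)) by auto.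
      nra. }
    rewrite PS_shift by auto.
    replace (1 * (RtoC (INR 0) * bc q 0) + - RtoC (INR q) * bc q 0) with (RtoC 0).
    - rewrite Cplus_0_l.
      replace (- z * PS (bc (S q)) z) with (z * (-1 * PS (bc (S q)) z)) by ring. f_equal.
      apply C_series_unique.
      apply is_Cseries_ext with (fun n => -1 * (bc (S q) n * z ^ n)).
      + intros n. replace (-1 * (bc (S q) n * z ^ n)) with (- bc (S q) n * z ^ n) by ring.
        rewrite <- bc_rec_up. ring.
      + apply is_Cseries_scal, PS_is; auto.
    - destruct q as [|q].
      + simpl. ring.
      + rewrite bc_small by lia. ring. }
  rewrite PS_lin in E; auto; [|now apply ecoef_INR].
  replace (PS (fun n => RtoC (INR n) * bc q n) z) with
    (1 * PS (fun n => RtoC (INR n) * bc q n) z + - RtoC (INR q) * PS (bc q) z + RtoC (INR q) * PS (bc q) z) by ring.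
  rewrite E. ring.
Qed.

Lemma BesselJ_rec_down q z : z * J1 (S q) z = z * J q z - RtoC (INR (S q)) * J (S q) z.
Proof.
  rewrite dBesselJ_PS, !BesselJ_PS. simpl (bcd (S q) 1). rewrite PS_mult_id by auto.
  assert (E : PS (fun n => 1 * (RtoC (INR n) * bc (S q) n) + (RtoC (INR (S q))) * bc (S q) n) z = z * PS (bc q) z).
  { apply C_series_unique.
    replace (z * PS (bc q) z) with
      ((1 * (RtoC (INR 0) * bc (S q) 0) + (RtoC (INR (S q))) * bc (S q) 0) * z ^ 0 + z * PS (bc q) z)
      by (rewrite bc_small by lia; simpl; ring).
    apply (is_Cseries_decr_1 (fun n => (1 * (RtoC (INR n) * bc (S q) n) + (RtoC (INR (S q))) * bc (S q) n) * z ^ n)).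
    apply is_Cseries_ext with (fun n => z * (bc q n * z ^ n)).
    - intros n. rewrite <- bc_rec_down. rewrite Cpow_S. ring.
    - apply is_Cseries_scal, PS_is; auto. }
  rewrite PS_lin in E; auto; [|now apply ecoef_INR].
  rewrite <- E. ring.
Qed.

(** The raising relation is differentiated, and [J_(q+1)] and its derivative are eliminated by the
    two recurrences. Nothing is divided by [z], so the equation holds at 0 too. *)
Lemma BesselJ_ode q z :
  z * z * J2 q z + z * J1 q z + (z * z - RtoC (INR q) * RtoC (INR q)) * J q z = 0.
Proof.
  assert (D : 1 * J1 q z + z * J2 q z = RtoC (INR q) * J1 q z - (1 * J (S q) z + z * J1 (S q) z)).
  { apply (cara_unique_C (fun w => w * J1 q w) z).
    - apply cara_mult; auto; [apply cara_id|apply (dBesselJ_cderiv q 1)].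
    - apply cderiv_ext with (fun w => RtoC (INR q) * J q w - w * J (S q) w).
      + intros w. now rewrite BesselJ_rec_up.
      + apply cara_minus; [apply cara_scal, BesselJ_cderiv|].
        apply cara_mult; auto; [apply cara_id|apply BesselJ_cderiv]. }
  assert (U := BesselJ_rec_up q z). assert (V := BesselJ_rec_down q z).
  replace (z * z * J2 q z + z * J1 q z) with (z * (1 * J1 q z + z * J2 q z)) by ring.
  rewrite D.
  replace (z * (RtoC (INR q) * J1 q z - (1 * J (S q) z + z * J1 (S q) z))) with
   (RtoC (INR q) * (z * J1 q z) - z * J (S q) z - z * (z * J1 (S q) z)) by ring.
  rewrite V, U, S_INR, RtoC_plus. ring.
Qed.

(** * Orders of vanishing at the origin *)

Lemma PS_factor c k z : ecoef c -> (forall n, (n < k)%nat -> c n = 0) ->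
  PS c z = z ^ k * PS (fun n => c (k + n)%nat) z.
Proof.
  revert c; induction k as [|k IH]; intros c H E.
  - simpl. rewrite Cmult_1_l. now apply PS_ext.
  - rewrite PS_shift, E by (auto; lia). rewrite (IH (fun n => c (S n))).
    + simpl. ring.
    + exact (ecoef_shift c 1 H).
    + intros n Hn. apply E. lia.
Qed.

Lemma PS_0 c : ecoef c -> PS c 0 = c 0%nat.
Proof. intros H. rewrite PS_shift by auto. ring. Qed.

Definition Jfactor q : C -> C := PS (fun n => bc q (q + n)%nat).

Lemma BesselJ_factor q z : J q z = z ^ q * Jfactor q z.
Proof. rewrite BesselJ_PS. apply PS_factor; auto. intros n. apply bc_small. Qed.

Lemma Jfactor_0 q : Jfactor q 0 <> 0.
Proof.
  unfold Jfactor. rewrite PS_0 by now apply ecoef_shift. rewrite Nat.add_0_r.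
  change (bc q q) with (bc q (2 * 0 + q)); rewrite (bc_even q 0). apply RtoC_neq_0.
  apply Rmult_integral_contrapositive_currified; [simpl; lra|]. apply Rinv_neq_0_compat.
  repeat apply Rmult_integral_contrapositive_currified; try apply INR_fact_neq_0.
  apply pow_nonzero. lra.
Qed.

(* Order of vanishing of [J_q'] at 0. *)
Definition ord1 (q : nat) : nat := match q with O => 1%nat | S q => q end.

Definition J1factor q : C -> C := PS (fun n => bcd q 1 (ord1 q + n)%nat).

Lemma dBesselJ_factor q z : J1 q z = z ^ ord1 q * J1factor q z.
Proof.
  rewrite dBesselJ_PS. apply PS_factor; auto. intros n Hn. simpl. unfold PSd.
  destruct q as [|q]; simpl in Hn.
  - replace n with 0%nat by lia. change (bc 0 1) with (bc 0 (S (2 * 0 + 0))); rewrite (bc_odd 0 0). ring.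
  - rewrite bc_small by lia. ring.
Qed.

Lemma J1factor_coef0 q : J1factor q 0 = bcd q 1 (ord1 q).
Proof.
  unfold J1factor. rewrite PS_0 by exact (ecoef_shift _ (ord1 q) (ecoef_bcd q 1)). now rewrite Nat.add_0_r.
Qed.

Lemma J1factor_0 q : J1factor q 0 <> 0.
Proof.
  rewrite J1factor_coef0. simpl. unfold PSd. apply Cmult_neq_0.
  - apply RtoC_neq_0. apply not_0_INR. lia.
  - destruct q as [|q]; simpl ord1.
    + change (bc 0 2) with (bc 0 (2 * 1 + 0)); rewrite (bc_even 0 1). apply RtoC_neq_0. simpl. lra.
    + change (bc (S q) (S q)) with (bc (S q) (2 * 0 + S q)); rewrite (bc_even (S q) 0). apply RtoC_neq_0.
      apply Rmult_integral_contrapositive_currified; [simpl; lra|]. apply Rinv_neq_0_compat.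
    apply bc_den_neq_0.
Qed.

(** [J_0' w = - w / 2 + ...], and the square of this leading coefficient yields the [4 / z^2] of
    both parts at 0 when [q = 0]. *)
Lemma J1factor_0_q0 : J1factor 0 0 = RtoC (-1/2).
Proof.
  rewrite J1factor_coef0. simpl. unfold PSd. change (bc 0 2) with (bc 0 (2 * 1 + 0)); rewrite (bc_even 0 1), <- RtoC_mult. f_equal. simpl. lra.
Qed.

(** * Integrals of complex-valued functions *)

Definition CI (f : R -> C) (a b : R) : C := @RInt C_R_CompleteNormedModule f a b.
Notation is_CI := (@is_RInt C_R_NormedModule).
Notation Rcont f t := (@cont R_UniformSpace f t).

Section CI.
Variables a b : R.
Hypothesis Hab : (a <= b)%R.

Definition con (f : R -> C) : Prop := forall t, (a <= t <= b)%R -> Rcont f t.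

Lemma CI_ex f : con f -> @ex_RInt C_R_CompleteNormedModule f a b.
Proof.
  intros H. apply ex_RInt_continuous. rewrite Rmin_left, Rmax_right by auto.
  intros t Ht. apply cont_continuous. auto.
Qed.

Lemma CI_is f : con f -> is_CI f a b (CI f a b).
Proof. intros H. apply (@RInt_correct C_R_CompleteNormedModule). now apply CI_ex. Qed.

Lemma CI_unique f l : is_CI f a b l -> CI f a b = l.
Proof. intros H. exact (@is_RInt_unique C_R_CompleteNormedModule f a b l H). Qed.

Lemma CI_ext f g : (forall t, (a <= t <= b)%R -> f t = g t) -> CI f a b = CI g a b.
Proof.
  intros H. apply (@RInt_ext C_R_CompleteNormedModule). rewrite Rmin_left, Rmax_right by auto.
  intros t Ht. apply H. lra.
Qed.

Lemma CI_plus f g : con f -> con g -> CI (fun t => f t + g t) a b = CI f a b + CI g a b.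
Proof.
  intros Hf Hg. apply CI_unique.
  exact (@is_RInt_plus C_R_NormedModule f g a b _ _ (CI_is f Hf) (CI_is g Hg)).
Qed.

Lemma CI_Re f : con f -> is_RInt (fun t => Re (f t)) a b (Re (CI f a b)).
Proof. intros H. exact (is_RInt_fct_extend_fst (U := R_NormedModule) (V := R_NormedModule) f a b _ (CI_is f H)). Qed.

Lemma CI_Im f : con f -> is_RInt (fun t => Im (f t)) a b (Im (CI f a b)).
Proof. intros H. exact (is_RInt_fct_extend_snd (U := R_NormedModule) (V := R_NormedModule) f a b _ (CI_is f H)). Qed.

(** The integral is taken in a real normed module, hence linear over [R]; a complex factor is
    distributed over the real and imaginary parts. *)
Lemma CI_scal (c : C) f : con f -> CI (fun t => c * f t) a b = c * CI f a b.
Proof.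
  intros H. apply CI_unique.
  assert (X := CI_Re f H). assert (Y := CI_Im f H).
  replace (c * CI f a b) with
    ((Re c * Re (CI f a b) - Im c * Im (CI f a b))%R, (Re c * Im (CI f a b) + Im c * Re (CI f a b))%R)
    by reflexivity.
  apply (is_RInt_fct_extend_pair (U := R_NormedModule) (V := R_NormedModule)).
  - exact (is_RInt_minus (V := R_NormedModule) _ _ a b _ _
      (is_RInt_scal (V := R_NormedModule) _ a b (Re c) _ X) (is_RInt_scal (V := R_NormedModule) _ a b (Im c) _ Y)).
  - exact (is_RInt_plus (V := R_NormedModule) _ _ a b _ _
      (is_RInt_scal (V := R_NormedModule) _ a b (Re c) _ Y) (is_RInt_scal (V := R_NormedModule) _ a b (Im c) _ X)).
Qed.

Lemma CI_conj f : con f -> CI (fun t => Cconj (f t)) a b = Cconj (CI f a b).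
Proof.
  intros H. apply CI_unique.
  assert (X := CI_Re f H). assert (Y := CI_Im f H).
  apply (is_RInt_fct_extend_pair (U := R_NormedModule) (V := R_NormedModule)).
  - exact X.
  - exact (is_RInt_opp (V := R_NormedModule) _ a b _ Y).
Qed.

Lemma con_const c : con (fun _ => c).
Proof. intros t _. apply cont_const. Qed.

Lemma con_plus f g : con f -> con g -> con (fun t => f t + g t).
Proof. intros Hf Hg t Ht. apply cont_plus; auto. Qed.

Lemma con_mult f g : con f -> con g -> con (fun t => f t * g t).
Proof. intros Hf Hg t Ht. apply cont_mult; auto. Qed.

Lemma con_minus f g : con f -> con g -> con (fun t => f t - g t).
Proof. intros Hf Hg t Ht. apply cont_minus; auto. Qed.

Lemma CI_minus f g : con f -> con g -> CI (fun t => f t - g t) a b = CI f a b - CI g a b.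
Proof.
  intros Hf Hg. rewrite (CI_ext _ (fun t => f t + (-1) * g t)) by (intros; ring).
  rewrite CI_plus, CI_scal; auto.
  - ring.
  - apply con_mult; auto. apply con_const.
Qed.

Lemma CI_const c : CI (fun _ => c) a b = RtoC (b - a) * c.
Proof.
  apply CI_unique.
  replace (RtoC (b - a) * c) with (@scal R_Ring C_R_ModuleSpace (b - a)%R c).
  - apply (@is_RInt_const C_R_NormedModule).
  - destruct c as [x y]. apply injective_projections.
    + change ((b - a) * x = (b - a) * x - 0 * y)%R. ring.
    + change ((b - a) * y = (b - a) * y + 0 * x)%R. ring.
Qed.

Lemma CI_norm f g I : con f -> (forall t, (a <= t <= b)%R -> (Cmod (f t) <= g t)%R) ->
  is_RInt g a b I -> (Cmod (CI f a b) <= I)%R.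
Proof.
  intros Hf H Hg. rewrite Cmod_norm.
  apply (@norm_RInt_le C_R_NormedModule f g a b); auto.
  - intros t Ht. generalize (H t Ht). rewrite Cmod_norm. intro K; exact K.
  - now apply CI_is.
Qed.

Lemma CI_FTC F f : (forall t, (a <= t <= b)%R -> rderiv F t (f t)) -> con f ->
  CI f a b = F b - F a.
Proof.
  intros H Hf. apply CI_unique.
  apply (@is_RInt_derive C_R_CompleteNormedModule); rewrite Rmin_left, Rmax_right by auto.
  - intros t Ht. apply rderiv_C_R. auto.
  - intros t Ht. apply cont_continuous. auto.
Qed.
End CI.

(** * Circle means *)

Definition cis (t : R) : C := (cos t, sin t).

Lemma cis_alt t : cis t = RtoC (cos t) + Ci * RtoC (sin t).
Proof. unfold cis, Ci, RtoC, Cplus, Cmult; simpl; f_equal; ring. Qed.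

Lemma Cmod_cis t : Cmod (cis t) = 1%R.
Proof.
  unfold Cmod, cis; simpl. generalize (sin2_cos2 t). unfold Rsqr. intros E.
  replace (cos t * (cos t * 1) + sin t * (sin t * 1))%R with 1%R by lra. apply sqrt_1.
Qed.

Lemma cis_neq_0 t : cis t <> 0.
Proof. intro E. generalize (Cmod_cis t). rewrite E, Cmod_0. lra. Qed.

Lemma cis_plus s t : cis (s + t) = cis s * cis t.
Proof. unfold cis, Cmult; simpl. rewrite cos_plus, sin_plus. f_equal; ring. Qed.

Lemma cis_0 : cis 0 = 1.
Proof. unfold cis. now rewrite cos_0, sin_0. Qed.

Lemma cis_opp t : cis (- t) = / cis t.
Proof.
  assert (E : cis (- t) * cis t = 1).
  { rewrite <- cis_plus. replace (- t + t)%R with 0%R by ring. apply cis_0. }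
  replace (/ cis t) with (cis (- t) * cis t * / cis t).
  - field. apply cis_neq_0.
  - rewrite E. field. apply cis_neq_0.
Qed.

Lemma cis_2PI : cis (2 * PI) = 1.
Proof. unfold cis. now rewrite cos_2PI, sin_2PI. Qed.

Lemma rderiv_cis (k t : R) : rderiv (fun s => cis (k * s)) t (Ci * RtoC k * cis (k * t)).
Proof.
  apply rderiv_ext with (fun s => RtoC (cos (k * s)) + Ci * RtoC (sin (k * s))).
  - intros s. now rewrite cis_alt.
  - replace (Ci * RtoC k * cis (k * t)) with (RtoC (- (k * sin (k * t))) + Ci * RtoC (k * cos (k * t)))%C.
    + apply cara_plus; [|apply cara_scal]; apply rderiv_RtoC.
      * auto_derive; auto. ring.
      * auto_derive; auto. ring.
    + rewrite cis_alt, RtoC_opp, !RtoC_mult.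
      replace (Ci * k * (cos (k * t) + Ci * sin (k * t))) with
        (Ci * Ci * (k * sin (k * t)) + Ci * (k * cos (k * t))) by ring.
      replace (Ci * Ci) with (RtoC (-1)) by (unfold Ci, RtoC, Cmult; simpl; f_equal; ring).
      ring.
Qed.

(** The factor [k] is the orientation, 1 or -1: the inversion [w -> 1 / w] runs the circle
    backwards, as happens in [oint_recip]. *)
Definition circ (k : R) (f : C -> C) (r : R) : C := CI (fun t => f (RtoC r * cis (k * t))) 0 (2 * PI).

Lemma two_PI_pos : (0 <= 2 * PI)%R.
Proof. generalize PI_RGT_0. lra. Qed.
#[global] Hint Resolve two_PI_pos : core.

Lemma Cmod_circle (r k t : R) : Cmod (RtoC r * cis (k * t)) = Rabs r.
Proof. rewrite Cmod_mult, Cmod_cis, Cmod_R. ring. Qed.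

Lemma cont_circle (k r t : R) : Rcont (fun s => RtoC r * cis (k * s)) t.
Proof.
  apply cont_mult; [apply cont_const|]. exact (rderiv_cont _ _ _ (rderiv_cis k t)).
Qed.

Lemma hol_C_derive f w : hol f w ->
  cderiv f w (C_derive f w) /\ @cont C_UniformSpace (C_derive f) w.
Proof.
  intros [df [D1 D2]].
  assert (E : @locally C_UniformSpace w (fun u => df u = C_derive f u)).
  { revert D1. apply filter_imp. intros u Hu. symmetry. now apply C_derive_cderiv. }
  split.
  - rewrite <- (locally_singleton _ _ E). exact (locally_singleton _ _ D1).
  - now apply cont_ext_loc with df.
Qed.

Lemma con_comp_circle (k r : R) (f : C -> C) a b :
  (forall w, Cmod w = Rabs r -> @cont C_UniformSpace f w) ->
  con a b (fun t => f (RtoC r * cis (k * t))).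
Proof.
  intros H t _. apply (cont_comp (fun s => RtoC r * cis (k * s)) t f); [apply cont_circle|].
  apply H, Cmod_circle.
Qed.

Section MeanValue.
Variables (k : R) (R' : R).
Hypothesis Hk : k = 1%R \/ k = (-1)%R.

Lemma cis_k_2PI : cis (k * (2 * PI)) = 1.
Proof.
  destruct Hk as [-> | ->].
  - rewrite Rmult_1_l. apply cis_2PI.
  - replace (-1 * (2 * PI))%R with (- (2 * PI))%R by ring. rewrite cis_opp, cis_2PI. now field.
Qed.

Lemma RtoC_k_neq_0 : RtoC k <> 0.
Proof. intro E. apply RtoC_inj in E. destruct Hk; lra. Qed.

Section Disc.
Variable f : C -> C.
Hypothesis Hf : forall w, (Cmod w < R')%R -> hol f w.
Let df := C_derive f.

Lemma circ_rderiv_t (r t : R) : (Rabs r < R')%R ->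
  rderiv (fun s => f (RtoC r * cis (k * s))) t (df (RtoC r * cis (k * t)) * (RtoC r * (Ci * RtoC k * cis (k * t)))).
Proof.
  intros Hr. apply (rderiv_comp (fun s => RtoC r * cis (k * s))).
  - apply cara_scal. apply rderiv_cis.
  - apply hol_C_derive, Hf. now rewrite Cmod_circle.
Qed.

Lemma circ_rderiv_r (r t : R) : (Rabs r < R')%R ->
  rderiv (fun s => f (RtoC s * cis (k * t))) r (df (RtoC r * cis (k * t)) * cis (k * t)).
Proof.
  intros Hr. apply (rderiv_comp (fun s => RtoC s * cis (k * t))).
  - apply rderiv_ext with (fun s => cis (k * t) * RtoC s); [intros; ring|].
    assert (K := cara_scal _ _ _ (cis (k * t)) _ (@cara_id R_UniformSpace RtoC r)).
    rewrite Cmult_1_r in K. exact K.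
  - apply hol_C_derive, Hf. now rewrite Cmod_circle.
Qed.

(** The radial derivative of [f (r cis (k t))] is its angular derivative divided by [i k r], and the
    latter integrates to 0 over a period. *)
Lemma circ_dr_zero (r : R) : (Rabs r < R')%R ->
  CI (fun t => df (RtoC r * cis (k * t)) * cis (k * t)) 0 (2 * PI) = 0.
Proof.
  intros Hr.
  assert (Hc : con 0 (2 * PI) (fun t => df (RtoC r * cis (k * t)) * cis (k * t))).
  { apply con_mult.
    - apply con_comp_circle. intros w Hw. apply hol_C_derive, Hf. lra.
    - intros t _. exact (rderiv_cont _ _ _ (rderiv_cis k t)). }
  assert (K := RtoC_k_neq_0). assert (K2 := Ci_nz).
  (* At [r = 0] division by [r] is impossible, but the integrand is then a constant multiple of
     [cis (k t)], which has a periodic primitive. *)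
  destruct (Req_EM_T r 0) as [->|Hr0].
  - rewrite (CI_FTC 0 (2 * PI) two_PI_pos (fun t => df 0 / (Ci * RtoC k) * cis (k * t))); auto.
    + rewrite cis_k_2PI, Rmult_0_r, cis_0. ring.
    + intros t _. replace (df (0 * cis (k * t)) * cis (k * t)) with
        (df 0 / (Ci * RtoC k) * (Ci * RtoC k * cis (k * t))).
      * apply cara_scal. apply rderiv_cis.
      * rewrite Cmult_0_l. field. auto.
  - assert (K3 : RtoC r <> 0) by (intro E; apply RtoC_inj in E; auto).
    rewrite (CI_FTC 0 (2 * PI) two_PI_pos (fun t => / (RtoC r * (Ci * RtoC k)) * f (RtoC r * cis (k * t)))); auto.
    + rewrite cis_k_2PI, Rmult_0_r, cis_0. ring.
    + intros t _. replace (df (RtoC r * cis (k * t)) * cis (k * t)) with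
        (/ (RtoC r * (Ci * RtoC k)) * (df (RtoC r * cis (k * t)) * (RtoC r * (Ci * RtoC k * cis (k * t))))).
      * apply cara_scal. now apply circ_rderiv_t.
      * field. auto.
Qed.

(** Differentiation under the integral sign, carried out on real parts; [circ_dr_zero] evaluates the
    differentiated integral. The mean is therefore independent of the radius, down to radius 0. *)
Lemma circ_Re_derive (r : R) : (Rabs r < R')%R ->
  is_derive (fun s => RInt (fun t => Re (f (RtoC s * cis (k * t)))) 0 (2 * PI)) r 0%R.
Proof.
  intros Hr.
  assert (L : locally r (fun s => (Rabs s < R')%R)).
  { apply locally_Rabs. exists (R' - Rabs r)%R. split; [lra|]. intros y Hy.
    generalize (Rabs_triang (y - r) r). replace (y - r + r)%R with y by ring. lra. }
  assert (D : forall s t, (Rabs s < R')%R -> is_derive (fun u => Re (f (RtoC u * cis (k * t)))) s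
     (Re (df (RtoC s * cis (k * t)) * cis (k * t)))).
  { intros s t Hs. apply rderiv_Re. now apply circ_rderiv_r. }
  assert (V : RInt (fun t => Derive (fun u => Re (f (RtoC u * cis (k * t)))) r) 0 (2 * PI) = 0%R).
  { rewrite (RInt_ext _ (fun t => Re (df (RtoC r * cis (k * t)) * cis (k * t)))).
    + apply is_RInt_unique.
      assert (Q : con 0 (2 * PI) (fun t => df (RtoC r * cis (k * t)) * cis (k * t))).
      { apply con_mult.
        - apply con_comp_circle. intros w Hw. apply hol_C_derive, Hf. lra.
        - intros t _. exact (rderiv_cont _ _ _ (rderiv_cis k t)). }
      apply CI_Re in Q; auto. rewrite circ_dr_zero in Q by auto. exact Q.
    + intros t _. apply is_derive_unique, D, Hr. }
  assert (W : is_derive (fun s => RInt (fun t => Re (f (RtoC s * cis (k * t)))) 0 (2 * PI)) r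
    (RInt (fun t => Derive (fun u => Re (f (RtoC u * cis (k * t)))) r) 0 (2 * PI))).
  2:{ rewrite V in W. exact W. }
  clear V.
  apply (is_derive_RInt_param (fun s t => Re (f (RtoC s * cis (k * t)))) 0 (2 * PI) r).
    + revert L. apply filter_imp. intros s Hs t _. eexists. apply D, Hs.
    + intros t _.
      apply continuity_2d_pt_ext_loc with (fun u v => Re (df (RtoC u * cis (k * v)) * cis (k * v))).
      * assert (Hp : (0 < R' - Rabs r)%R) by lra. exists (mkposreal _ Hp). intros u v Hu _.
        symmetry. apply is_derive_unique, D. simpl in Hu.
        generalize (Rabs_triang (u - r) r). replace (u - r + r)%R with u by ring. lra.
      * apply continuity_2d_pt_filterlim.
        assert (Cc : @cont (prod_UniformSpace R_UniformSpace R_UniformSpace)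
          (fun p => df (RtoC (fst p) * cis (k * snd p)) * cis (k * snd p)) (r, t)).
        { assert (C1 : @cont (prod_UniformSpace R_UniformSpace R_UniformSpace) (fun p => cis (k * snd p)) (r, t)).
          { apply cont_continuous. apply (continuous_comp snd (fun v => cis (k * v)) (r, t)).
            - apply continuous_snd.
            - apply cont_continuous. exact (rderiv_cont _ _ _ (rderiv_cis k t)). }
          apply cont_mult; auto.
          apply (cont_comp (fun p => RtoC (fst p) * cis (k * snd p)) (r, t) df).
          - apply cont_mult; auto. apply cont_continuous. apply (continuous_comp fst RtoC (r, t)).
            + apply continuous_fst.
            + apply cont_continuous. auto.
          - apply hol_C_derive, Hf. simpl. now rewrite Cmod_circle. }
        apply cont_continuous in Cc.
        exact (continuous_comp _ (fst : C_UniformSpace -> R_UniformSpace) (r, t) Cc (continuous_fst _ _)).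
    + revert L. apply filter_imp. intros s Hs. eexists. apply (CI_Re 0 (2 * PI) two_PI_pos (fun t => f (RtoC s * cis (k * t)))).
      apply con_comp_circle. intros w Hw. apply hol_cont, Hf. lra.
Qed.

Lemma circ_Re_mean (r : R) : (0 < r < R')%R -> Re (circ k f r) = Re (RtoC (2 * PI) * f 0).
Proof.
  intros Hr.
  assert (Hc : forall s, (0 <= s < R')%R -> con 0 (2 * PI) (fun t => f (RtoC s * cis (k * t)))).
  { intros s Hs. apply con_comp_circle. intros w Hw. apply hol_cont, Hf. rewrite Hw, Rabs_pos_eq; lra. }
  assert (E : forall s, (0 <= s < R')%R -> Re (circ k f s) = RInt (fun t => Re (f (RtoC s * cis (k * t)))) 0 (2 * PI)).
  { intros s Hs. symmetry. apply is_RInt_unique. apply CI_Re; auto. }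
  transitivity (Re (circ k f 0)).
  - rewrite !E by lra. symmetry. apply (eq_is_derive (fun s => RInt (fun t => Re (f (RtoC s * cis (k * t)))) 0 (2 * PI))); [|lra].
    intros t Ht. apply circ_Re_derive. rewrite Rabs_pos_eq; lra.
  - unfold circ. rewrite (CI_ext 0 (2 * PI) two_PI_pos _ (fun _ => f 0)).
    + rewrite CI_const by auto. f_equal. f_equal. f_equal. ring.
    + intros t _. now rewrite Cmult_0_l.
Qed.
End Disc.

Theorem circ_mean (f : C -> C) (r : R) :
  (forall w, (Cmod w < R')%R -> hol f w) -> (0 < r < R')%R -> circ k f r = RtoC (2 * PI) * f 0.
Proof.
  intros Hf Hr.
  assert (A := circ_Re_mean f Hf r Hr).
  (* The imaginary part of [f] is the real part of [- i f]. *)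
  assert (B := circ_Re_mean (fun w => - Ci * f w) (fun w Hw => hol_mult _ _ _ (hol_const _ _) (Hf w Hw)) r Hr).
  unfold circ in B. rewrite CI_scal in B; auto.
  - fold (circ k f r) in B. revert A B. generalize (circ k f r) (f 0). intros [x1 x2] [y1 y2].
    unfold Re, Ci, Cmult, Copp, RtoC; simpl. intros A B. f_equal; lra.
  - apply con_comp_circle. intros w Hw. apply hol_cont, Hf. rewrite Hw, Rabs_pos_eq; lra.
Qed.
End MeanValue.

(** * Cauchy's formula and principal parts *)

Definition oint (F : C -> C) (r : R) : C := circ 1 F r.

(** For [F] holomorphic outside the circle the substitution [u = 1 / w] leads back to a disc: the
    mean is the value at infinity, [G 0]. *)
Lemma oint_recip (G : C -> C) (F : C -> C) (r s : R) : (0 < r)%R -> (/ r < s)%R ->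
  (forall u, (Cmod u < s)%R -> hol G u) -> (forall w, Cmod w = r -> F w = G (/ w)) ->
  oint F r = RtoC (2 * PI) * G 0.
Proof.
  intros Hr Hs HG E.
  assert (Hr' : (0 < / r)%R) by now apply Rinv_0_lt_compat.
  rewrite <- (circ_mean (-1) s (or_intror eq_refl) G (/ r)); auto.
  unfold oint, circ. apply CI_ext; auto. intros t _.
  rewrite E by (rewrite Cmod_circle, Rabs_pos_eq; lra). f_equal.
  replace (-1 * t)%R with (- (1 * t))%R by ring. rewrite cis_opp, RtoC_inv by lra.
  field. split; [apply cis_neq_0|]. intro K; apply RtoC_inj in K; lra.
Qed.

Lemma one_minus_neq_0 (x : C) : (Cmod x < 1)%R -> 1 - x <> 0.
Proof.
  intros H E. apply Cminus_eq_0 in E. rewrite <- E, Cmod_1 in H. lra.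
Qed.

Section Kernel.
Variables (r : R) (z : C).
Hypothesis Hz : (Cmod z < r)%R.

Lemma radius_pos : (0 < r)%R.
Proof. generalize (Cmod_ge_0 z). lra. Qed.

Lemma kernel_radius (a : C) : (Cmod a < r)%R ->
  exists s, (/ r < s)%R /\ forall u, (Cmod u < s)%R -> (Cmod (a * u) < 1)%R /\ (Cmod (z * u) < 1)%R.
Proof.
  intros Ha. assert (Hr := radius_pos).
  set (m := Rmax (Cmod a) (Cmod z)).
  assert (Hm : (m < r)%R) by (unfold m; apply Rmax_lub_lt; auto).
  assert (Hm0 : (0 <= m)%R) by (unfold m; eapply Rle_trans; [apply (Cmod_ge_0 a)|apply Rmax_l]).
  (* With [m < r], the number [2 / (r + m)] exceeds [1 / r] and its product with [m] is below 1: the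
     disc in [u] contains the inverted circle but no zero of [1 - a u] or [1 - z u]. *)
  exists (2 / (r + m))%R. split.
  - apply Rmult_lt_reg_l with r; auto. rewrite Rinv_r by lra.
    replace (r * (2 / (r + m)))%R with ((2 * r) / (r + m))%R by (field; lra).
    apply Rlt_div_r; lra.
  - intros u Hu. assert (Hu0 := Cmod_ge_0 u). apply Rlt_div_r in Hu; [|lra].
    assert (A : (Cmod a <= m)%R) by apply Rmax_l. assert (B : (Cmod z <= m)%R) by apply Rmax_r.
    rewrite !Cmod_mult.
    assert (Q : (Cmod u * m < 1)%R) by nra.
    assert (Cmod a * Cmod u <= m * Cmod u)%R by (apply Rmult_le_compat_r; auto).
    assert (Cmod z * Cmod u <= m * Cmod u)%R by (apply Rmult_le_compat_r; auto).
    split; lra.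
Qed.

Lemma circle_neq (w : C) (a : C) : (Cmod a < r)%R -> Cmod w = r -> w - a <> 0.
Proof. intros Ha Hw E. apply Cminus_eq_0 in E. rewrite E in Hw. lra. Qed.

Lemma circle_neq_0 (w : C) : Cmod w = r -> w <> 0.
Proof. intros Hw E. assert (Hr := radius_pos). rewrite E, Cmod_0 in Hw. lra. Qed.

Lemma oint_kernel : oint (fun w => w / (w - z)) r = RtoC (2 * PI).
Proof.
  assert (Hr := radius_pos).
  destruct (kernel_radius z Hz) as [s [Hs H]].
  rewrite (oint_recip (fun u => / (1 - z * u)) _ r s Hr Hs).
  - replace (1 - z * 0) with (RtoC 1) by ring. field.
  - intros u Hu. apply hol_inv.
    + apply hol_minus; [apply hol_const|]. apply hol_mult; [apply hol_const|apply hol_id].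
    + now apply one_minus_neq_0, H.
  - intros w Hw. assert (A := circle_neq_0 w Hw). assert (B := circle_neq w z Hz Hw). field.
    repeat split; auto.
Qed.

(** In [u = 1 / w] the integrand is [u^(j+1)] over factors that do not vanish in the disc, so its
    value at infinity is 0. *)
Lemma oint_kernel_pole (a : C) (j : nat) : (Cmod a < r)%R ->
  oint (fun w => w / (w - z) * / (w - a) ^ S j) r = 0.
Proof.
  intros Ha. assert (Hr := radius_pos).
  destruct (kernel_radius a Ha) as [s [Hs H]].
  rewrite (oint_recip (fun u => u * (u ^ j * (/ (1 - z * u) * / (1 - a * u) ^ S j))) _ r s Hr Hs).
  - ring.
  - intros u Hu. destruct (H u Hu) as [Q1 Q2].
    assert (L : forall b, hol (fun v => 1 - b * v) u).
    { intros b. apply hol_minus; [apply hol_const|]. apply hol_mult; [apply hol_const|apply hol_id]. }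
    apply hol_mult; [apply hol_id|]. apply hol_mult; [apply hol_pow, hol_id|].
    apply hol_mult; apply hol_inv; auto.
    + now apply one_minus_neq_0.
    + now apply (hol_pow (fun v => 1 - a * v)).
    + now apply Cpow_nz, one_minus_neq_0.
  - intros w Hw. assert (A := circle_neq_0 w Hw). assert (B := circle_neq w z Hz Hw).
    assert (B2 := circle_neq w a Ha Hw).
    replace (1 - a * / w) with ((w - a) * / w) by (field; auto).
    rewrite Cpow_mult_l, (Cpow_inv w (S j)) by auto. rewrite Cpow_inv by auto.
    rewrite (Cpow_S w j).
    assert (P1 := Cpow_nz (w - a) (S j) B2). assert (P2 := Cpow_nz w j A).
    generalize dependent ((w - a) ^ S j). intros X HX. field. repeat split; auto.
Qed.
End Kernel.

Lemma locally_neq (a b : C) : a <> b -> @locally C_UniformSpace a (fun w => w <> b).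
Proof.
  intros H. assert (H' : a - b <> 0) by (intro E; apply H; now apply Cminus_eq_0).
  assert (K := cont_neq_0 (fun w : C_UniformSpace => (w : C) - b) a (cont_minus _ _ a (cont_idC a) (cont_const b a)) H').
  revert K. apply filter_imp. intros w Hw E. apply Hw. rewrite E. cring.
Qed.

Lemma con_oint (r : R) (f : C -> C) a b :
  (0 < r)%R -> (forall w, Cmod w = r -> @cont C_UniformSpace f w) ->
  con a b (fun t => f (RtoC r * cis (1 * t))).
Proof. intros Hr H. apply con_comp_circle. intros w Hw. apply H. rewrite Hw. apply Rabs_pos_eq. lra. Qed.

Lemma Cmod_circle_pos (r t : R) : (0 < r)%R -> Cmod (RtoC r * cis (1 * t)) = r.
Proof. intros H. rewrite Cmod_circle. apply Rabs_pos_eq. lra. Qed.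

(** The difference quotient [psi] is holomorphic at [z] as well, which is what [An 1] provides. The
    mean of [w * psi w] is its value at 0, hence 0, and the remaining [phi z * w / (w - z)] has mean
    [phi z]. *)
Theorem cauchy_formula (phi : C -> C) (R' r : R) (z : C) :
  (forall w, (Cmod w < R')%R -> An 1 phi w) -> (Cmod z < r)%R -> (r < R')%R ->
  oint (fun w => w / (w - z) * phi w) r = RtoC (2 * PI) * phi z.
Proof.
  intros H Hz Hr. assert (Hr0 := radius_pos r z Hz).
  destruct (H z) as [g [G1 G2]]; [lra|].
  set (psi := fun w : C => if Ceq_dec w z then g z else (phi w - phi z) / (w - z)).
  assert (Hpsi : forall w, (Cmod w < R')%R -> hol psi w).
  { intros w Hw. destruct (Ceq_dec w z) as [->|N].
    - apply hol_ext with g; auto. revert G2. apply filter_imp. intros w Hw'. unfold psi.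
      destruct (Ceq_dec w z) as [->|N]; auto. rewrite Hw'.
      assert (w - z <> 0) by (intro E; apply N; now apply Cminus_eq_0).
      change C in (type of w). field. auto.
    - apply hol_ext with (fun w => (phi w - phi z) / (w - z)).
      + generalize (locally_neq w z N). apply filter_imp. intros u Hu. unfold psi.
        destruct (Ceq_dec u z); congruence.
      + apply hol_div.
        * apply hol_minus; [exact (An_hol _ _ _ (H w Hw))|apply hol_const].
        * apply hol_minus; [apply hol_id|apply hol_const].
        * intro E. apply N. now apply Cminus_eq_0. }
  assert (M : oint (fun w => w * psi w) r = 0).
  { unfold oint. rewrite (circ_mean 1 R' (or_introl eq_refl)).
    - ring.
    - intros w Hw. apply hol_mult; [apply hol_id|auto].
    - split; auto. }
  assert (K : oint (fun w => phi z * (w / (w - z))) r = phi z * RtoC (2 * PI)).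
  { unfold oint, circ. rewrite (CI_scal 0 (2 * PI) two_PI_pos (phi z) (fun t => RtoC r * cis (1 * t) / (RtoC r * cis (1 * t) - z))).
    - f_equal. apply (oint_kernel r z Hz).
    - apply (con_oint r (fun w => w / (w - z))); auto. intros w Hw. apply cont_div; auto.
      + apply cont_minus; auto. apply cont_const.
      + now apply (circle_neq r). }
  replace (RtoC (2 * PI) * phi z) with (0 + phi z * RtoC (2 * PI)) by ring.
  rewrite <- M, <- K. unfold oint, circ. rewrite <- CI_plus; auto.
  - apply CI_ext; auto. intros t _. set (w := RtoC r * cis (1 * t)).
    assert (Hw : Cmod w = r) by now apply Cmod_circle_pos.
    assert (N := circle_neq r w z Hz Hw). unfold psi. destruct (Ceq_dec w z) as [E|E].
    + exfalso. apply N. rewrite E. ring.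
    + field. auto.
  - apply (con_oint r (fun w => w * psi w)); auto. intros w Hw. apply cont_mult; auto. apply hol_cont, Hpsi. lra.
  - apply (con_oint r (fun w => phi z * (w / (w - z)))); auto. intros w Hw. apply cont_mult; [apply cont_const|].
    apply cont_div; auto.
    + apply cont_minus; auto. apply cont_const.
    + now apply (circle_neq r).
Qed.

(** * Removable singularities and principal parts *)

Definition punct (a : C) (P : C -> Prop) : Prop :=
  @locally C_UniformSpace a (fun w => w <> a -> P w).

Lemma punct_and a (P Q : C -> Prop) : punct a P -> punct a Q -> punct a (fun w => P w /\ Q w).
Proof. intros H K. unfold punct in *. generalize (filter_and _ _ H K). apply filter_imp. intros w [A B] N. auto. Qed.

Lemma punct_imp a (P Q : C -> Prop) : (forall w, P w -> Q w) -> punct a P -> punct a Q.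
Proof. intros H. unfold punct. apply filter_imp. auto. Qed.

(** Agreement with the germ [g] is asked off [a] only: division being total, [f - P] takes an
    arbitrary value at a pole. *)
Definition regular (h : C -> C) (a : C) : Prop :=
  exists g, An 1 g a /\ punct a (fun w => h w = g w).

Lemma regular_An h a : An 1 h a -> regular h a.
Proof. intros H. exists h. split; auto. apply filter_forall. auto. Qed.

Lemma regular_ext f g a : punct a (fun w => f w = g w) -> regular f a -> regular g a.
Proof.
  intros E [h [H1 H2]]. exists h. split; auto. generalize (punct_and _ _ _ E H2).
  apply punct_imp. intros w [A B]. congruence.
Qed.

Lemma regular_minus f g a : regular f a -> An 1 g a -> regular (fun w => f w - g w) a.
Proof.
  intros [h [H1 H2]] Hg. exists (fun w => h w - g w). split; [now apply An_minus|].
  revert H2. apply punct_imp. intros w ->. reflexivity.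
Qed.

Lemma C_lim_punct (h g : C -> C) (a : C) :
  @cont C_UniformSpace g a -> punct a (fun w => h w = g w) -> C_lim h a = g a.
Proof.
  intros Hg E. apply is_C_lim_unique. intros P HP. apply cont_continuous in Hg.
  specialize (Hg P HP). unfold filtermap, punct in *. unfold locally', within.
  generalize (filter_and _ _ E Hg). apply filter_imp.
  intros w [A B] N. rewrite A; auto.
Qed.

Lemma C_lim_cont (h : C -> C) (a : C) : @cont C_UniformSpace h a -> C_lim h a = h a.
Proof. intros H. apply C_lim_punct; auto. apply filter_forall. auto. Qed.

(** Replacing every value by the limit repairs all removable singularities at once, without a choice
    of germs; near [a] the result coincides with the germ at [a]. *)
Lemma regularize (h : C -> C) (a : C) (R' : R) :
  (forall w, (Cmod w < R')%R -> regular h w) -> (Cmod a < R')%R -> An 1 (C_lim h) a.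
Proof.
  intros H Ha. destruct (H a Ha) as [g [G1 G2]].
  apply An_ext with g; auto.
  assert (Gc : @locally C_UniformSpace a (fun w => @cont C_UniformSpace g w)).
  { destruct (An_hol _ _ _ G1) as [dg [D _]]. revert D. apply filter_imp.
    intros w Hw. eapply cderiv_cont, Hw. }
  unfold punct in G2. apply locally_locally in G2.
  generalize (filter_and _ _ Gc G2). apply filter_imp. intros w [A B].
  symmetry. apply C_lim_punct; auto. unfold punct.
  destruct (Ceq_dec w a) as [->|N]; [exact B|].
  generalize (filter_and _ _ B (locally_neq w a N)). apply filter_imp. tauto.
Qed.

(* A principal part whose poles lie inside the circle of radius [r] does not
   contribute to Cauchy's integral. *)
Definition negl (r : R) (P : C -> C) : Prop :=
  (forall w, Cmod w = r -> @cont C_UniformSpace P w) /\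
  forall z, (Cmod z < r)%R -> oint (fun w => w / (w - z) * P w) r = 0.

Lemma con_kernel r z P : (Cmod z < r)%R -> (forall w, Cmod w = r -> @cont C_UniformSpace P w) ->
  con 0 (2 * PI) (fun t => RtoC r * cis (1 * t) / (RtoC r * cis (1 * t) - z) * P (RtoC r * cis (1 * t))).
Proof.
  intros Hz HP. assert (Hr := radius_pos r z Hz).
  apply (con_oint r (fun w => w / (w - z) * P w)); auto.
  intros w Hw. apply cont_mult; auto. apply cont_div; auto.
  - apply cont_minus; auto. apply cont_const.
  - now apply (circle_neq r).
Qed.

Lemma negl_plus r P Q : negl r P -> negl r Q -> negl r (fun w => P w + Q w).
Proof.
  intros [P1 P2] [Q1 Q2]. split.
  - intros w Hw. apply cont_plus; auto.
  - intros z Hz. rewrite <- (Cplus_0_r 0). rewrite <- (P2 z Hz) at 1. rewrite <- (Q2 z Hz).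
    unfold oint, circ. rewrite <- CI_plus; auto; try now apply con_kernel.
    apply CI_ext; auto. intros; ring.
Qed.

Lemma negl_0 r : negl r (fun _ => 0).
Proof.
  split.
  - intros w _. apply cont_const.
  - intros z Hz. unfold oint, circ. rewrite (CI_ext 0 (2 * PI) two_PI_pos _ (fun _ => 0)) by (intros; ring).
    rewrite CI_const by auto. ring.
Qed.

Lemma negl_pole r a c j : (Cmod a < r)%R -> negl r (fun w => c / (w - a) ^ S j).
Proof.
  intros Ha. assert (C0 : forall w, Cmod w = r -> @cont C_UniformSpace (fun w => / (w - a) ^ S j) w).
  { intros w Hw. apply cont_inv.
    - apply cont_pow. apply cont_minus; auto. apply cont_const.
    - apply Cpow_nz. now apply (circle_neq r). }
  split.
  - intros w Hw. apply cont_mult; [apply cont_const|auto].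
  - intros z Hz. rewrite <- (Cmult_0_r c), <- (oint_kernel_pole r z Hz a j Ha).
    unfold oint, circ. rewrite <- CI_scal; auto.
    + apply CI_ext; auto. intros t _. unfold Cdiv. ring.
    + now apply (con_kernel r z (fun w => / (w - a) ^ S j)).
Qed.

Lemma negl_ext r P Q : (forall w, P w = Q w) -> negl r P -> negl r Q.
Proof.
  intros E [P1 P2]. split.
  - intros w Hw. apply cont_ext_loc with P; auto. apply filter_forall. auto.
  - intros z Hz. rewrite <- (P2 z Hz). unfold oint, circ. apply CI_ext; auto. intros. now rewrite E.
Qed.

Lemma negl_sum r (P : nat -> C -> C) m n : (forall k, (m <= k <= n)%nat -> negl r (P k)) ->
  negl r (fun w => @sum_n_m C_AbelianMonoid (fun k => P k w) m n).
Proof.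
  destruct (Nat.le_gt_cases m n) as [L|L].
  - induction L as [|n L IH]; intros H.
    + apply negl_ext with (P m); [|apply H; lia]. intros w. now rewrite sum_n_n.
    + apply negl_ext with (fun w => @sum_n_m C_AbelianMonoid (fun k => P k w) m n + P (S n) w).
      * intros w. rewrite sum_n_Sm by lia. reflexivity.
      * apply negl_plus; [apply IH; intros; apply H; lia|apply H; lia].
  - intros _. apply negl_ext with (fun _ => 0); [|apply negl_0].
    intros w. now rewrite sum_n_m_zero.
Qed.

(** Cauchy's formula is applied to the regularized difference [C_lim (f - P)]. It agrees with
    [f - P] on the circle and at [z], where both functions are continuous, and [P] integrates to
    0. *)
Theorem principal_parts (f P : C -> C) (R' r : R) (z : C) :
  (forall a, (Cmod a < R')%R -> regular (fun w => f w - P w) a) ->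
  (r < R')%R -> (Cmod z < r)%R -> negl r P ->
  (forall w, Cmod w = r -> @cont C_UniformSpace f w) ->
  @cont C_UniformSpace f z -> @cont C_UniformSpace P z ->
  f z - P z = / RtoC (2 * PI) * oint (fun w => w / (w - z) * f w) r.
Proof.
  intros H Hr Hz [P1 P2] Hf Hfz HPz.
  set (h := fun w => f w - P w) in *.
  assert (Hr0 := radius_pos r z Hz).
  assert (K := cauchy_formula (C_lim h) R' r z (fun w Hw => regularize h w R' H Hw) Hz Hr).
  rewrite (C_lim_cont h z) in K by now apply cont_minus.
  change (f z - P z) with (h z).
  replace (h z) with (/ RtoC (2 * PI) * (RtoC (2 * PI) * h z)).
  2:{ field. intro E; apply RtoC_inj in E. generalize PI_RGT_0. lra. }
  f_equal. rewrite <- K.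
  replace (oint (fun w => w / (w - z) * f w) r) with (oint (fun w => w / (w - z) * f w) r - oint (fun w => w / (w - z) * P w) r)
    by (rewrite (P2 z Hz); ring).
  unfold oint, circ. rewrite <- CI_minus; auto; try now apply con_kernel.
  apply CI_ext; auto. intros t _. assert (Hw := Cmod_circle_pos r t Hr0).
  rewrite (C_lim_cont h) by (apply cont_minus; auto). unfold h. ring.
Qed.

(** Induction on the order: removing [g a / (w - a)^(m+1)] leaves the divided difference of [g] over
    [(w - a)^m]. Each step uses up one order of [An], so [k] orders remain for the regular part. *)
Lemma polar_part (m k : nat) (a : C) (f g : C -> C) :
  An (m + k) g a -> punct a (fun w => f w = g w / (w - a) ^ m) ->
  exists (c : nat -> C) (h : C -> C), An k h a /\
    punct a (fun w => f w = @sum_n_m C_AbelianMonoid (fun n => c n / (w - a) ^ n) 1 m + h w).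
Proof.
  revert f g; induction m as [|m IH]; intros f g Hg E.
  - exists (fun _ => 0), g. split; auto. revert E. apply punct_imp. intros w ->.
    rewrite sum_n_m_zero by lia. simpl. change (g w / 1 = 0 + g w). field.
  - destruct Hg as [g1 [G1 G2]].
    destruct (IH (fun w => f w - g a / (w - a) ^ S m) g1 G1) as [c [h [H1 H2]]].
    + unfold punct in *. generalize (filter_and _ _ E G2). apply filter_imp. intros w [A B] N.
      assert (w - a <> 0) by (intro Q; apply N; now apply Cminus_eq_0).
      rewrite A by auto. rewrite B. simpl.
      assert (Q := Cpow_nz (w - a) m H). change C in (type of w).
      generalize dependent ((w - a) ^ m). intros. field. auto.
    + exists (fun n => if Nat.eq_dec n (S m) then g a else c n), h. split; auto.
      revert H2. apply punct_imp. intros w A. rewrite sum_n_Sm by lia.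
      destruct (Nat.eq_dec (S m) (S m)); [|congruence].
      rewrite (sum_n_m_ext_loc _ (fun n => c n / (w - a) ^ n)).
      * replace (f w) with (f w - g a / (w - a) ^ S m + g a / (w - a) ^ S m) by ring.
        rewrite A. unfold plus; simpl. cring.
      * intros n Hn. destruct (Nat.eq_dec n (S m)); [lia|auto].
Qed.

(** * Taylor and Laurent expansions *)

Lemma continuous_Cmod {X : UniformSpace} (f : X -> C) x : cont f x -> continuous (fun t => Cmod (f t)) x.
Proof.
  intros H P [eps HP]. specialize (H eps (cond_pos eps)). unfold filtermap. revert H. apply filter_imp.
  intros y Hy. apply HP. change (Rabs (Cmod (f y) - Cmod (f x)) < eps)%R.
  apply Rabs_def1.
  - generalize (Cmod_triangle_inv (f y) (f x)). lra.
  - generalize (Cmod_triangle_inv (f x) (f y)). rewrite Cmod_sub_sym. lra.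
Qed.

Lemma ex_RInt_Cmod f a b : (a <= b)%R -> con a b f -> ex_RInt (fun t => Cmod (f t)) a b.
Proof.
  intros Hab H. apply (@ex_RInt_continuous R_CompleteNormedModule). rewrite Rmin_left, Rmax_right by auto.
  intros t Ht. apply continuous_Cmod. auto.
Qed.

Lemma Csum_ext (a b : nat -> C) n : (forall k, (k <= n)%nat -> a k = b k) -> Csum a n = Csum b n.
Proof. intros H. apply sum_n_ext_loc. auto. Qed.

Lemma Csum_scal (c : C) (a : nat -> C) n : Csum (fun k => c * a k) n = c * Csum a n.
Proof.
  induction n as [|n IH].
  - now rewrite !Csum_O.
  - rewrite !Csum_S, IH. cring.
Qed.

Lemma con_Csum a b (u : nat -> R -> C) n : (forall k, con a b (u k)) -> con a b (fun t => Csum (fun k => u k t) n).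
Proof.
  intros H. induction n as [|n IH]; intros t Ht.
  - apply cont_ext_loc with (u 0%nat); [|now apply H].
    apply filter_forall. intros s. now rewrite Csum_O.
  - apply cont_ext_loc with (fun s => Csum (fun k => u k s) n + u (S n) s).
    + apply filter_forall. intros s. now rewrite Csum_S.
    + apply cont_plus; [now apply IH|now apply H].
Qed.

Lemma CI_Csum a b (u : nat -> R -> C) n : (a <= b)%R -> (forall k, con a b (u k)) ->
  CI (fun t => Csum (fun k => u k t) n) a b = Csum (fun k => CI (u k) a b) n.
Proof.
  intros Hab H. induction n as [|n IH].
  - rewrite Csum_O. apply CI_ext; auto. intros. now rewrite Csum_O.
  - rewrite Csum_S, <- IH. rewrite <- CI_plus; auto.
    + apply CI_ext; auto. intros. now rewrite Csum_S.
    + now apply con_Csum.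
Qed.

Lemma pow_lim_0 (x M eps : R) : (0 <= x < 1)%R -> (0 < eps)%R ->
  exists N, forall n, (N <= n)%nat -> (x ^ n * M < eps)%R.
Proof.
  intros Hx He.
  destruct (pow_lt_1_zero x ltac:(rewrite Rabs_pos_eq; lra) (eps / (Rabs M + 1))%R) as [N HN].
  { apply Rdiv_lt_0_compat; auto. generalize (Rabs_pos M). lra. }
  exists N. intros n Hn. specialize (HN n Hn).
  assert (P : (0 <= x ^ n)%R) by (apply pow_le; lra). rewrite Rabs_pos_eq in HN by auto.
  assert (A := Rabs_pos M). apply Rlt_div_r in HN; [|lra].
  generalize (Rle_abs M). nra.
Qed.

Lemma geom_kernel (x : C) N : 1 - x <> 0 -> Csum (fun n => x ^ n) N + x ^ S N / (1 - x) = / (1 - x).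
Proof.
  intros Hx. induction N as [|N IH].
  - rewrite Csum_O. simpl. field. auto.
  - rewrite Csum_S. rewrite <- IH, (Cpow_S x (S N)).
    generalize (x ^ S N) (Csum (fun n => x ^ n) N). intros y s. change C in (type of s). field. auto.
Qed.

(** In Cauchy's formula the kernel [1 / (1 - z / w)] is replaced by a finite geometric sum; the
    remainder is the integrand times [(z / w)^(n+1)], of modulus at most [q^(n+1)] with
    [q = |z| / r < 1]. *)
Theorem taylor (phi : C -> C) (R' : R) : (0 < R')%R -> (forall w, (Cmod w < R')%R -> An 1 phi w) ->
  exists (c : nat -> C) (r : R), (0 < r < R')%R /\ forall z, (Cmod z < r)%R ->
    is_Cseries (fun n => c n * z ^ n) (phi z).
Proof.
  intros HR H. set (r := (R' / 2)%R).
  assert (Hphi : forall w, Cmod w = r -> @cont C_UniformSpace phi w).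
  { intros w Hw. apply hol_cont, (An_hol 1), H. unfold r in Hw. lra. }
  exists (fun n => / RtoC (2 * PI) * CI (fun t => phi (RtoC r * cis (1 * t)) * / (RtoC r * cis (1 * t)) ^ n) 0 (2 * PI)), r.
  split; [unfold r; lra|]. intros z Hz. assert (Hr := radius_pos r z Hz).
  assert (Hpi : RtoC (2 * PI) <> 0).
  { intro E; apply RtoC_inj in E. generalize PI_RGT_0. lra. }
  assert (Hw0 : forall w, Cmod w = r -> w <> 0) by (intros w; apply (circle_neq_0 r z Hz)).
  assert (Ck := con_kernel r z phi Hz Hphi).
  set (K := fun t => RtoC r * cis (1 * t) / (RtoC r * cis (1 * t) - z) * phi (RtoC r * cis (1 * t))) in *.
  destruct (ex_RInt_Cmod K 0 (2 * PI) two_PI_pos Ck) as [M HM].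
  apply is_Cseries_eps. intros eps He.
  set (q := (Cmod z / r)%R).
  assert (Hq : (0 <= q < 1)%R).
  { split; [apply Rdiv_le_0_compat; auto; apply Cmod_ge_0|]. apply Rlt_div_l; lra. }
  destruct (pow_lim_0 q (q * (/ (2 * PI) * M))%R eps Hq He) as [N HN].
  exists N. intros n Hn.
  assert (Cp : forall k, con 0 (2 * PI) (fun t => phi (RtoC r * cis (1 * t)) * / (RtoC r * cis (1 * t)) ^ k)).
  { intros k. apply (con_oint r (fun w => phi w * / w ^ k)); auto. intros w Hw. apply cont_mult; auto.
    apply cont_inv; [now apply cont_pow|]. now apply Cpow_nz, Hw0. }
  assert (E1 : Csum (fun n => / RtoC (2 * PI) * CI (fun t => phi (RtoC r * cis (1 * t)) * / (RtoC r * cis (1 * t)) ^ n) 0 (2 * PI) * z ^ n) n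
     = / RtoC (2 * PI) * CI (fun t => Csum (fun k => z ^ k * (phi (RtoC r * cis (1 * t)) * / (RtoC r * cis (1 * t)) ^ k)) n) 0 (2 * PI)).
  { rewrite CI_Csum; auto.
    - rewrite <- Csum_scal. apply Csum_ext. intros k _. rewrite CI_scal; auto. ring.
    - intros k. apply con_mult; auto. apply con_const. }
  rewrite E1.
  assert (E2 : phi z = / RtoC (2 * PI) * CI K 0 (2 * PI)).
  { assert (Q := cauchy_formula phi R' r z H Hz ltac:(unfold r; lra)). unfold oint, circ in Q. fold K in Q.
    rewrite Q. field. auto. }
  rewrite E2.
  set (T := fun t => Csum (fun k => z ^ k * (phi (RtoC r * cis (1 * t)) * / (RtoC r * cis (1 * t)) ^ k)) n).
  assert (CT : con 0 (2 * PI) T).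
  { apply con_Csum. intros k. apply con_mult; auto. apply con_const. }
  replace (/ RtoC (2 * PI) * CI T 0 (2 * PI) - / RtoC (2 * PI) * CI K 0 (2 * PI))
    with (/ RtoC (2 * PI) * (CI T 0 (2 * PI) - CI K 0 (2 * PI))) by ring.
  rewrite <- CI_minus by auto. rewrite Cmod_mult, <- RtoC_inv by (generalize PI_RGT_0; lra).
  rewrite Cmod_R, Rabs_pos_eq by (left; apply Rinv_0_lt_compat; generalize PI_RGT_0; lra).
  apply Rle_lt_trans with (/ (2 * PI) * (q ^ S n * M))%R.
  - apply Rmult_le_compat_l; [left; apply Rinv_0_lt_compat; generalize PI_RGT_0; lra|].
    apply CI_norm with (fun t => (q ^ S n * Cmod (K t))%R); auto.
    + now apply con_minus.
    + intros t _. set (w := RtoC r * cis (1 * t)).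
      assert (Hw : Cmod w = r) by now apply Cmod_circle_pos.
      assert (N1 := circle_neq r w z Hz Hw). assert (N2 := Hw0 w Hw).
      assert (N3 : 1 - z / w <> 0).
      { replace (1 - z / w) with ((w - z) * / w) by (field; auto). apply Cmult_neq_0; auto.
        intro E. apply N2. replace w with (w * w * / w) by (field; auto). rewrite E. ring. }
      replace (T t - K t) with (- ((z / w) ^ S n) * K t).
      * rewrite Cmod_mult, Cmod_opp, Cmod_pow, Cmod_div, Hw by auto. right. reflexivity.
      * unfold T, K. fold w.
        replace (Csum (fun k => z ^ k * (phi w * / w ^ k)) n) with (phi w * Csum (fun k => (z / w) ^ k) n).
        -- replace (w / (w - z)) with (/ (1 - z / w)) by (field; auto).
           rewrite <- (geom_kernel (z / w) n N3) at 2.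
           generalize ((z / w) ^ S n) (Csum (fun k => (z / w) ^ k) n). intros y s. change C in (type of s).
           unfold Cdiv. ring.
        -- rewrite <- Csum_scal. apply Csum_ext. intros k _. unfold Cdiv.
           rewrite Cpow_mult_l, Cpow_inv by auto. ring.
    + exact (is_RInt_scal (V := R_NormedModule) _ 0 (2 * PI) (q ^ S n)%R M HM).
  - specialize (HN n Hn). simpl. lra.
Qed.

(** * Uniqueness of Laurent coefficients *)

Lemma cis_Z_2PI (m : Z) : cis (IZR m * (2 * PI)) = 1.
Proof.
  assert (H : forall n : nat, cis (INR n * (2 * PI)) = 1).
  { induction n as [|n IH].
    - simpl. rewrite Rmult_0_l. apply cis_0.
    - rewrite S_INR. replace ((INR n + 1) * (2 * PI))%R with (INR n * (2 * PI) + 2 * PI)%R by ring.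
      rewrite cis_plus, IH, cis_2PI. ring. }
  destruct (Z.le_gt_cases 0 m) as [L|L].
  - rewrite <- (Z2Nat.id m L), <- INR_IZR_INZ. apply H.
  - replace (IZR m * (2 * PI))%R with (- (INR (Z.to_nat (- m)) * (2 * PI)))%R.
    + rewrite cis_opp, H. field.
    + rewrite INR_IZR_INZ, Z2Nat.id by lia. rewrite opp_IZR. ring.
Qed.

Lemma con_cis a b k : con a b (fun t => cis (k * t)).
Proof. intros t _. exact (rderiv_cont _ _ _ (rderiv_cis k t)). Qed.

Lemma CI_cis (m : Z) : CI (fun t => cis (IZR m * t)) 0 (2 * PI) = if Z.eq_dec m 0 then RtoC (2 * PI) else 0.
Proof.
  destruct (Z.eq_dec m 0) as [->|N].
  - rewrite (CI_ext 0 (2 * PI) two_PI_pos _ (fun _ => 1)).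
    + rewrite CI_const by auto. rewrite Rminus_0_r. ring.
    + intros t _. rewrite Rmult_0_l. apply cis_0.
  - assert (K : RtoC (IZR m) <> 0) by (intro E; apply RtoC_inj in E; now apply (eq_IZR m 0) in E).
    assert (K2 := Ci_nz).
    rewrite (CI_FTC 0 (2 * PI) two_PI_pos (fun t => / (Ci * RtoC (IZR m)) * cis (IZR m * t))).
    + rewrite cis_Z_2PI, Rmult_0_r, cis_0. ring.
    + intros t _. replace (cis (IZR m * t)) with (/ (Ci * RtoC (IZR m)) * (Ci * RtoC (IZR m) * cis (IZR m * t))).
      * apply cara_scal, rderiv_cis.
      * field. auto.
    + apply con_cis.
Qed.

Lemma Csum_single (a : nat -> C) k n : (forall j, j <> k -> a j = 0) ->
  Csum a n = if le_dec k n then a k else RtoC 0.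
Proof.
  intros H. induction n as [|n IH].
  - rewrite Csum_O. destruct (le_dec k 0).
    + now replace k with 0%nat by lia.
    + apply H. lia.
  - rewrite Csum_S, IH. destruct (le_dec k n), (le_dec k (S n)); try lia.
    + rewrite (H (S n)) by lia. cring.
    + replace k with (S n) by lia. cring.
    + rewrite (H (S n)) by lia. cring.
Qed.

(** The point is uniformity in [w]: convergence at the larger radius [x] bounds the terms there by
    1, so on the circle of radius [q x] the tail is at most [q^n / (1 - q)]. *)
Lemma power_tail (c : nat -> C) (x q : R) (l0 : C) : (0 < x)%R -> (0 <= q < 1)%R ->
  is_Cseries (fun n => c n * RtoC x ^ n) l0 ->
  forall eps : R, (0 < eps)%R -> exists N, forall n, (N <= n)%nat ->
    forall w l : C, Cmod w = (q * x)%R -> is_Cseries (fun n => c n * w ^ n) l ->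
      (Cmod (Csum (fun n => c n * w ^ n)%C n - l) < eps)%R.
Proof.
  intros Hx Hq H eps He.
  destruct (is_Cseries_term_0 _ _ H 1%R Rlt_0_1) as [N1 H1].
  destruct (pow_lim_0 q (/ (1 - q)) (eps / 2)%R Hq ltac:(lra)) as [N2 H2].
  exists (N1 + N2)%nat. intros n Hn w l Hw Hl.
  rewrite is_Cseries_eps in Hl. destruct (Hl (eps / 2)%R ltac:(lra)) as [N3 H3].
  specialize (H3 (n + N3)%nat ltac:(lia)). specialize (H2 n ltac:(lia)).
  set (S := Csum (fun n => c n * w ^ n)) in *.
  assert (T : forall k, (Cmod (S (n + k)%nat - S n) <= (1 - q ^ k) * (q ^ n * / (1 - q)))%R).
  { induction k as [|k IH].
    - rewrite Nat.add_0_r. replace (S n - S n) with (RtoC 0) by cring. rewrite Cmod_0. simpl. lra.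
    - rewrite Nat.add_succ_r. unfold S at 1. rewrite Csum_S. fold S.
      replace (S (n + k)%nat + c (Datatypes.S (n + k)) * w ^ Datatypes.S (n + k) - S n)
        with (S (n + k)%nat - S n + c (Datatypes.S (n + k)) * w ^ Datatypes.S (n + k)) by cring.
      eapply Rle_trans; [apply Cmod_triangle|].
      assert (B : (Cmod (c (Datatypes.S (n + k)) * w ^ Datatypes.S (n + k)) <= q ^ k * q ^ n)%R).
      { specialize (H1 (Datatypes.S (n + k)) ltac:(lia)). cbv beta in H1.
        rewrite Cmod_mult, Cmod_pow in H1. rewrite Cmod_R, (Rabs_pos_eq x) in H1 by lra.
        rewrite Cmod_mult, Cmod_pow, Hw, Rpow_mult_distr.
        assert (Q0 : (0 <= q ^ n)%R) by (apply pow_le; lra). assert (Q1 : (0 <= q ^ k)%R) by (apply pow_le; lra).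
        assert (Q2 : (0 <= q ^ k * q ^ n)%R) by now apply Rmult_le_pos.
        assert (Q3 : (q ^ Datatypes.S (n + k) <= q ^ k * q ^ n)%R).
        { simpl. rewrite pow_add. nra. }
        assert (Q4 : (0 <= q ^ Datatypes.S (n + k))%R) by (apply pow_le; lra).
        generalize dependent (q ^ Datatypes.S (n + k))%R. intros y Y1 Y2.
        replace (Cmod (c (Datatypes.S (n + k))) * (y * x ^ Datatypes.S (n + k)))%R
          with (y * (Cmod (c (Datatypes.S (n + k))) * x ^ Datatypes.S (n + k)))%R by ring.
        nra. }
      assert (E : ((1 - q ^ Datatypes.S k) * (q ^ n * / (1 - q)) = (1 - q ^ k) * (q ^ n * / (1 - q)) + q ^ k * q ^ n)%R).
      { simpl. field. lra. }
      lra. }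
  specialize (T N3).
  assert (P : (0 <= q ^ n * / (1 - q))%R).
  { apply Rmult_le_pos; [apply pow_le; lra|left; apply Rinv_0_lt_compat; lra]. }
  assert (P2 : (0 <= q ^ N3)%R) by (apply pow_le; lra).
  generalize (Cmod_triangle_sub (S (n + N3)%nat - l) (S (n + N3)%nat - S n)).
  replace (S (n + N3)%nat - l - (S (n + N3)%nat - S n)) with (S n - l) by cring. nra.
Qed.

(** Fourier coefficients on the circle of radius [x = r / 2]: integrating the partial sums against
    [cis (- m t)] isolates [d m * x^m], while by uniform convergence these partial sums tend to
    0. *)
Lemma laurent_zero (d : Z -> C) (r : R) : (0 < r)%R ->
  (forall w : C, w <> 0 -> (Cmod w < r)%R -> exists l1 l2 : C,
     is_Cseries (fun n : nat => d (Z.of_nat n) * w ^ n) l1 /\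
     is_Cseries (fun n : nat => d (- Z.of_nat (S n))%Z / w ^ S n) l2 /\ l1 + l2 = 0) ->
  forall n, d n = 0.
Proof.
  intros Hr H m. set (x := (r / 2)%R). assert (Hx : (0 < x)%R) by (unfold x; lra).
  set (b := fun j : Z => d j * RtoC (powerRZ x j)).
  set (T := fun N t => Csum (fun k => b (Z.of_nat k) * cis (IZR (Z.of_nat k) * t)) N +
     Csum (fun k => b (- Z.of_nat (S k))%Z * cis (IZR (- Z.of_nat (S k)) * t)) N).
  assert (cis_pow : forall k t, cis (INR k * t) = cis t ^ k).
  { intros k t. induction k as [|k IH].
    - simpl. rewrite Rmult_0_l. apply cis_0.
    - rewrite S_INR, Rmult_plus_distr_r, cis_plus, IH, Rmult_1_l. simpl. ring. }
  assert (B : forall eps : R, (0 < eps)%R -> exists N0, forall N, (N0 <= N)%nat -> forall t, (Cmod (T N t) < eps)%R).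
  { intros eps He.
    (* Comparison radii for [power_tail] on either side of [x]: [3 x / 2], still below [r], for the
       powers of [w], and [x / 2] for the powers of [1 / w]. *)
    destruct (H (RtoC (3 / 2 * x))) as [l1 [_ [L1 _]]].
    { intro E; apply RtoC_inj in E; lra. }
    { rewrite Cmod_R, Rabs_pos_eq by lra. unfold x; lra. }
    destruct (H (RtoC (x / 2))) as [_ [l2 [_ [L2 _]]]].
    { intro E; apply RtoC_inj in E; lra. }
    { rewrite Cmod_R, Rabs_pos_eq by lra. unfold x; lra. }
    destruct (power_tail (fun n => d (Z.of_nat n)) (3 / 2 * x)%R (2 / 3)%R l1 ltac:(lra) ltac:(lra) L1 (eps / 2)%R ltac:(lra)) as [N1 H1].
    assert (L2' : is_Cseries (fun n => (d (- Z.of_nat (S n))%Z * RtoC (2 / x)) * RtoC (2 / x) ^ n) l2).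
    { revert L2. apply is_Cseries_ext. intros n. unfold Cdiv. rewrite <- Cpow_inv by (intro E; apply RtoC_inj in E; lra).
      rewrite <- RtoC_inv by lra. replace (/ (x / 2))%R with (2 / x)%R by (field; lra). rewrite Cpow_S. ring. }
    assert (Hx2 : (0 < 2 / x)%R) by (apply Rdiv_lt_0_compat; lra).
    assert (L2'' : is_Cseries (fun n => d (- Z.of_nat (S n))%Z * RtoC (2 / x) ^ n) (l2 * / RtoC (2 / x))).
    { rewrite Cmult_comm. apply is_Cseries_ext with (fun n => / RtoC (2 / x) * (d (- Z.of_nat (S n))%Z * RtoC (2 / x) * RtoC (2 / x) ^ n)).
      - intros n. field. intro E; apply RtoC_inj in E; lra.
      - now apply is_Cseries_scal. }
    destruct (power_tail (fun n => d (- Z.of_nat (S n))%Z) (2 / x)%R (1 / 2)%R _ Hx2 ltac:(lra) L2'' (x * (eps / 2))%R ltac:(nra)) as [N2 H2].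
    exists (N1 + N2)%nat. intros N HN t.
    set (w := RtoC x * cis t).
    assert (Hw : Cmod w = x) by (unfold w; rewrite Cmod_mult, Cmod_cis, Cmod_R, Rabs_pos_eq; lra).
    assert (Nw : w <> 0) by (intro E; rewrite E, Cmod_0 in Hw; lra).
    destruct (H w Nw) as [s1 [s2 [S1 [S2 S12]]]]; [rewrite Hw; unfold x; lra|].
    specialize (H1 N ltac:(lia) w s1 ltac:(rewrite Hw; lra) S1).
    assert (S2' : is_Cseries (fun n => d (- Z.of_nat (S n))%Z * (/ w) ^ n) (w * s2)).
    { generalize (is_Cseries_scal w _ _ S2). apply is_Cseries_ext. intros n. unfold Cdiv.
      rewrite <- Cpow_inv by auto. rewrite Cpow_S. field. auto. }
    specialize (H2 N ltac:(lia) (/ w) (w * s2) ltac:(rewrite Cmod_inv, Hw by auto; field; lra) S2').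
    assert (ET : T N t = (Csum (fun n => d (Z.of_nat n) * w ^ n) N - s1) + / w * (Csum (fun n => d (- Z.of_nat (S n))%Z * (/ w) ^ n) N - w * s2)).
    { replace (Csum (fun n => d (Z.of_nat n) * w ^ n) N - s1 + / w * (Csum (fun n => d (- Z.of_nat (S n))%Z * (/ w) ^ n) N - w * s2))
        with (Csum (fun n => d (Z.of_nat n) * w ^ n) N + / w * Csum (fun n => d (- Z.of_nat (S n))%Z * (/ w) ^ n) N - (s1 + s2))
        by (field; auto). rewrite S12. unfold T. rewrite <- Csum_scal.
      unfold Cminus. rewrite (Csum_ext _ (fun n => d (Z.of_nat n) * w ^ n)).
      - rewrite (Csum_ext (fun k => b (- Z.of_nat (S k))%Z * cis (IZR (- Z.of_nat (S k)) * t)) (fun k => / w * (d (- Z.of_nat (S k))%Z * (/ w) ^ k))).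
        + cring.
        + intros k _. unfold b, w. rewrite opp_IZR, <- INR_IZR_INZ, Ropp_mult_distr_l_reverse, cis_opp, cis_pow.
          rewrite powerRZ_neg', <- pow_powerRZ. rewrite RtoC_inv by (apply pow_nonzero; lra).
          rewrite RtoC_pow. assert (Q1 := cis_neq_0 t). assert (Q2 : RtoC x <> 0) by (intro E; apply RtoC_inj in E; lra).
          replace (/ (RtoC x * cis t)) with (/ RtoC x * / cis t) by (field; auto).
          rewrite !Cpow_mult_l, !Cpow_inv by auto. rewrite !Cpow_S.
          assert (Q3 := Cpow_nz _ k Q1). assert (Q4 := Cpow_nz _ k Q2).
          generalize dependent (cis t ^ k). generalize dependent (RtoC x ^ k). intros; field. auto.
      - intros k _. unfold b, w. rewrite <- INR_IZR_INZ, cis_pow, <- pow_powerRZ, RtoC_pow, Cpow_mult_l. ring. }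
    rewrite ET. eapply Rle_lt_trans; [apply Cmod_triangle|]. rewrite (Cmod_mult (/ w)), Cmod_inv, Hw by auto.
    assert ((/ x * Cmod (Csum (fun n => d (- Z.of_nat (S n))%Z * (/ w) ^ n)%C N - w * s2) < eps / 2)%R).
    { apply Rmult_lt_reg_l with x; auto. rewrite <- Rmult_assoc, Rinv_r, Rmult_1_l by lra. exact H2. }
    lra. }
  assert (CTk : forall (u : nat -> Z) (v : nat -> C) k, con 0 (2 * PI) (fun t => v k * cis (IZR (u k) * t))).
  { intros u v k. apply con_mult; [apply con_const|apply con_cis]. }
  assert (E : forall N, (Z.abs_nat m <= N)%nat -> CI (fun t => cis (IZR (- m) * t) * T N t) 0 (2 * PI) = RtoC (2 * PI) * b m).
  { intros N HN.
    assert (A : forall (u : nat -> Z), CI (fun t => Csum (fun k => b (u k) * cis (IZR (u k - m) * t)) N) 0 (2 * PI)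
       = Csum (fun k => if Z.eq_dec (u k - m) 0 then RtoC (2 * PI) * b m else RtoC 0) N).
    { intros u. rewrite (CI_Csum 0 (2 * PI) (fun k t => b (u k) * cis (IZR (u k - m) * t))); auto.
      - apply Csum_ext. intros k _. rewrite CI_scal; auto; [|apply con_cis]. rewrite CI_cis.
        destruct (Z.eq_dec (u k - m) 0) as [Z0|Z0].
        + replace (u k) with m by lia. ring.
        + ring.
      - intros k. apply (CTk (fun k => (u k - m)%Z) (fun k => b (u k))). }
    rewrite (CI_ext 0 (2 * PI) two_PI_pos _ (fun t => Csum (fun k => b (Z.of_nat k) * cis (IZR (Z.of_nat k - m) * t)) N +
       Csum (fun k => b (- Z.of_nat (S k))%Z * cis (IZR (- Z.of_nat (S k) - m) * t)) N)).
    2:{ intros t _. unfold T. rewrite Cmult_plus_distr_l, <- !Csum_scal. 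
        assert (Q : forall u, cis (IZR (u - m) * t) = cis (IZR (- m) * t) * cis (IZR u * t)).
        { intros u. rewrite <- cis_plus. f_equal. rewrite minus_IZR, opp_IZR. ring. }
        f_equal; apply Csum_ext; intros k _; rewrite Q; ring. }
    rewrite CI_plus; auto.
    2:{ apply (con_Csum 0 (2 * PI) (fun k t => b (Z.of_nat k) * cis (IZR (Z.of_nat k - m) * t))).
        intros k. apply (CTk (fun k => (Z.of_nat k - m)%Z) (fun k => b (Z.of_nat k))). }
    2:{ apply (con_Csum 0 (2 * PI) (fun k t => b (- Z.of_nat (S k))%Z * cis (IZR (- Z.of_nat (S k) - m) * t))).
        intros k. apply (CTk (fun k => (- Z.of_nat (S k) - m)%Z) (fun k => b (- Z.of_nat (S k))%Z)). }
    rewrite (A Z.of_nat), (A (fun k => - Z.of_nat (S k))%Z).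
    destruct (Z.le_gt_cases 0 m) as [L|L].
    - rewrite (Csum_single _ (Z.to_nat m)), (Csum_zero (fun k => if Z.eq_dec (- Z.of_nat (S k) - m) 0 then RtoC (2 * PI) * b m else RtoC 0)).
      + destruct (le_dec (Z.to_nat m) N); [|lia]. destruct (Z.eq_dec (Z.of_nat (Z.to_nat m) - m) 0); [|lia]. cring.
      + intros k _. destruct (Z.eq_dec (- Z.of_nat (S k) - m) 0); [lia|auto].
      + intros j Hj. destruct (Z.eq_dec (Z.of_nat j - m) 0); [lia|auto].
    - rewrite (Csum_zero (fun k => if Z.eq_dec (Z.of_nat k - m) 0 then RtoC (2 * PI) * b m else RtoC 0)), (Csum_single _ (Z.to_nat (- m - 1))).
      + destruct (le_dec (Z.to_nat (- m - 1)) N); [|lia]. destruct (Z.eq_dec (- Z.of_nat (S (Z.to_nat (- m - 1))) - m) 0); [|lia]. cring.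
      + intros j Hj. destruct (Z.eq_dec (- Z.of_nat (S j) - m) 0); [lia|auto].
      + intros k _. destruct (Z.eq_dec (Z.of_nat k - m) 0); [lia|auto]. }
  assert (b0 : b m = 0).
  { apply Cmod_eq_0. apply Rle_antisym; [|apply Cmod_ge_0]. apply le_epsilon. intros eps He.
    destruct (B eps He) as [N0 HN0]. set (N := (N0 + Z.abs_nat m)%nat).
    specialize (E N ltac:(unfold N; lia)). specialize (HN0 N ltac:(unfold N; lia)).
    assert (Q : (Cmod (CI (fun t => cis (IZR (- m) * t) * T N t)%C 0 (2 * PI)) <= (2 * PI - 0) * eps)%R).
    { apply CI_norm with (fun _ => eps); auto.
      - apply con_mult; [apply con_cis|]. apply con_plus.
        + apply (con_Csum 0 (2 * PI) (fun k t => b (Z.of_nat k) * cis (IZR (Z.of_nat k) * t))).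
          intros k. apply (CTk (fun k => (Z.of_nat k)%Z) (fun k => b (Z.of_nat k))).
        + apply (con_Csum 0 (2 * PI) (fun k t => b (- Z.of_nat (S k))%Z * cis (IZR (- Z.of_nat (S k)) * t))).
          intros k. apply (CTk (fun k => (- Z.of_nat (S k))%Z) (fun k => b (- Z.of_nat (S k))%Z)).
      - intros t _. rewrite Cmod_mult, Cmod_cis. left. rewrite Rmult_1_l. apply HN0.
      - apply (is_RInt_const (V := R_NormedModule)). }
    rewrite E, Cmod_mult, Cmod_R, Rabs_pos_eq in Q by auto. generalize PI_RGT_0. nra. }
  unfold b in b0. apply Cmult_integral in b0. destruct b0 as [b0|b0]; auto.
  exfalso. apply RtoC_inj in b0. revert b0. apply powerRZ_NOR. lra.
Qed.

Lemma laurent_unique (f : C -> C) (c c' : Z -> C) :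
  is_Laurent_expansion_0 f c -> is_Laurent_expansion_0 f c' -> forall n, c n = c' n.
Proof.
  intros [r [Hr H]] [r' [Hr' H']] n. apply Cminus_eq_0.
  apply (laurent_zero (fun n => c n - c' n) (Rmin r r')).
  - now apply Rmin_pos.
  - intros w Nw Hw.
    destruct (H w Nw) as [l1 [l2 [A1 [A2 A3]]]]; [eapply Rlt_le_trans; [exact Hw|apply Rmin_l]|].
    destruct (H' w Nw) as [m1 [m2 [B1 [B2 B3]]]]; [eapply Rlt_le_trans; [exact Hw|apply Rmin_r]|].
    exists (l1 - m1), (l2 - m2). split; [|split].
    + generalize (is_Cseries_minus _ _ _ _ A1 B1). apply is_Cseries_ext. intros; ring.
    + generalize (is_Cseries_minus _ _ _ _ A2 B2). apply is_Cseries_ext. intros; unfold Cdiv; ring.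
    + replace (l1 - m1 + (l2 - m2)) with (l1 + l2 - (m1 + m2)) by ring. rewrite <- A3, <- B3. ring.
Qed.

Lemma Laurent_coef_0_unique (f : C -> C) (c : Z -> C) n : is_Laurent_expansion_0 f c -> Laurent_coef_0 f n = c n.
Proof.
  intros H. unfold Laurent_coef_0. apply (@iota_unique C_AbsRing C_CompleteNormedModule).
  - intros y [c' [H' <-]]. exact (laurent_unique f c' c H' H n).
  - exists c. auto.
Qed.

Lemma is_Cseries_finite (a : nat -> C) m : (forall n, (m <= n)%nat -> a n = 0) ->
  is_Cseries a (@sum_n_m C_AbelianMonoid (fun n => a (pred n)) 1 m).
Proof.
  intros H. apply is_Cseries_eps. intros eps He. exists m. intros n Hn.
  replace (Csum a n - @sum_n_m C_AbelianMonoid (fun n => a (pred n)) 1 m) with (RtoC 0); [now rewrite Cmod_0|].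
  assert (E : Csum a n = @sum_n_m C_AbelianMonoid (fun n => a (pred n)) 1 (S n)).
  { unfold sum_n. now rewrite <- (sum_n_m_S (fun n => a (pred n)) 0 n). }
  rewrite E. destruct (Nat.eq_dec m (S n)) as [->|N]; [cring|].
  rewrite (sum_n_m_Chasles _ 1 m (S n)) by lia.
  rewrite (sum_n_m_ext_loc (fun n => a (pred n)) (fun _ => zero) (S m) (S n)).
  - rewrite (sum_n_m_const_zero (G := C_AbelianMonoid)). unfold plus; simpl.
    generalize (@sum_n_m C_AbelianMonoid (fun n => a (pred n)) 1 m). intros s. change C in (type of s).
    change (RtoC 0 = s + RtoC 0 - s). ring.
  - intros k Hk. apply H. lia.
Qed.

(** The Taylor series of the regularized difference together with the finite polar sum is one
    Laurent expansion of [f]; uniqueness then identifies the coefficients. *)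
Theorem laurent_principal (f : C -> C) (c : nat -> C) (m : nat) (R' : R) : (0 < R')%R ->
  (forall a, (Cmod a < R')%R ->
     regular (fun w : C => f w - @sum_n_m C_AbelianMonoid (fun n => c n / w ^ n) 1 m) a) ->
  (forall w : C, w <> 0 -> (Cmod w < R')%R -> @cont C_UniformSpace f w) ->
  forall n, (1 <= n <= m)%nat -> Laurent_coef_0 f (- Z.of_nat n) = c n.
Proof.
  intros HR H Hf n Hn.
  set (P := fun w : C => @sum_n_m C_AbelianMonoid (fun n => c n / w ^ n) 1 m) in *.
  set (h := fun w => f w - P w) in *.
  destruct (taylor (C_lim h) R' HR (fun w Hw => regularize h w R' H Hw)) as [g [r [Hr G]]].
  set (d := fun j : Z => if Z_lt_dec j 0 then (if le_dec (Z.to_nat (- j)) m then c (Z.to_nat (- j)) else 0)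
              else g (Z.to_nat j)).
  rewrite (Laurent_coef_0_unique f d).
  - unfold d. destruct (Z_lt_dec (- Z.of_nat n) 0); [|lia].
    replace (Z.to_nat (- - Z.of_nat n)) with n by lia. destruct (le_dec n m); [auto|lia].
  - exists r. split; [lra|]. intros w Nw Hw. exists (h w), (P w). split; [|split].
    + assert (Q : C_lim h w = h w).
      { apply C_lim_cont. apply cont_minus; [apply Hf; auto; lra|].
        clear - Nw. unfold P. induction m as [|m IH].
        - apply cont_ext_loc with (fun _ => RtoC 0); [|apply cont_const]. apply filter_forall. intros u.
          now rewrite sum_n_m_zero by lia.
        - apply cont_ext_loc with (fun w : C => @sum_n_m C_AbelianMonoid (fun n => c n / w ^ n) 1 m + c (S m) / w ^ S m).
          + apply filter_forall. intros u. rewrite sum_n_Sm by lia. reflexivity.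
          + apply cont_plus; auto. apply cont_div; [apply cont_const|now apply cont_pow|now apply Cpow_nz]. }
      rewrite <- Q. generalize (G w Hw). apply is_Cseries_ext. intros k. unfold d.
      destruct (Z_lt_dec (Z.of_nat k) 0); [lia|]. now rewrite Nat2Z.id.
    + assert (Q := is_Cseries_finite (fun n => d (- Z.of_nat (S n))%Z / w ^ S n) m).
      replace (P w) with (@sum_n_m C_AbelianMonoid (fun n : nat => d (- Z.of_nat (S (pred n)))%Z / w ^ S (pred n)) 1 m).
      * apply Q. intros k Hk. unfold d. destruct (Z_lt_dec (- Z.of_nat (S k)) 0); [|lia].
        destruct (le_dec (Z.to_nat (- - Z.of_nat (S k))) m); [lia|]. unfold Cdiv. ring.
      * unfold P. apply sum_n_m_ext_loc. intros k Hk. replace (S (pred k)) with k by lia. unfold d.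
        destruct (Z_lt_dec (- Z.of_nat k) 0); [|lia].
        destruct (le_dec (Z.to_nat (- - Z.of_nat k)) m); [|lia].
        now replace (Z.to_nat (- - Z.of_nat k)) with k by lia.
    + unfold h. ring.
Qed.

(** * Zeros of the derivative *)

Lemma mvt (f df : R -> R) (a b : R) : (a < b)%R ->
  (forall t, (a <= t <= b)%R -> is_derive f t (df t)) ->
  exists c, (a < c < b)%R /\ (f b - f a = df c * (b - a))%R.
Proof.
  intros Hab D. destruct (MVT_cor2 f df a b Hab) as [c [E Hc]].
  - intros t Ht. apply is_derive_Reals. auto.
  - now exists c.
Qed.

Lemma mvt_incr (f df : R -> R) (a b : R) : (a <= b)%R ->
  (forall t, (a <= t <= b)%R -> is_derive f t (df t)) ->
  (forall t, (a < t < b)%R -> (0 <= df t)%R) -> (f a <= f b)%R.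
Proof.
  intros Hab D P. destruct (Req_EM_T a b) as [->|N]; [lra|].
  destruct (mvt f df a b ltac:(lra) D) as [c [Hc E]]. specialize (P c Hc). nra.
Qed.

(** A nondecreasing function that does not end above its initial value is constant. In this form the
    lemma turns vanishing boundary terms into vanishing of a nonnegative density. *)
Lemma mono_zero (f df : R -> R) (a : R) : (0 < a)%R ->
  (forall t, (0 <= t <= a)%R -> is_derive f t (df t)) ->
  (forall t, (0 < t < a)%R -> (0 <= df t)%R) -> (f a <= f 0)%R ->
  forall t, (0 < t < a)%R -> df t = 0%R.
Proof.
  intros Ha D P E t Ht.
  assert (C0 : forall s, (0 <= s <= a)%R -> f s = f 0%R).
  { intros s Hs.
    assert (A : (f 0 <= f s)%R) by (apply (mvt_incr f df); [lra| |]; intros; [apply D|apply P]; lra).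
    assert (B : (f s <= f a)%R) by (apply (mvt_incr f df); [lra| |]; intros; [apply D|apply P]; lra).
    lra. }
  rewrite <- (is_derive_unique _ _ _ (D t ltac:(lra))).
  apply is_derive_unique. apply is_derive_ext_loc with (fun _ => f 0%R).
  - apply locally_Rabs. exists (Rmin t (a - t))%R. split; [apply Rmin_pos; lra|].
    intros y Hy. symmetry. apply C0. apply Rabs_def2 in Hy.
    generalize (Rmin_l t (a - t)) (Rmin_r t (a - t)). lra.
  - apply (is_derive_const (f 0%R) t).
Qed.

Lemma BesselJ_nz_near_0 q : exists d : R, (0 < d)%R /\ forall w : C, w <> 0 -> (Cmod w < d)%R -> J q w <> 0.
Proof.
  assert (K : @locally C_UniformSpace (RtoC 0) (fun w => Jfactor q w <> 0)).
  { apply cont_neq_0; [|apply Jfactor_0]. apply PS_cont. exact (ecoef_shift _ q (ecoef_bc q)). }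
  apply locally_Cmod in K. destruct K as [d [Hd K]]. exists d. split; auto.
  intros w Nw Hw. rewrite BesselJ_factor. apply Cmult_neq_0; [now apply Cpow_nz|].
  apply K. replace (w - RtoC 0) with w by ring. exact Hw.
Qed.

Lemma dBesselJ_nz_near_0 q : exists d : R, (0 < d)%R /\ forall w : C, w <> 0 -> (Cmod w < d)%R -> J1 q w <> 0.
Proof.
  assert (K : @locally C_UniformSpace (RtoC 0) (fun w => J1factor q w <> 0)).
  { apply cont_neq_0; [|apply J1factor_0]. apply PS_cont. exact (ecoef_shift _ (ord1 q) (ecoef_bcd q 1)). }
  apply locally_Cmod in K. destruct K as [d [Hd K]]. exists d. split; auto.
  intros w Nw Hw. rewrite dBesselJ_factor. apply Cmult_neq_0; [now apply Cpow_nz|].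
  apply K. replace (w - RtoC 0) with w by ring. exact Hw.
Qed.

(** The zeros of [J_q] do not accumulate at 0. This is the contradiction reached by the energy
    arguments, which force [J_q] to vanish along a segment issuing from 0. *)
Lemma BesselJ_segment q (z : C) (a : R) : z <> 0 -> (0 < a)%R ->
  ~ (forall t : R, (0 < t < a)%R -> J q (RtoC t * z) = 0).
Proof.
  intros Nz Ha H. destruct (BesselJ_nz_near_0 q) as [d [Hd K]].
  assert (Pz := proj1 (Cmod_gt_0 z) Nz).
  set (t := (Rmin a (d / Cmod z) / 2)%R).
  assert (Hq : (0 < d / Cmod z)%R) by (apply Rdiv_lt_0_compat; auto).
  assert (Hm := Rmin_pos a _ Ha Hq).
  assert (Ht : (0 < t)%R) by (unfold t; lra).
  apply (K (RtoC t * z)).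
  - apply Cmult_neq_0; auto. apply RtoC_neq_0. lra.
  - rewrite Cmod_mult, Cmod_R, Rabs_pos_eq by lra.
    apply Rmult_lt_reg_r with (/ Cmod z)%R; [now apply Rinv_0_lt_compat|].
    rewrite Rmult_assoc, Rinv_r, Rmult_1_r by lra.
    change (d * / Cmod z)%R with (d / Cmod z)%R. unfold t. generalize (Rmin_r a (d / Cmod z)). lra.
  - apply H. split; auto. unfold t. generalize (Rmin_l a (d / Cmod z)). lra.
Qed.

Lemma rderiv_line (F : C -> C) (L z : C) (t : R) : cderiv F (RtoC t * z) L ->
  rderiv (fun s => F (RtoC s * z)) t (L * z).
Proof.
  intros H. apply (rderiv_comp (fun s => RtoC s * z)); auto.
  apply rderiv_ext with (fun s => z * RtoC s); [intros; ring|].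
  assert (K := cara_scal _ _ _ z _ (@cara_id R_UniformSpace RtoC t)). now rewrite Cmult_1_r in K.
Qed.

Lemma rderiv_real (F : C -> C) (L : C) (t : R) : cderiv F (RtoC t) L -> rderiv (fun s => F (RtoC s)) t L.
Proof.
  intros H. replace L with (L * 1) by ring.
  apply rderiv_ext with (fun s => F (RtoC s * 1)); [intros s; f_equal; ring|].
  apply rderiv_line. now replace (RtoC t * 1) with (RtoC t) by ring.
Qed.

(** With [A t = J_q (t z)] and [B t = t A' t], Bessel's equation gives
    [t G' = |B|^2 + (q^2 - t^2 z^2) |A|^2] for [G = conj A * B], which vanishes at [t = 0] and, by
    hypothesis, at [t = 1]. *)
Lemma dBesselJ_zero_real q (z : C) : z <> 0 -> J1 q z = 0 -> Im z = 0%R.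
Proof.
  intros Nz Z.
  set (A := fun t : R => J q (RtoC t * z)).
  set (B := fun t : R => RtoC t * z * J1 q (RtoC t * z)).
  set (dA := fun t : R => J1 q (RtoC t * z) * z).
  set (dB := fun t : R => (1 * J1 q (RtoC t * z) + RtoC t * z * J2 q (RtoC t * z)) * z).
  set (G := fun t : R => Cconj (A t) * B t).
  set (dG := fun t : R => Cconj (dA t) * B t + Cconj (A t) * dB t).
  assert (DG : forall t, rderiv G t (dG t)).
  { intros t. apply rderiv_mult.
    - apply rderiv_conj. apply rderiv_line. apply BesselJ_cderiv.
    - apply (rderiv_line (fun w => w * J1 q w)). apply (cara_mult _ (fun w => w) (J1 q)); auto; [apply cara_id|].
      apply (dBesselJ_cderiv q 1). }
  assert (EG : forall t, RtoC t * dG t =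
     RtoC (Cmod (B t) ^ 2) + (RtoC (INR q * INR q) - RtoC (t * t) * (z * z)) * RtoC (Cmod (A t) ^ 2)).
  { intros t. rewrite !Cmod2_conj. unfold dG.
    assert (E1 : RtoC t * Cconj (dA t) = Cconj (B t)).
    { unfold dA, B. rewrite !Cmult_conj. replace (Cconj t) with (RtoC t) by (unfold Cconj, RtoC; simpl; f_equal; ring). ring. }
    assert (E2 : RtoC t * dB t = (RtoC (INR q * INR q) - RtoC (t * t) * (z * z)) * A t).
    { unfold dB, A. assert (O := BesselJ_ode q (RtoC t * z)). rewrite !RtoC_mult.
      set (w := RtoC t * z) in *.
      replace (RtoC t * ((1 * J1 q w + w * J2 q w) * z)) with (w * w * J2 q w + w * J1 q w) by (unfold w; ring).
      replace (w * w * J2 q w + w * J1 q w) with (w * w * J2 q w + w * J1 q w + (w * w - RtoC (INR q) * RtoC (INR q)) * J q w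
         - (w * w - RtoC (INR q) * RtoC (INR q)) * J q w) by ring.
      rewrite O. unfold w. ring. }
    replace (RtoC t * (Cconj (dA t) * B t + Cconj (A t) * dB t)) with
      (RtoC t * Cconj (dA t) * B t + Cconj (A t) * (RtoC t * dB t)) by ring.
    rewrite E1, E2. ring. }
  assert (G0 : G 0%R = 0) by (unfold G, B; ring).
  assert (G1 : G 1%R = 0).
  { unfold G, B. replace (RtoC 1 * z) with z by ring. rewrite Z. ring. }
  destruct (Req_EM_T (Im z) 0) as [E|NI]; auto. exfalso.
  assert (Pz := Cmod_ge_0).
  apply (BesselJ_segment q z 1 Nz Rlt_0_1). intros t Ht. fold (A t). apply Cmod_eq_0.
  specialize (EG).
  (* If [z^2] is real while [z] is not, then [z^2 < 0] and the real part of [t G'] is a sum of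
     nonnegative terms. Otherwise its imaginary part [- t^2 Im (z^2) |A|^2] has constant sign. In
     both cases [A] vanishes on the open segment. *)
  destruct (Req_EM_T (Im (z * z)) 0) as [I0|I0].
  - assert (R0 : Re z = 0%R).
    { destruct z as [x y]. unfold Im, Cmult, Re in *. simpl in *. 
      assert (x * y = 0)%R by lra. apply Rmult_integral in H. tauto. }
    assert (Rz : (Re (z * z) < 0)%R).
    { destruct z as [x y]. unfold Im, Cmult, Re in *. simpl in *. rewrite R0. nra. }
    assert (ER : forall s, (s * Re (dG s) = Cmod (B s) ^ 2 + (INR q * INR q - s * s * Re (z * z)) * Cmod (A s) ^ 2)%R).
    { intros s. transitivity (Re (RtoC s * dG s)).
      - destruct (dG s); unfold Re, Cmult, RtoC; simpl; ring.
      - rewrite EG. generalize (Cmod (B s)) (Cmod (A s)). intros u v. destruct (z * z) as [a b].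
        unfold Re, Cmult, Cplus, Cminus, Copp, RtoC; simpl; ring. }
    assert (Z0 : Re (dG t) = 0%R).
    { apply (mono_zero (fun s => Re (G s)) (fun s => Re (dG s)) 1 Rlt_0_1); auto.
      - intros s _. apply rderiv_Re, DG.
      - intros s Hs. apply Rmult_le_reg_l with s; [lra|]. rewrite Rmult_0_r, ER.
        assert (0 <= Cmod (B s) ^ 2)%R by apply pow2_ge_0.
        assert (0 <= Cmod (A s) ^ 2)%R by apply pow2_ge_0.
        assert (0 <= INR q * INR q - s * s * Re (z * z))%R by (generalize (pos_INR q); nra). nra.
      - rewrite G0, G1. lra. }
    specialize (ER t). rewrite Z0 in ER.
    assert (0 <= Cmod (B t) ^ 2)%R by apply pow2_ge_0.
    assert (0 <= Cmod (A t) ^ 2)%R by apply pow2_ge_0.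
    assert (0 < INR q * INR q - t * t * Re (z * z))%R.
    { assert (0 < t * t)%R by nra. assert (0 <= INR q * INR q)%R by (generalize (pos_INR q); nra).
      assert (0 < (t * t) * - Re (z * z))%R by (apply Rmult_lt_0_compat; lra). lra. }
    assert (Cmod (A t) ^ 2 = 0)%R by nra. nra.
  - assert (EI : forall s, (s * Im (dG s) = - (s * s * Im (z * z) * Cmod (A s) ^ 2))%R).
    { intros s. transitivity (Im (RtoC s * dG s)).
      - destruct (dG s); unfold Im, Cmult, RtoC; simpl; ring.
      - rewrite EG. generalize (Cmod (B s)) (Cmod (A s)). intros u v. destruct (z * z) as [a b].
        unfold Im, Cmult, Cplus, Cminus, Copp, RtoC; simpl; ring. }
    set (i := Im (z * z)) in *.
    assert (Z0 : (- i * Im (dG t) = 0)%R).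
    { apply (mono_zero (fun s => - i * Im (G s))%R (fun s => - i * Im (dG s))%R 1 Rlt_0_1); auto.
      - intros s _. apply is_derive_scal. apply rderiv_Im, DG.
      - intros s Hs. apply Rmult_le_reg_l with s; [lra|]. rewrite Rmult_0_r.
        replace (s * (- i * Im (dG s)))%R with (- i * (s * Im (dG s)))%R by ring. rewrite EI.
        replace (- i * - (s * s * i * Cmod (A s) ^ 2))%R with ((s * i * Cmod (A s)) ^ 2)%R by ring. apply pow2_ge_0.
      - rewrite G0, G1. lra. }
    specialize (EI t).
    assert (E2 : ((t * i * Cmod (A t)) ^ 2 = 0)%R).
    { replace ((t * i * Cmod (A t)) ^ 2)%R with (- i * - (t * t * i * Cmod (A t) ^ 2))%R by ring.
      rewrite <- EI. replace (- i * (t * Im (dG t)))%R with (t * (- i * Im (dG t)))%R by ring. rewrite Z0. ring. }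

    destruct (Req_EM_T (Cmod (A t)) 0) as [E|N]; auto. exfalso.
    assert ((t * i * Cmod (A t)) <> 0)%R.
    { repeat apply Rmult_integral_contrapositive_currified; auto. lra. }
    apply H. nra.
Qed.

(** * Positive zeros: simplicity, interlacing and divergence *)

Definition rj q (x : R) : R := Re (J q x).
Definition rj1 q (x : R) : R := Re (J1 q x).
Definition rj2 q (x : R) : R := Re (J2 q x).

Lemma rj_derive q x : is_derive (rj q) x (rj1 q x).
Proof. apply (rderiv_Re (fun s => J q (RtoC s))), rderiv_real, BesselJ_cderiv. Qed.

Lemma rj1_derive q x : is_derive (rj1 q) x (rj2 q x).
Proof. apply (rderiv_Re (fun s => J1 q (RtoC s))), rderiv_real, (dBesselJ_cderiv q 1). Qed.

Lemma rj_eq q (x : R) : J q x = RtoC (rj q x).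
Proof. apply BesselJ_real. Qed.
Lemma rj1_eq q (x : R) : J1 q x = RtoC (rj1 q x).
Proof. apply dBesselJ_real. Qed.
Lemma rj2_eq q (x : R) : J2 q x = RtoC (rj2 q x).
Proof. apply dBesselJ_real. Qed.

Lemma rj_ode q x : (x * x * rj2 q x + x * rj1 q x + (x * x - INR q * INR q) * rj q x = 0)%R.
Proof.
  assert (O := BesselJ_ode q x). rewrite rj_eq, rj1_eq, rj2_eq in O.
  apply RtoC_inj. rewrite <- O. rewrite !RtoC_plus, !RtoC_mult, RtoC_minus, !RtoC_mult. reflexivity.
Qed.

(** The derivative of this expression is [2 x J_q^2] by Bessel's equation, and its value at 0 is
    0. *)
Lemma rj_energy_pos q x : (0 < x)%R ->
  (0 < (x * rj1 q x) ^ 2 + (x * x - INR q * INR q) * rj q x ^ 2)%R.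
Proof.
  intros Hx. set (D := fun x => ((x * rj1 q x) ^ 2 + (x * x - INR q * INR q) * rj q x ^ 2)%R).
  assert (DD : forall t, is_derive D t (2 * t * rj q t ^ 2)%R).
  { intros t. unfold D. auto_derive.
    - split; [eexists; apply rj1_derive|split; [eexists; apply rj_derive|auto]].
    - replace (Derive (fun x => rj1 q x) t) with (rj2 q t) by (symmetry; apply is_derive_unique, rj1_derive).
      replace (Derive (fun x => rj q x) t) with (rj1 q t) by (symmetry; apply is_derive_unique, rj_derive).
      assert (O := rj_ode q t).
      replace (1 * rj1 q t + t * (1 * rj2 q t))%R with (rj1 q t + t * rj2 q t)%R by ring.
      transitivity (2 * rj1 q t * (t * t * rj2 q t + t * rj1 q t + (t * t - INR q * INR q) * rj q t) + 2 * t * rj q t ^ 2)%R.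
      + ring.
      + rewrite O. ring. }
  assert (D0 : D 0%R = 0%R).
  { unfold D. destruct q as [|q]; [simpl; ring|].
    assert (E : rj (S q) 0 = 0%R).
    { unfold rj. rewrite BesselJ_factor. rewrite Cpow_S, !Cmult_0_l. reflexivity. }
    rewrite E. ring. }
  fold (D x). apply Rnot_le_lt. intro Neg.
  apply (BesselJ_segment q 1 x C1_nz Hx). intros t Ht.
  replace (RtoC t * 1) with (RtoC t) by ring. rewrite rj_eq. f_equal.
  assert (Z := mono_zero D (fun t => 2 * t * rj q t ^ 2)%R x Hx (fun t _ => DD t)).
  assert (E : (2 * t * rj q t ^ 2 = 0)%R).
  { apply Z; auto.
    - intros s Hs. assert (0 <= rj q s ^ 2)%R by apply pow2_ge_0. nra.
    - lra. }
  apply Rmult_integral in E. destruct E as [E|E]; [lra|]. nra.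
Qed.

(** At a critical point the energy inequality reduces to [(x^2 - q^2) J_q^2 > 0], and Bessel's
    equation then excludes [J_q'' = 0]. *)
Lemma rj1_zero q x : (0 < x)%R -> rj1 q x = 0%R -> (INR q < x)%R /\ rj q x <> 0%R /\ rj2 q x <> 0%R.
Proof.
  intros Hx E. assert (P := rj_energy_pos q x Hx). rewrite E, Rmult_0_r in P.
  assert (Q := pow2_ge_0 (rj q x)).
  assert (A : (0 < x * x - INR q * INR q)%R) by nra.
  assert (B : rj q x <> 0%R) by (intro K; rewrite K in P; lra).
  split; [generalize (pos_INR q); nra|]. split; auto.
  intro K. assert (O := rj_ode q x). rewrite K, E in O.
  assert (F : ((x * x - INR q * INR q) * rj q x = 0)%R) by lra.
  apply Rmult_integral in F. destruct F; [lra|auto].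
Qed.

(** Rolle's theorem for [x J_q'], whose derivative is [- (x - q^2 / x) J_q]; the first factor does
    not vanish beyond [q]. *)
Lemma rj_zero_between q a b : (INR q < a)%R -> (a < b)%R -> rj1 q a = 0%R -> rj1 q b = 0%R ->
  exists c, (a < c < b)%R /\ rj q c = 0%R.
Proof.
  intros Ha Hab A B.
  destruct (mvt (fun x => x * rj1 q x)%R (fun x => rj1 q x + x * rj2 q x)%R a b Hab) as [c [Hc E]].
  - intros t _. auto_derive; [eexists; apply rj1_derive|].
    replace (Derive (fun x => rj1 q x) t) with (rj2 q t) by (symmetry; apply is_derive_unique, rj1_derive). ring.
  - exists c. split; auto. rewrite A, B, !Rmult_0_r, Rminus_0_r in E.
    assert (F : (rj1 q c + c * rj2 q c = 0)%R).
    { symmetry in E. apply Rmult_integral in E. destruct E; auto. lra. }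
    assert (O := rj_ode q c). assert (P := pos_INR q).
    assert (G : ((c * c - INR q * INR q) * rj q c = 0)%R).
    { replace (c * c * rj2 q c + c * rj1 q c)%R with (c * (rj1 q c + c * rj2 q c))%R in O by ring.
      rewrite F in O. lra. }
    apply Rmult_integral in G. destruct G; auto. nra.
Qed.

Lemma rj_cont q x : continuous (rj q) x.
Proof. apply (ex_derive_continuous (rj q)). eexists. apply rj_derive. Qed.
Lemma rj1_cont q x : continuous (rj1 q) x.
Proof. apply (ex_derive_continuous (rj1 q)). eexists. apply rj1_derive. Qed.

(* Zeros of [J_q] interlace, so a finite limit point would be a common zero of
   [J_q] and [J_q']. *)
Lemma zeros_unbounded q (x : nat -> R) : (0 < x 0%nat)%R -> (forall k, (x k < x (S k))%R) ->
  (forall k, rj1 q (x k) = 0%R) -> forall M, exists K, forall k, (K <= k)%nat -> (M < x k)%R.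
Proof.
  intros H0 Hi Z M.
  assert (Hmono : forall k n, (k <= n)%nat -> (x k <= x n)%R).
  { intros k n L; induction L; [lra|]. specialize (Hi m). lra. }
  destruct (classic (exists K, (M < x K)%R)) as [[K HK]|N].
  - exists K. intros k Hk. generalize (Hmono _ _ Hk). lra.
  - exfalso.
    assert (Hb : forall k, (x k <= M)%R) by (intros k; apply Rnot_lt_le; intro; apply N; eauto).
    assert (Hl : ex_finite_lim_seq x).
    { apply ex_finite_lim_seq_incr with M; [intros k; left; apply Hi|auto]. }
    destruct Hl as [l Hl].
    assert (Hlx : forall k, (x k <= l)%R).
    { apply is_lim_seq_incr_compare; [exact Hl|intros k; left; apply Hi]. }
    assert (L0 : (0 < l)%R) by (generalize (Hlx 0%nat); lra).
    assert (Hpos : forall k, (0 < x k)%R) by (intros k; generalize (Hmono 0%nat k ltac:(lia)); lra).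
    destruct (classic (exists y : nat -> R, forall k, (x k < y k < x (S k))%R /\ rj q (y k) = 0%R)) as [[y Hy]|Ny].
    + assert (Ly : is_lim_seq y l).
      { apply is_lim_seq_le_le with x (fun n => x (S n)); auto.
        - intros k. destruct (Hy k). lra.
        - now apply (is_lim_seq_incr_1 x l). }
      assert (E1 : rj1 q l = 0%R).
      { assert (Q := is_lim_seq_continuous (rj1 q) x l (proj2 (continuity_pt_filterlim _ _) (rj1_cont q l)) Hl).
        assert (Q2 : is_lim_seq (fun n => rj1 q (x n)) 0%R).
        { apply is_lim_seq_ext with (fun _ => 0%R); [intros; now rewrite Z|apply is_lim_seq_const]. }
        assert (F := is_lim_seq_unique _ _ Q). rewrite (is_lim_seq_unique _ _ Q2) in F. now injection F. }
      assert (E0 : rj q l = 0%R).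
      { assert (Q := is_lim_seq_continuous (rj q) y l (proj2 (continuity_pt_filterlim _ _) (rj_cont q l)) Ly).
        assert (Q2 : is_lim_seq (fun n => rj q (y n)) 0%R).
        { apply is_lim_seq_ext with (fun _ => 0%R); [intros n; now destruct (Hy n)|apply is_lim_seq_const]. }
        assert (F := is_lim_seq_unique _ _ Q). rewrite (is_lim_seq_unique _ _ Q2) in F. now injection F. }
      generalize (rj_energy_pos q l L0). rewrite E0, E1. lra.
    + apply Ny. apply (functional_choice (fun k y => (x k < y < x (S k))%R /\ rj q y = 0%R)).
      intros k. apply rj_zero_between; auto. apply (rj1_zero q (x k)); auto.
Qed.

(** * Principal parts of the two quotients *)

(** Write [J_q' = (w - a) H]; then [H a = J_q'' a] and [H' a = J_q''' a / 2]. The polar coefficients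
    are the value and the derivative at [a] of [g0 = N / H^2], and the three orders of [An] pay for
    these two coefficients and a regular remainder. *)
Lemma double_pole q (N : C -> C) (a N1 : C) :
  An 3 N a -> cderiv N a N1 -> J1 q a = 0 -> J2 q a <> 0 ->
  regular (fun w => N w / J1 q w ^ 2 -
    ((N a / J2 q a ^ 2) / (w - a) ^ 2 + (N1 / J2 q a ^ 2 - N a * J3 q a / J2 q a ^ 3) / (w - a))) a.
Proof.
  intros HN HN1 Z1 Z2.
  set (c := bcd q 1). assert (Hc : ecoef c) by apply ecoef_bcd.
  set (g := ddiff c a). assert (Hg : ecoef g) by now apply ecoef_ddiff.
  set (H := PS g).
  assert (E1 : forall w, J1 q w = (w - a) * H w).
  { intros w. rewrite dBesselJ_PS. fold c. rewrite (PS_ddiff c a w Hc).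
    replace (PS c a) with (J1 q a) by (rewrite dBesselJ_PS; auto). rewrite Z1. unfold H, g. ring. }
  assert (Dl : forall w, cderiv (fun w => w - a) w 1).
  { intros w. replace (RtoC 1) with (1 - 0) by ring. apply cara_minus; [apply cara_id|apply cara_const]. }
  assert (E2 : forall w, J2 q w = H w + (w - a) * PS (PSd g) w).
  { intros w. apply (cara_unique_C (J1 q) w); [apply (dBesselJ_cderiv q 1)|].
    apply cderiv_ext with (fun w => (w - a) * H w); [intros; now rewrite E1|].
    replace (H w + (w - a) * PS (PSd g) w) with (1 * H w + (w - a) * PS (PSd g) w) by ring.
    apply (cara_mult _ (fun w => w - a) H); auto. apply Dl. apply PS_cderiv; auto. }
  assert (Ha : H a = J2 q a) by (rewrite E2; ring).
  assert (E3 : J3 q a = 2 * PS (PSd g) a).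
  { apply (cara_unique_C (J2 q) a); [apply (dBesselJ_cderiv q 2)|].
    apply cderiv_ext with (fun w => H w + (w - a) * PS (PSd g) w); [intros; now rewrite E2|].
    replace (2 * PS (PSd g) a) with (PS (PSd g) a + (1 * PS (PSd g) a + (a - a) * PS (PSd (PSd g)) a)) by ring.
    apply cara_plus; [apply PS_cderiv; auto|].
    apply (cara_mult _ (fun w => w - a) (PS (PSd g))); auto. apply Dl. apply PS_cderiv. now apply ecoef_PSd. }
  set (g0 := fun w => N w / (H w * H w)).
  assert (HHa : H a * H a <> 0) by (rewrite Ha; now apply Cmult_neq_0).
  assert (A3 : An 3 g0 a).
  { apply An_div; auto. apply An_mult; now apply PS_An. }
  assert (D0 : cderiv g0 a ((N1 * (H a * H a) - N a * (PS (PSd g) a * H a + H a * PS (PSd g) a)) / ((H a * H a) * (H a * H a)))).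
  { apply (cara_div _ N (fun w => H w * H w)); auto.
    apply (cara_mult _ H H); auto; now apply PS_cderiv. }
  destruct A3 as [u1 [[u2 [U3 U4]] U2]].
  assert (U1a : cderiv g0 a (u1 a)).
  { exists u1. split; [apply hol_cont; apply (An_hol 2); exists u2; auto|]. split; auto.
    revert U2. apply filter_imp. intros w ->. cring. }
  assert (V1 := cara_unique_C _ _ _ _ U1a D0).
  exists u2. split; auto. unfold punct. generalize (filter_and _ _ U2 U4). apply filter_imp.
  intros w [W1 W2] Nw. change C in (type of w).
  assert (Nw' : w - a <> 0) by (intro E; apply Nw; now apply Cminus_eq_0).
  assert (W3 : N w / J1 q w ^ 2 = g0 w / (w - a) ^ 2).
  { unfold g0. rewrite E1. unfold Cdiv. rewrite Cpow_mult_l.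
    (* Where [H w = 0] both sides are 0, because [/ 0 = 0]. *)
    destruct (Ceq_dec (H w) 0) as [Z|Nz].
    - rewrite Z. replace (0 * 0) with (RtoC 0) by ring. replace (RtoC 0 ^ 2) with (RtoC 0) by (simpl; ring).
      rewrite Cmult_0_r. assert (I0 : / RtoC 0 = 0).
      { unfold Cinv, RtoC; simpl. f_equal; unfold Rdiv; ring. }
      rewrite I0. ring.
    - field. auto. }
  rewrite W3, W1, W2, V1, E3, Ha. unfold g0. rewrite Ha. field. auto.
Qed.

(** * The pole at the origin *)

Lemma An_sum_pole (c : nat -> C) (m k : nat) (a : C) : a <> 0 ->
  An k (fun w : C => @sum_n_m C_AbelianMonoid (fun n => c n / w ^ n) 1 m) a.
Proof.
  intros Na. induction m as [|m IH].
  - apply An_ext with (fun _ => RtoC 0); [|apply An_const]. apply filter_forall. intros w.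
    now rewrite sum_n_m_zero by lia.
  - apply An_ext with (fun w : C => @sum_n_m C_AbelianMonoid (fun n => c n / w ^ n) 1 m + c (S m) / w ^ S m).
    + apply filter_forall. intros w. now rewrite sum_n_Sm by lia.
    + apply An_plus; auto. apply An_div; [apply An_const| |now apply Cpow_nz].
      apply (An_pow k (fun w => w)). apply An_id.
Qed.

Definition polar (c : nat -> C) (m : nat) (w : C) : C :=
  @sum_n_m C_AbelianMonoid (fun n => c n / w ^ n) 1 m.

(** The clause on [q = 1] serves the point [z = 0], where [J_1'] does not vanish: the polar sum must
    be empty for [A0] to be analytic there. *)
Definition A0_spec (q : nat) (f A0 : C -> C) : Prop :=
  exists (c : nat -> C) (m : nat), (forall w, A0 w = polar c m w) /\ (q = 1%nat -> m = 0%nat) /\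
    regular (fun w => f w - polar c m w) 0.

(** [polar_part] produces a polar sum with some coefficients, and [laurent_principal] recognizes
    them as Laurent coefficients; [f] is analytic in a punctured disc since the zeros of [J_q'] do
    not accumulate at 0. *)
Lemma A0_spec_laurent q f g m (A0 : C -> C) :
  (forall w, J1 q w <> 0 -> An 1 f w) ->
  An (m + 1) g 0 -> punct 0 (fun w => f w = g w / w ^ m) -> (q = 1%nat -> m = 0%nat) ->
  (forall w, A0 w = polar (fun n => Laurent_coef_0 f (- Z.of_nat n)) m w) ->
  A0_spec q f A0.
Proof.
  intros Hf Hg E Hq HA.
  destruct (polar_part m 1 0 f g Hg) as [c [h [H1 H2]]].
  { revert E. apply punct_imp. intros w ->. now replace (w - 0) with w by ring. }
  assert (Hreg : regular (fun w => f w - polar c m w) 0).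
  { exists h. split; auto. revert H2. apply punct_imp. intros w ->.
    replace (@sum_n_m C_AbelianMonoid (fun n => c n / (w - 0) ^ n) 1 m) with (polar c m w); [cring|].
    apply sum_n_m_ext. intros n. now replace (w - 0) with w by ring. }
  destruct (dBesselJ_nz_near_0 q) as [d [Hd Nz]].
  exists c, m. split; [|split; auto]. intros w. rewrite HA. apply sum_n_m_ext_loc. intros n Hn.
  f_equal. apply (laurent_principal f c m d); auto.
  - intros a Ha. destruct (Ceq_dec a 0) as [->|Na]; auto.
    apply regular_minus; [apply regular_An; auto|]. now apply An_sum_pole.
  - intros a Na Ha. apply hol_cont, (An_hol 1). auto.
Qed.

Lemma den_An q n a : J1 q a <> 0 -> An n (den_fun q) a.
Proof.
  intros H. apply An_div; [apply An_const|apply An_pow, dBesselJ_An|now apply Cpow_nz].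
Qed.

Lemma num_An q n a : J1 q a <> 0 -> An n (num_fun q) a.
Proof.
  intros H. apply An_div; [apply (dBesselJ_An n q 0)|apply An_pow, dBesselJ_An|now apply Cpow_nz].
Qed.

Lemma J1factor_An n q a : An n (J1factor q) a.
Proof. apply PS_An. exact (ecoef_shift _ (ord1 q) (ecoef_bcd q 1)). Qed.

Lemma Jfactor_An n q a : An n (Jfactor q) a.
Proof. apply PS_An. exact (ecoef_shift _ q (ecoef_bc q)). Qed.

Lemma punct_J1factor q : punct 0 (fun w => w <> 0 /\ J1factor q w <> 0).
Proof.
  unfold punct. generalize (cont_neq_0 _ _ (hol_cont _ _ (An_hol 0 _ _ (J1factor_An 0 q 0))) (J1factor_0 q)).
  apply filter_imp. auto.
Qed.

(** The case [q = 0]: a double pole whose [1 / w] term disappears by parity, leaving [4 / w^2]. *)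
Lemma A0_spec_even (f g A0 : C -> C) :
  (forall w, g (- w) = g w) -> An 3 g 0 -> g 0 = 4 ->
  punct 0 (fun w => f w = g w / w ^ 2) -> (forall w, A0 w = 4 / w ^ 2) -> A0_spec 0 f A0.
Proof.
  intros Ev Hg G0 E HA.
  exists (fun n => if Nat.eq_dec n 2 then RtoC 4 else 0), 2%nat.
  assert (HP : forall w, polar (fun n => if Nat.eq_dec n 2 then RtoC 4 else 0) 2 w = 4 / w ^ 2).
  { intros w. unfold polar. rewrite sum_n_Sm, sum_n_n by lia. unfold plus; simpl.
    unfold Cdiv. cring. }
  split; [intros w; now rewrite HA, HP|]. split; [discriminate|].
  destruct Hg as [u1 [[u2 [U3 U4]] U2]].
  assert (Cu : @cont C_UniformSpace u1 (RtoC 0)).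
  { apply hol_cont; apply (An_hol 2); exists u2; auto. }
  assert (Hopp : @cont C_UniformSpace (fun w => - w) (RtoC 0)) by (apply cont_opp; auto).
  assert (U2' : @locally C_UniformSpace (RtoC 0) (fun w => g (- w) = g 0 + (- w - 0) * u1 (- w))).
  { apply cont_continuous in Hopp. apply (Hopp (fun w => g w = g 0 + (w - 0) * u1 w)).
    now replace (- RtoC 0) with (RtoC 0) by ring. }
  (* Evenness of [g] gives [w * (u1 w + u1 (- w)) = 0] near 0; division by [w] and continuity give
     [u1 0 = 0]. *)
  assert (Z : u1 0 = 0).
  { assert (S0 : @cont C_UniformSpace (fun w => u1 w + u1 (- w)) (RtoC 0)).
    { apply cont_plus; auto. apply (cont_comp (fun w : C_UniformSpace => - (w : C)) (RtoC 0) u1); auto.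
      now replace (- RtoC 0) with (RtoC 0) by ring. }
    assert (L : C_lim (fun w => u1 w + u1 (- w)) 0 = 0).
    { apply (C_lim_punct _ (fun _ => RtoC 0)); [apply cont_const|]. unfold punct.
      generalize (filter_and _ _ U2 U2'). apply filter_imp. intros w [A B] Nw. change C in (type of w).
      rewrite Ev, A in B.
      assert (F : w * (u1 w + u1 (- w)) = 0).
      { replace (w * (u1 w + u1 (- w))) with (g 0 + (w - 0) * u1 w - (g 0 + (- w - 0) * u1 (- w))) by ring.
        rewrite B. ring. }
      apply Cmult_integral in F. tauto. }
    assert (L2 := eq_trans (eq_sym (C_lim_cont _ _ S0)) L). clear L. rename L2 into L. cbv beta in L. replace (- RtoC 0) with (RtoC 0) in L by ring.
    replace (u1 0) with (/ 2 * (u1 0 + u1 0)) by (field; apply RtoC_neq_0; lra). rewrite L. ring. }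
  exists u2. split; auto. unfold punct in *. generalize (filter_and _ _ E (filter_and _ _ U2 U4)).
  apply filter_imp. intros w [A [B B']] Nw. change C in (type of w). rewrite HP, A by auto.
  rewrite B, B', Z, G0. field. auto.
Qed.

Lemma J1factor_even w : J1factor 0 (- w) = J1factor 0 w.
Proof.
  unfold J1factor. rewrite (PS_parity _ 0).
  - simpl. ring.
  - exact (ecoef_shift _ (ord1 0) (ecoef_bcd 0 1)).
  - intros n Hn. apply bcd_parity. simpl. replace (n + 1)%nat with (S n) by lia.
    rewrite Nat.add_0_r in Hn. exact Hn.
Qed.

Lemma BesselJ0_0 : J 0 0 = 1.
Proof. rewrite BesselJ_PS, PS_0 by auto. change (bc 0 0) with (bc 0 (2 * 0 + 0)). rewrite bc_even. f_equal. simpl. lra. Qed.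

Lemma A0_den_spec q : A0_spec q (den_fun q) (A0_den q).
Proof.
  assert (P := punct_J1factor q).
  destruct q as [|[|q]].
  - apply A0_spec_even with (fun w => 1 / (J1factor 0 w * J1factor 0 w)); auto.
    + intros w. now rewrite J1factor_even.
    + apply An_div; [apply An_const|apply An_mult; apply J1factor_An|]. apply Cmult_neq_0; apply J1factor_0.
    + rewrite J1factor_0_q0, <- RtoC_mult, <- RtoC_div by lra. f_equal. field.
    + revert P. apply punct_imp. intros w [W1 W2]. unfold den_fun. rewrite dBesselJ_factor. simpl ord1.
      field. auto.
  - apply A0_spec_laurent with (den_fun 1) 0%nat; auto.
    + intros w. apply den_An.
    + apply den_An. rewrite dBesselJ_factor. simpl. rewrite Cmult_1_l. apply J1factor_0.
    + unfold punct; apply filter_forall. intros w _. simpl. field.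
  - apply A0_spec_laurent with (fun w => 1 / (J1factor (S (S q)) w * J1factor (S (S q)) w)) (2 * (S (S q) - 1))%nat; auto.
    + intros w. apply den_An.
    + apply An_div; [apply An_const|apply An_mult; apply J1factor_An|]. apply Cmult_neq_0; apply J1factor_0.
    + revert P. apply punct_imp. intros w [W1 W2]. unfold den_fun. rewrite dBesselJ_factor. simpl ord1.
      replace (2 * (S (S q) - 1))%nat with (S q + S q)%nat by lia. rewrite Cpow_add_r.
      assert (W3 := Cpow_nz w (S q) W1). generalize dependent (w ^ S q). intros. field. auto.
    + discriminate.
Qed.

(** For [q >= 2] the numerator vanishes to order [q] and the denominator to order [2 (q - 1)], which
    leaves a pole of order [q - 2]. *)
Lemma A0_num_spec q : A0_spec q (num_fun q) (A0_num q).
Proof.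
  assert (P := punct_J1factor q).
  destruct q as [|[|q]].
  - apply A0_spec_even with (fun w => J 0 w / (J1factor 0 w * J1factor 0 w)); auto.
    + intros w. rewrite J1factor_even, BesselJ_opp. simpl. now rewrite Cmult_1_l.
    + apply An_div; [apply (dBesselJ_An 3 0 0)|apply An_mult; apply J1factor_An|]. apply Cmult_neq_0; apply J1factor_0.
    + rewrite J1factor_0_q0, BesselJ0_0, <- RtoC_mult, <- RtoC_div by lra. f_equal. field.
    + revert P. apply punct_imp. intros w [W1 W2]. unfold num_fun. rewrite dBesselJ_factor. simpl ord1.
      field. auto.
  - apply A0_spec_laurent with (num_fun 1) 0%nat; auto.
    + intros w. apply num_An.
    + apply num_An. rewrite dBesselJ_factor. simpl. rewrite Cmult_1_l. apply J1factor_0.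
    + unfold punct; apply filter_forall. intros w _. simpl. field.
  - apply A0_spec_laurent with (fun w => Jfactor (S (S q)) w / (J1factor (S (S q)) w * J1factor (S (S q)) w)) (S (S q) - 2)%nat; auto.
    + intros w. apply num_An.
    + apply An_div; [apply Jfactor_An|apply An_mult; apply J1factor_An|]. apply Cmult_neq_0; apply J1factor_0.
    + revert P. apply punct_imp. intros w [W1 W2]. unfold num_fun. rewrite dBesselJ_factor, BesselJ_factor. simpl ord1.
      replace (S (S q) - 2)%nat with q by lia. rewrite !Cpow_S.
      assert (W3 := Cpow_nz w q W1). generalize dependent (w ^ q). intros. simpl. field. auto.
    + discriminate.
Qed.

(** * Exact partial fractions inside one contour *)

Section PartialFractions.
Variables (q : nat) (zk : Z -> R) (f A0 A2 A1 : C -> C).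
Hypothesis Hzk : enumerates_zeros (J1 q) zk.
Hypothesis Hf : forall a, J1 q a <> 0 -> An 1 f a.
Hypothesis HA0 : A0_spec q f A0.
Hypothesis Hpole : forall a : C, a <> 0 -> J1 q a = 0 ->
  regular (fun w => f w - (A2 a / (w - a) ^ 2 + A1 a / (w - a))) a.

Definition term (w : C) (k : Z) : C := A2 (zk k) / (w - zk k) ^ 2 + A1 (zk k) / (w - zk k).

Lemma zk_pos k : (1 <= k)%Z -> (0 < zk k)%R.
Proof. destruct Hzk as [H _]. auto. Qed.

Lemma zk_lt j k : (1 <= j)%Z -> (j < k)%Z -> (zk j < zk k)%R.
Proof.
  intros Hj Hjk. destruct Hzk as [_ [H _]].
  assert (E : forall n : nat, (zk j < zk (j + 1 + Z.of_nat n))%R).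
  { induction n as [|n IH].
    - rewrite Z.add_0_r. apply H. lia.
    - eapply Rlt_trans; [exact IH|]. replace (j + 1 + Z.of_nat (S n))%Z with (j + 1 + Z.of_nat n + 1)%Z by lia.
      apply H. lia. }
  specialize (E (Z.to_nat (k - j - 1))). now replace (j + 1 + Z.of_nat (Z.to_nat (k - j - 1)))%Z with k in E by lia.
Qed.

Lemma zk_opp k : (1 <= k)%Z -> zk (- k) = (- zk k)%R.
Proof. destruct Hzk as [_ [_ [_ H]]]. apply H. Qed.

Lemma zk_zero k : (1 <= k)%Z -> J1 q (zk k) = 0.
Proof. intros Hk. destruct Hzk as [_ [_ [H _]]]. apply H; [now apply zk_pos|eauto]. Qed.

Lemma dBesselJ_zero_opp a : J1 q a = 0 -> J1 q (- a) = 0.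
Proof. intros H. rewrite dBesselJ_opp, H. ring. Qed.

Lemma zk_zero_opp k : (1 <= k)%Z -> J1 q (zk (- k)) = 0.
Proof. intros Hk. rewrite zk_opp, RtoC_opp by auto. now apply dBesselJ_zero_opp, zk_zero. Qed.

Lemma zeros_cases (a : C) : a <> 0 -> J1 q a = 0 -> exists k, (1 <= k)%Z /\ (a = RtoC (zk k) \/ a = RtoC (zk (- k))).
Proof.
  intros Na Z. assert (I := dBesselJ_zero_real q a Na Z).
  assert (E : a = RtoC (Re a)) by (destruct a as [x y]; unfold Im, Re, RtoC in *; simpl in *; now subst).
  destruct Hzk as [_ [_ [H _]]].
  destruct (Rtotal_order (Re a) 0) as [L|[L|L]].
  - destruct (proj1 (H (- Re a)%R ltac:(lra))) as [k [Hk Ek]].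
    + rewrite RtoC_opp, <- E. now apply dBesselJ_zero_opp.
    + exists k. split; auto. right. rewrite zk_opp, Ek by auto. rewrite Ropp_involutive. auto.
  - exfalso. apply Na. now rewrite E, L.
  - destruct (proj1 (H (Re a) L)) as [k [Hk Ek]]; [now rewrite <- E|]. exists k. split; auto. left. congruence.
Qed.

Lemma An_term k n a : a <> RtoC (zk k) -> An n (fun w => term w k) a.
Proof.
  intros Na. assert (N : a - RtoC (zk k) <> 0) by (intro E; apply Na; now apply Cminus_eq_0).
  assert (L : An n (fun w => w - RtoC (zk k)) a) by (apply An_minus; [apply An_id|apply An_const]).
  apply An_plus; apply An_div; auto; try apply An_const.
  - now apply (An_pow n (fun w => w - RtoC (zk k))).
  - now apply Cpow_nz.
Qed.

Lemma An_sym_sum K n a : (forall k, (1 <= k <= Z.of_nat K)%Z -> a <> RtoC (zk k) /\ a <> RtoC (zk (- k))) ->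
  An n (fun w => sym_partial_sum (term w) K) a.
Proof.
  unfold sym_partial_sum. induction K as [|K IH]; intros H.
  - apply An_ext with (fun _ => RtoC 0); [|apply An_const]. apply filter_forall. intros w.
    now rewrite sum_n_m_zero by lia.
  - apply An_ext with (fun w => sym_partial_sum (term w) K + (term w (Z.of_nat (S K)) + term w (- Z.of_nat (S K)))).
    + apply filter_forall. intros w. unfold sym_partial_sum. now rewrite (sum_n_Sm _ 1 K) by lia.
    + apply An_plus; [apply IH; intros; apply H; lia|].
      destruct (H (Z.of_nat (S K))) as [B C]; [lia|]. apply An_plus; now apply An_term.
Qed.

(** Only the term of index [s * j] is singular at [a]; the sign [s] treats the positive and the
    negative zero together. All other terms, including the opposite one, are analytic at [a], the
    zeros being distinct. *)
Lemma regular_sym_sum K j s a : (1 <= j <= Z.of_nat K)%Z -> (s = 1%Z \/ s = (-1)%Z) -> a = RtoC (zk (s * j)) ->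
  forall F, regular (fun w => F w - term w (s * j)) a -> regular (fun w => F w - sym_partial_sum (term w) K) a.
Proof.
  intros Hj Hs Ea F HF.
  assert (Nk : forall k, (1 <= k)%Z -> k <> j -> a <> RtoC (zk k) /\ a <> RtoC (zk (- k))).
  { intros k Hk Nkj. assert (zk k <> zk j).
    { destruct (Z.lt_total k j) as [L|[L|L]]; [|lia|].
      - generalize (zk_lt k j Hk L). lra.
      - generalize (zk_lt j k ltac:(lia) L). lra. }
    assert (Pk := zk_pos k Hk). assert (Pj := zk_pos j ltac:(lia)).
    rewrite zk_opp by auto. subst a.
    destruct Hs as [-> | ->].
    - rewrite Z.mul_1_l. split; intro E; apply RtoC_inj in E; lra.
    - replace (-1 * j)%Z with (- j)%Z by lia. rewrite zk_opp by lia. split; intro E; apply RtoC_inj in E; lra. }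
  assert (Nself : a <> RtoC (zk (- (s * j)))).
  { assert (Pj := zk_pos j ltac:(lia)). subst a. destruct Hs as [-> | ->].
    - rewrite Z.mul_1_l, zk_opp by lia. intro E; apply RtoC_inj in E; lra.
    - replace (- (-1 * j))%Z with j by lia. replace (-1 * j)%Z with (- j)%Z by lia. rewrite zk_opp by lia.
      intro E; apply RtoC_inj in E; lra. }
  unfold sym_partial_sum. revert Hj. induction K as [|K IH]; intros Hj; [lia|].
  set (SK := fun w => sym_partial_sum (term w) K).
  set (TK := fun w => term w (Z.of_nat (S K)) + term w (- Z.of_nat (S K))).
  apply regular_ext with (fun w => F w - (SK w + TK w)).
  { unfold punct; apply filter_forall. intros w _. unfold SK, TK, sym_partial_sum. now rewrite (sum_n_Sm _ 1 K) by lia. }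
  destruct (Z.eq_dec j (Z.of_nat (S K))) as [Ej|Nj].
  - apply regular_ext with (fun w => F w - term w (s * j) - (SK w + term w (- (s * j)))).
    { unfold punct; apply filter_forall. intros w _. unfold TK. rewrite <- Ej. destruct Hs as [-> | ->].
      - rewrite !Z.mul_1_l. cring.
      - replace (- (-1 * j))%Z with j by lia. replace (-1 * j)%Z with (- j)%Z by lia. cring. }
    apply regular_minus; auto. apply An_plus; [|now apply An_term].
    apply An_sym_sum. intros k Hk. apply Nk; lia.
  - apply regular_ext with (fun w => F w - SK w - TK w).
    { unfold punct; apply filter_forall. intros w _. cring. }
    apply regular_minus; [apply IH; lia|].
    destruct (Nk (Z.of_nat (S K))) as [B1 B2]; [lia|auto|]. apply An_plus; now apply An_term.
Qed.

Lemma A0_An n (a : C) : a <> 0 \/ q = 1%nat -> An n A0 a.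
Proof.
  destruct HA0 as [c [m [E [Q _]]]]. intros H.
  apply An_ext with (polar c m); [apply filter_forall; intros w; now rewrite E|].
  destruct H as [H|H].
  - now apply An_sum_pole.
  - rewrite (Q H). apply An_ext with (fun _ => RtoC 0); [|apply An_const]. apply filter_forall. intros w.
    unfold polar. now rewrite sum_n_m_zero by lia.
Qed.

Lemma A0_negl r : (0 < r)%R -> negl r A0.
Proof.
  intros Hr. destruct HA0 as [c [m [E _]]]. apply negl_ext with (polar c m); [intros; now rewrite E|].
  apply (negl_sum r (fun n w => c n / w ^ n)). intros n Hn. destruct n as [|n]; [lia|].
  apply negl_ext with (fun w => c (S n) / (w - 0) ^ S n).
  - intros w. now replace (w - 0) with w by ring.
  - apply negl_pole. now rewrite Cmod_0.
Qed.

Lemma dBesselJ_0_zero : q <> 1%nat -> J1 q 0 = 0.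
Proof.
  intros H. rewrite dBesselJ_factor. destruct q as [|[|p]]; [|lia|]; simpl; ring.
Qed.

Lemma dBesselJ_circle_neq_0 (K : nat) (r : R) : (0 < r)%R ->
  (forall k, (1 <= k <= Z.of_nat K)%Z -> (zk k < r)%R) -> (r < zk (Z.of_nat (S K)))%R ->
  forall w, Cmod w = r -> J1 q w <> 0.
Proof.
  intros Hr HK HK' w Hw Z.
  assert (Nw : w <> 0) by (intro E; rewrite E, Cmod_0 in Hw; lra).
  destruct (zeros_cases w Nw Z) as [k [Hk E]].
  assert (Ew : r = zk k).
  { rewrite <- Hw. assert (P := zk_pos k Hk). destruct E as [-> | ->].
    - rewrite Cmod_R, Rabs_pos_eq; lra.
    - rewrite zk_opp, Cmod_R, Rabs_Ropp, Rabs_pos_eq; lra || auto. }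
  destruct (Z.le_gt_cases k (Z.of_nat K)) as [L|L].
  - specialize (HK k ltac:(lia)). lra.
  - destruct (Z.eq_dec k (Z.of_nat (S K))) as [E'|N]; [subst k; lra|].
    generalize (zk_lt (Z.of_nat (S K)) k ltac:(lia) ltac:(lia)). lra.
Qed.

(** An equality, not an estimate: the circle separates the [K]th zero from the next one, and [f]
    minus its principal parts is regular in the whole disc up to that next zero. *)
Theorem partial_fraction_step (K : nat) (r : R) (z : C) :
  (forall k, (1 <= k <= Z.of_nat K)%Z -> (zk k < r)%R) -> (r < zk (Z.of_nat (S K)))%R -> (Cmod z < r)%R ->
  J1 q z <> 0 ->
  f z - (A0 z + sym_partial_sum (term z) K) = / RtoC (2 * PI) * oint (fun w => w / (w - z) * f w) r.
Proof.
  intros HK HK' Hz Nz. assert (Hr := radius_pos r z Hz).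
  (* The point [z = 0] is admissible for [q = 1] alone, since otherwise [J_q' 0 = 0]. *)
  assert (Hz0 : z <> 0 \/ q = 1%nat).
  { destruct (Nat.eq_dec q 1) as [E|E]; auto. left. intro E0. apply Nz. subst z. now apply dBesselJ_0_zero. }
  assert (Nzeros : forall k, (1 <= k)%Z -> z <> RtoC (zk k) /\ z <> RtoC (zk (- k))).
  { intros k Hk. split; intro E; apply Nz; rewrite E; [now apply zk_zero|now apply zk_zero_opp]. }
  assert (Hcirc := dBesselJ_circle_neq_0 K r Hr HK HK').
  apply (principal_parts f (fun w => A0 w + sym_partial_sum (term w) K) (zk (Z.of_nat (S K))) r z); auto.
  - intros a Ha. destruct (Ceq_dec a 0) as [->|Na].
    + apply regular_ext with (fun w => f w - A0 w - sym_partial_sum (term w) K).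
      { unfold punct; apply filter_forall. intros w _. cring. }
      apply regular_minus.
      * destruct HA0 as [c [m [E [_ Hreg]]]]. apply regular_ext with (fun w => f w - polar c m w); auto.
        unfold punct; apply filter_forall. intros w _. now rewrite E.
      * apply An_sym_sum. intros k Hk. assert (P := zk_pos k ltac:(lia)). rewrite zk_opp by lia.
        split; intro E; apply RtoC_inj in E; lra.
    + assert (A0a : An 1 A0 a) by (apply A0_An; auto).
      apply regular_ext with (fun w => f w - sym_partial_sum (term w) K - A0 w).
      { unfold punct; apply filter_forall. intros w _. cring. }
      apply regular_minus; auto.
      destruct (Ceq_dec (J1 q a) 0) as [Z|Z].
      * destruct (zeros_cases a Na Z) as [k [Hk E]].
        assert (Pk := zk_pos k Hk).
        assert (HkK : (1 <= k <= Z.of_nat K)%Z).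
        { split; auto. assert (L : (zk k < zk (Z.of_nat (S K)))%R).
          { eapply Rle_lt_trans; [|exact Ha]. destruct E as [-> | ->].
            - rewrite Cmod_R, Rabs_pos_eq; lra.
            - rewrite zk_opp, Cmod_R, Rabs_Ropp, Rabs_pos_eq; lra || auto. }
          destruct (Z.le_gt_cases k (Z.of_nat K)) as [|L']; auto. exfalso.
          destruct (Z.eq_dec k (Z.of_nat (S K))) as [E'|N]; [subst k; lra|].
          generalize (zk_lt (Z.of_nat (S K)) k ltac:(lia) ltac:(lia)). lra. }
        destruct E as [E|E].
        -- apply (regular_sym_sum K k 1 a); auto; [now rewrite Z.mul_1_l|].
           rewrite Z.mul_1_l. unfold term. rewrite <- E. auto.
        -- apply (regular_sym_sum K k (-1) a); auto; replace (-1 * k)%Z with (- k)%Z by lia; auto.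
           unfold term. rewrite <- E. auto.
      * apply regular_minus; [apply regular_An; auto|]. apply An_sym_sum. intros k Hk.
        split; intro E; apply Z; rewrite E; [apply zk_zero|apply zk_zero_opp]; lia.
  - apply negl_plus; [now apply A0_negl|].
    apply (negl_sum r (fun k w => term w (Z.of_nat k) + term w (- Z.of_nat k))). intros k Hk.
    assert (NT : forall j, (Cmod (RtoC (zk j)) < r)%R -> negl r (fun w => term w j)).
    { intros j Hj. apply negl_plus; [apply (negl_pole r _ _ 1); auto|].
      apply negl_ext with (fun w => A1 (zk j) / (w - zk j) ^ 1); [intros; now rewrite Cpow_1_r|].
      now apply (negl_pole r _ _ 0). }
    assert (P := zk_pos (Z.of_nat k) ltac:(lia)). specialize (HK (Z.of_nat k) ltac:(lia)).
    apply negl_plus; apply NT.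
    + rewrite Cmod_R, Rabs_pos_eq; lra.
    + rewrite zk_opp, Cmod_R, Rabs_Ropp, Rabs_pos_eq; lra || lia.
  - intros w Hw. apply hol_cont, (An_hol 1). auto.
  - apply hol_cont, (An_hol 1). auto.
  - apply cont_plus; apply hol_cont; apply (An_hol 1); [now apply A0_An|].
    apply An_sym_sum. intros k Hk. apply Nzeros. lia.
Qed.
End PartialFractions.

Open Scope R_scope.

(** * Growth of [J_0] along the imaginary axis *)

(** The central binomial coefficient over [4^m], which is also the quotient of the coefficient
    [1 / (4^m m!^2)] of [I_0] by the coefficient [1 / (2 m)!] of [cosh]. *)
Definition wallis (m : nat) : R := INR (fact (2 * m)) / (4 ^ m * (INR (fact m) * INR (fact m))).

Lemma wallis_S m : wallis (S m) = wallis m * ((2 * INR m + 1) / (2 * INR m + 2)).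
Proof.
  unfold wallis. replace (2 * S m)%nat with (S (S (2 * m))) by lia.
  rewrite !fact_simpl, !mult_INR, !S_INR, mult_INR. simpl (INR 2). simpl (4 ^ S m).
  assert (H := INR_fact_neq_0 m). assert (P := pos_INR m).
  assert (H4 : 4 ^ m <> 0) by (apply pow_nonzero; lra).
  field. repeat split; auto; lra.
Qed.

Lemma wallis_pos m : 0 < wallis m.
Proof.
  unfold wallis. apply Rdiv_lt_0_compat; [apply INR_fact_lt_0|].
  apply Rmult_lt_0_compat; [apply pow_lt; lra|]. apply Rmult_lt_0_compat; apply INR_fact_lt_0.
Qed.

Definition sinI (n : nat) : R := RInt (fun t => sin t ^ n) 0 (PI / 2).

Lemma continuous_sin_pow n t : continuous (fun t => sin t ^ n) t.
Proof.
  apply (ex_derive_continuous (fun t => sin t ^ n)). auto_derive. auto.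
Qed.

Lemma sinI_is n : is_RInt (fun t => sin t ^ n) 0 (PI / 2) (sinI n).
Proof.
  apply (@RInt_correct R_CompleteNormedModule). apply (@ex_RInt_continuous R_CompleteNormedModule).
  intros t _. apply continuous_sin_pow.
Qed.

Lemma PI2_pos : 0 <= PI / 2.
Proof. generalize PI_RGT_0. lra. Qed.

(** The integrand is the derivative of [sin^(n+1) cos], which vanishes at both ends. *)
Lemma sinI_rec n : (INR n + 2) * sinI (S (S n)) = (INR n + 1) * sinI n.
Proof.
  assert (H : is_RInt (fun t => (INR n + 1) * sin t ^ n - (INR n + 2) * sin t ^ S (S n)) 0 (PI / 2)
     (minus (sin (PI / 2) ^ S n * cos (PI / 2)) (sin 0 ^ S n * cos 0))).
  { apply (is_RInt_derive (V := R_CompleteNormedModule) (fun t => sin t ^ S n * cos t)).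
    - intros t _. auto_derive; auto.
      replace (match n with 0%nat => 1 | S _ => INR n + 1 end) with (INR n + 1) by (destruct n; simpl; ring).
      replace (sin t ^ S (S n)) with (sin t ^ n * (sin t * sin t)) by (simpl; ring).
      replace (cos t * cos t) with (1 - sin t * sin t) by (generalize (sin2_cos2 t); unfold Rsqr; lra).
      simpl. generalize (sin2_cos2 t). unfold Rsqr. intros E.
      replace ((INR n + 1) * sin t ^ n - (INR n + 2) * (sin t ^ n * (sin t * sin t)))
        with ((INR n + 1) * sin t ^ n * (cos t * cos t) - sin t ^ n * (sin t * sin t)).
      + ring.
      + replace (cos t * cos t) with (1 - sin t * sin t) by lra. ring.
    - intros t _. apply (ex_derive_continuous (fun t => (INR n + 1) * sin t ^ n - (INR n + 2) * sin t ^ S (S n))).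
      auto_derive. auto. }
  assert (K : is_RInt (fun t => (INR n + 1) * sin t ^ n - (INR n + 2) * sin t ^ S (S n)) 0 (PI / 2)
     ((INR n + 1) * sinI n - (INR n + 2) * sinI (S (S n)))).
  { exact (is_RInt_minus (V := R_NormedModule) _ _ _ _ _ _
      (is_RInt_scal (V := R_NormedModule) _ _ _ (INR n + 1) _ (sinI_is n))
      (is_RInt_scal (V := R_NormedModule) _ _ _ (INR n + 2) _ (sinI_is (S (S n))))). }
  assert (E := is_RInt_unique _ _ _ _ H). rewrite (is_RInt_unique _ _ _ _ K) in E.
  rewrite sin_PI2, cos_PI2, sin_0 in E. unfold minus, plus, opp in E. simpl in E. lra.
Qed.

Lemma sinI_decr n : sinI (S n) <= sinI n.
Proof.
  apply (is_RInt_le (fun t => sin t ^ S n) (fun t => sin t ^ n) 0 (PI / 2)); try apply sinI_is.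
  - apply PI2_pos.
  - intros t Ht. simpl. assert (0 <= sin t) by (apply sin_ge_0; lra).
    assert (0 <= sin t ^ n) by now apply pow_le. generalize (SIN_bound t). nra.
Qed.

Lemma sinI_0 : sinI 0 = PI / 2.
Proof.
  unfold sinI. rewrite (RInt_ext _ (fun _ => 1)) by (intros; reflexivity).
  rewrite RInt_const. unfold scal; simpl; unfold mult; simpl. ring.
Qed.

Lemma sinI_1 : sinI 1 = 1.
Proof.
  apply is_RInt_unique.
  replace 1 with (minus (- cos (PI / 2)) (- cos 0)).
  - apply (is_RInt_derive (V := R_CompleteNormedModule) (fun t => - cos t)).
    + intros t _. auto_derive; auto. ring.
    + intros t _. apply continuous_sin_pow.
  - rewrite cos_PI2, cos_0. unfold minus, plus, opp; simpl. ring.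
Qed.

Lemma sinI_even m : sinI (2 * m) = PI / 2 * wallis m.
Proof.
  induction m as [|m IH].
  - rewrite Nat.mul_0_r, sinI_0. unfold wallis. simpl. field.
  - assert (R := sinI_rec (2 * m)). replace (2 * S m)%nat with (S (S (2 * m))) by lia.
    rewrite mult_INR in R. simpl (INR 2) in R. rewrite IH in R. rewrite wallis_S. assert (P := pos_INR m).
    apply Rmult_eq_reg_l with (2 * INR m + 2); [|lra]. 
    replace ((1 + 1) * INR m + 2) with (2 * INR m + 2) in R by ring. rewrite R. field. lra.
Qed.

Lemma sinI_odd m : sinI (S (2 * m)) * ((2 * INR m + 1) * wallis m) = 1.
Proof.
  induction m as [|m IH].
  - rewrite Nat.mul_0_r, sinI_1. unfold wallis. simpl. field.
  - assert (R := sinI_rec (S (2 * m))). replace (2 * S m)%nat with (S (S (2 * m))) by lia.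
    rewrite S_INR, mult_INR in R. simpl (INR 2) in R. rewrite wallis_S, S_INR. assert (P := pos_INR m).
    assert (Ey : sinI (S (S (S (2 * m)))) = (2 * INR m + 2) * sinI (S (2 * m)) / (2 * INR m + 3)).
    { apply Rmult_eq_reg_l with (2 * INR m + 3); [|lra].
      replace ((1 + 1) * INR m + 1 + 2) with (2 * INR m + 3) in R by ring. rewrite R. field. lra. }
    rewrite Ey. transitivity (sinI (S (2 * m)) * ((2 * INR m + 1) * wallis m)); [field; lra|exact IH].
Qed.

(** [sinI] decreases with the exponent: comparing exponents [2 m] and [2 m + 1] gives this bound,
    and [2 m + 1] with [2 m + 2] gives [wallis_upper]. *)
Lemma wallis_lower m : 2 / PI <= (2 * INR m + 1) * wallis m ^ 2.
Proof.
  assert (A := sinI_decr (2 * m)). rewrite sinI_even in A. assert (B := sinI_odd m).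
  assert (W := wallis_pos m). assert (P := pos_INR m). assert (Q := PI_RGT_0).
  assert (K : 1 <= PI / 2 * wallis m * ((2 * INR m + 1) * wallis m)).
  { eapply Rle_trans; [right; symmetry; exact B|]. apply Rmult_le_compat_r; auto. apply Rmult_le_pos; lra. }
  apply Rmult_le_reg_l with (PI / 2); [lra|]. replace (PI / 2 * (2 / PI)) with 1 by (field; lra).
  eapply Rle_trans; [exact K|]. right. ring.
Qed.

Lemma wallis_upper m : 2 * INR (S m) * wallis (S m) ^ 2 <= 2 / PI.
Proof.
  assert (A := sinI_decr (S (2 * m))). replace (S (S (2 * m))) with (2 * S m)%nat in A by lia.
  rewrite sinI_even in A. assert (B := sinI_odd m).
  assert (W := wallis_pos m). assert (P := pos_INR m). assert (Q := PI_RGT_0).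
  assert (E : (2 * INR m + 1) * wallis m = 2 * INR (S m) * wallis (S m)).
  { rewrite wallis_S, S_INR. field. lra. }
  rewrite E in B. assert (W' := wallis_pos (S m)).
  assert (K : PI / 2 * wallis (S m) * (2 * INR (S m) * wallis (S m)) <= 1).
  { eapply Rle_trans; [|right; exact B]. apply Rmult_le_compat_r; auto. apply Rmult_le_pos; [|lra]. generalize (pos_INR (S m)); lra. }
  apply Rmult_le_reg_l with (PI / 2); [lra|]. replace (PI / 2 * (2 / PI)) with 1 by (field; lra).
  eapply Rle_trans; [|exact K]. right. ring.
Qed.

Lemma wallis_0 : wallis 0 = 1.
Proof. unfold wallis. simpl. field. Qed.

(** The right side is shaped so that multiplication by [cterm x m] gives terms of known series:
    [1 / (2 m + 1)] turns them into [sinh x / x], and the second fraction into shifted terms of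
    [cosh]. *)
Lemma wallis_sqr_le m : wallis m ^ 2 <= 2 / PI * (/ (2 * INR m + 1) + 2 / ((2 * INR m + 1) * (2 * INR m + 2))).
Proof.
  assert (Q := PI_RGT_0). assert (Q4 := PI_4).
  destruct m as [|m].
  - rewrite wallis_0. simpl. apply Rmult_le_reg_l with PI; auto.
    replace (PI * (2 / PI * (/ (2 * 0 + 1) + 2 / ((2 * 0 + 1) * (2 * 0 + 2))))) with 4 by (field; lra). lra.
  - assert (U := wallis_upper m). set (n := INR (S m)) in *.
    assert (Hn : 1 <= n) by (unfold n; rewrite S_INR; generalize (pos_INR m); lra).
    apply Rle_trans with (2 / PI * (/ (2 * n))).
    + apply Rmult_le_reg_l with (2 * n); [lra|]. eapply Rle_trans; [exact U|]. right. field. lra.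
    + apply Rmult_le_compat_l; [apply Rdiv_le_0_compat; lra|].
      apply Rmult_le_reg_l with (2 * n * ((2 * n + 1) * (2 * n + 2))).
      * repeat apply Rmult_lt_0_compat; lra.
      * replace (2 * n * ((2 * n + 1) * (2 * n + 2)) * / (2 * n)) with ((2 * n + 1) * (2 * n + 2)) by (field; lra).
        replace (2 * n * ((2 * n + 1) * (2 * n + 2)) * (/ (2 * n + 1) + 2 / ((2 * n + 1) * (2 * n + 2))))
          with (2 * n * (2 * n + 2) + 4 * n) by (field; lra). nra.
Qed.

Lemma rseries_scal (c : R) (a : nat -> R) (l : R) : is_series a l -> is_series (fun n => c * a n) (c * l).
Proof. intros H. exact (is_series_scal c a l H). Qed.

Lemma rseries_plus (a b : nat -> R) (l m : R) :
  is_series a l -> is_series b m -> is_series (fun n => a n + b n) (l + m).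
Proof. intros H K. exact (is_series_plus a b l m H K). Qed.

Lemma rseries_minus (a b : nat -> R) (l m : R) :
  is_series a l -> is_series b m -> is_series (fun n => a n - b n) (l - m).
Proof. intros H K. exact (is_series_minus a b l m H K). Qed.

(** * Comparison of [I_0] with [cosh] *)

Definition cterm (x : R) (m : nat) : R := x ^ (2 * m) / INR (fact (2 * m)).
Definition sterm (x : R) (m : nat) : R := x ^ (2 * m) / INR (fact (S (2 * m))).

(** The even and odd parts of the exponential series depend on [x^2] only, so [exp y = c + y s] for
    both [y = x] and [y = - x]; solving for [c] and [s] gives the two sums. *)
Lemma cosh_sinh_series x : x <> 0 -> is_series (cterm x) (cosh x) /\ is_series (sterm x) (sinh x / x).
Proof.
  intros Hx.
  assert (Ce : ex_series (cterm x)).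
  { apply (@ex_series_le R_AbsRing R_CompleteNormedModule _ (fun m => (x ^ 2) ^ m / INR (fact m))).
    - intros m. change (Rabs (cterm x m) <= (x ^ 2) ^ m / INR (fact m)). unfold cterm. rewrite pow_mult.
      assert (0 <= (x ^ 2) ^ m) by (apply pow_le, pow2_ge_0).
      assert (A := INR_fact_lt_0 m). assert (B := INR_fact_lt_0 (2 * m)).
      rewrite Rabs_pos_eq by (apply Rdiv_le_0_compat; auto).
      apply Rmult_le_compat_l; auto. apply Rinv_le_contravar; auto. apply le_INR, fact_le. lia.
    - exists (exp (x ^ 2)). generalize (is_exp_Reals (x ^ 2)). apply is_series_ext.
      intros n. rewrite pow_n_pow. reflexivity. }
  assert (Se : ex_series (sterm x)).
  { apply (@ex_series_le R_AbsRing R_CompleteNormedModule _ (cterm x)); auto.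
    intros m. change (Rabs (sterm x m) <= cterm x m). unfold sterm, cterm. rewrite pow_mult.
    assert (0 <= (x ^ 2) ^ m) by (apply pow_le, pow2_ge_0).
    assert (A := INR_fact_lt_0 (S (2 * m))). assert (B := INR_fact_lt_0 (2 * m)).
    rewrite Rabs_pos_eq by (apply Rdiv_le_0_compat; auto).
    apply Rmult_le_compat_l; auto. apply Rinv_le_contravar; auto. apply le_INR, fact_le. lia. }
  destruct Ce as [c Hc], Se as [s Hs]. change R in (type of c), (type of s).
  assert (E : forall y, y ^ 2 = x ^ 2 -> exp y = c + y * s).
  { intros y Hy.
    assert (K : is_pseries (fun n => / INR (fact n)) y (c + y * s)).
    { apply is_pseries_odd_even.
      - revert Hc. apply is_series_ext. intros n. transitivity ((y ^ 2) ^ n * / INR (fact (2 * n))); [|now rewrite <- pow_n_pow].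
        rewrite Hy. unfold cterm. now rewrite pow_mult.
      - revert Hs. apply is_series_ext. intros n. transitivity ((y ^ 2) ^ n * / INR (fact (2 * n + 1))); [|now rewrite <- pow_n_pow].
        rewrite Hy. unfold sterm. replace (2 * n + 1)%nat with (S (2 * n)) by lia. now rewrite pow_mult. }
    rewrite <- (is_pseries_unique _ _ _ (is_exp_Reals y)). exact (is_pseries_unique _ _ _ K). }
  assert (E1 := E x eq_refl). assert (E2 := E (- x) ltac:(ring)).
  replace (cosh x) with c by (unfold cosh; lra).
  replace (sinh x / x) with s; auto. unfold sinh. rewrite E1, E2. field. auto.
Qed.

Lemma sinh_le_cosh x : sinh x <= cosh x.
Proof. unfold sinh, cosh. generalize (exp_pos (- x)). lra. Qed.

Lemma cosh_pos x : 0 < cosh x.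
Proof. unfold cosh. generalize (exp_pos (- x)) (exp_pos x). lra. Qed.

(** The modified Bessel function, its coefficients written as weights on the [cosh] series. *)
Definition I0 (x : R) : R := Series (fun m => wallis m * cterm x m).

Lemma cterm_pos x m : 0 < x -> 0 < cterm x m.
Proof. intros H. apply Rdiv_lt_0_compat; [now apply pow_lt|apply INR_fact_lt_0]. Qed.

Lemma wallis_le_1 m : wallis m <= 1.
Proof.
  induction m as [|m IH]; [rewrite wallis_0; lra|].
  rewrite wallis_S. assert (P := pos_INR m). assert (W := wallis_pos m).
  assert ((2 * INR m + 1) / (2 * INR m + 2) <= 1) by (apply Rle_div_l; lra).
  assert (0 <= (2 * INR m + 1) / (2 * INR m + 2)) by (apply Rdiv_le_0_compat; lra). nra.
Qed.

Lemma I0_is x : 0 < x -> is_series (fun m => wallis m * cterm x m) (I0 x).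
Proof.
  intros Hx. apply Series_correct.
  apply (@ex_series_le R_AbsRing R_CompleteNormedModule _ (cterm x)).
  - intros m. change (Rabs (wallis m * cterm x m) <= cterm x m).
    assert (A := cterm_pos x m Hx). assert (W := wallis_pos m). assert (W1 := wallis_le_1 m).
    rewrite Rabs_pos_eq by nra. nra.
  - eexists. apply cosh_sinh_series. lra.
Qed.

Lemma BesselJ_0_I0 x : 0 < x -> J 0 (Ci * RtoC x)%C = RtoC (I0 x).
Proof.
  intros Hx. unfold BesselJ. apply C_series_unique. apply is_Cseries_eps. intros eps He.
  assert (H := I0_is x Hx). destruct (proj1 (filterlim_locally _ _) H (mkposreal eps He)) as [N HN].
  exists N. intros n Hn. specialize (HN n Hn). change (Rabs (sum_n (fun m => wallis m * cterm x m) n - I0 x) < eps) in HN.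
  match goal with |- Cmod (?A - _) < _ => replace A with (RtoC (sum_n (fun m => wallis m * cterm x m) n)) end.
  - now rewrite <- RtoC_minus, Cmod_R.
  - clear HN Hn.
    assert (T : forall m, ((-1) ^ m / (INR (fact m) * INR (fact (m + 0))) * (Ci * x / 2) ^ (2 * m + 0))%C
       = RtoC (wallis m * cterm x m)).
    { intros m. rewrite !Nat.add_0_r. rewrite Cpow_mult_r.
      replace ((Ci * x / 2) ^ 2)%C with (RtoC (-1) * (RtoC (x / 2) * RtoC (x / 2)))%C.
      2:{ rewrite <- !RtoC_mult. replace (Ci * x / 2)%C with (Ci * RtoC (x / 2))%C.
          - simpl. rewrite Cmult_1_r. unfold Ci, Cmult, RtoC; simpl. f_equal; ring.
          - rewrite RtoC_div by lra. unfold Cdiv. ring. }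
      rewrite Cpow_mult_l. unfold Cdiv.
      replace ((-1) ^ m * / (INR (fact m) * INR (fact m)) * (RtoC (-1) ^ m * (RtoC (x / 2) * RtoC (x / 2)) ^ m))%C
        with (((-1) ^ m * RtoC (-1) ^ m) * (/ (INR (fact m) * INR (fact m)) * (RtoC (x / 2) * RtoC (x / 2)) ^ m))%C by ring.
      rewrite <- Cpow_mult_l. replace (-1 * RtoC (-1))%C with (RtoC 1).
      2:{ unfold RtoC, Cmult, Copp; simpl; f_equal; ring. }
      rewrite Cpow_1_l, Cmult_1_l, <- !RtoC_mult, <- RtoC_pow, <- RtoC_inv.
      2:{ apply Rmult_integral_contrapositive_currified; apply INR_fact_neq_0. }
      rewrite <- RtoC_mult. f_equal. unfold wallis, cterm. rewrite pow_mult.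
      replace (x ^ 2) with (4 * (x / 2 * (x / 2))) by (simpl; field). rewrite !Rpow_mult_distr.
      assert (F1 := INR_fact_neq_0 m). assert (F2 := INR_fact_neq_0 (2 * m)).
      assert (F3 : 4 ^ m <> 0) by (apply pow_nonzero; lra). field. auto. }
    induction n as [|n IH].
    + rewrite Csum_O, sum_O. symmetry. apply T.
    + rewrite Csum_S, sum_Sn, <- IH. rewrite T. apply RtoC_plus.
Qed.

Lemma is_series_le_val (a b : nat -> R) la lb : (forall n, a n <= b n) -> is_series a la -> is_series b lb -> la <= lb.
Proof.
  intros H A B. apply (is_lim_seq_le (sum_n a) (sum_n b) la lb).
  - intros n. now apply sum_n_m_le.
  - exact A.
  - exact B.
Qed.

Lemma is_series_shift (a : nat -> R) (l : R) : is_series (fun n => a (S n)) l -> is_series a (a 0%nat + l).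
Proof.
  intros H. assert (K := is_series_decr_1 a (a 0%nat + l)). apply K.
  match goal with |- is_series _ ?X => replace X with l; [exact H|] end.
  change (l = a 0%nat + l + - a 0%nat). ring.
Qed.

Lemma cterm_S_series x : 0 < x -> is_series (fun m => cterm x (S m)) (cosh x - 1).
Proof.
  intros Hx. destruct (cosh_sinh_series x ltac:(lra)) as [C _].
  assert (K := is_series_incr_1 (cterm x) (cosh x - 1)). apply K.
  match goal with |- is_series _ ?X => replace X with (cosh x); [exact C|] end.
  change (cosh x = cosh x - 1 + 1 / 1). field.
Qed.

(** A form of the Cauchy-Schwarz inequality for the weights [cterm x m]: the mean of [wallis] is at
    most the root of the mean of its squares. The parameter [l] is that root's bound, which balances
    the two halves of the inequality. *)
Lemma I0_upper x : 0 < x -> I0 x <= cosh x * sqrt (2 / PI * (/ x + 2 / x ^ 2)).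
Proof.
  intros Hx. destruct (cosh_sinh_series x ltac:(lra)) as [C Sh].
  assert (Q := PI_RGT_0). assert (Hc := cosh_pos x).
  set (B := 2 / PI * (/ x + 2 / x ^ 2)).
  assert (Hx2 : 0 < x ^ 2) by (apply pow_lt; auto).
  assert (HB : 0 < B).
  { unfold B. apply Rmult_lt_0_compat; [apply Rdiv_lt_0_compat; lra|].
    generalize (Rinv_0_lt_compat x Hx) (Rdiv_lt_0_compat 2 (x ^ 2)). lra. }
  set (l := sqrt B). assert (Hl : 0 < l) by now apply sqrt_lt_R0.
  assert (Hll : l * l = B) by (apply sqrt_sqrt; lra).
  assert (U : is_series (fun m => / 2 * (/ l * (2 / PI * (sterm x m + 2 / x ^ 2 * cterm x (S m))) + l * cterm x m))
     (/ 2 * (/ l * (2 / PI * (sinh x / x + 2 / x ^ 2 * (cosh x - 1))) + l * cosh x))).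
  { apply (rseries_scal (/ 2)). apply rseries_plus.
    - apply (rseries_scal (/ l)). apply (rseries_scal (2 / PI)). apply rseries_plus; auto.
      apply (rseries_scal (2 / x ^ 2)). now apply cterm_S_series.
    - now apply (rseries_scal l). }
  eapply Rle_trans; [refine (is_series_le_val _ _ _ _ _ (I0_is x Hx) U)|].
  - intros m. cbv beta. assert (Hcm := cterm_pos x m Hx). assert (W := wallis_sqr_le m). assert (P := pos_INR m).
    assert (E : sterm x m + 2 / x ^ 2 * cterm x (S m) = cterm x m * (/ (2 * INR m + 1) + 2 / ((2 * INR m + 1) * (2 * INR m + 2)))).
    { unfold sterm, cterm. replace (2 * S m)%nat with (S (S (2 * m))) by lia.
      rewrite !fact_simpl, !mult_INR, !S_INR, mult_INR. simpl (INR 2). rewrite <- !tech_pow_Rmult.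
      assert (F := INR_fact_neq_0 (2 * m)). field. repeat split; auto; lra. }
    rewrite E.
    set (g := / (2 * INR m + 1) + 2 / ((2 * INR m + 1) * (2 * INR m + 2))) in *.
    set (wm := wallis m) in *.
    (* AM-GM: [2 w l <= w^2 + l^2] *)
    assert (G : wm <= / 2 * (/ l * wm ^ 2 + l)).
    { apply Rmult_le_reg_l with (2 * l); [lra|].
      replace (2 * l * (/ 2 * (/ l * wm ^ 2 + l))) with (wm ^ 2 + l ^ 2) by (field; lra).
      generalize (pow2_ge_0 (wm - l)). nra. }
    assert (G2 : / l * wm ^ 2 <= / l * (2 / PI * g)).
    { apply Rmult_le_compat_l; auto. left. now apply Rinv_0_lt_compat. }
    replace (/ 2 * (/ l * (2 / PI * (cterm x m * g)) + l * cterm x m)) with (/ 2 * (/ l * (2 / PI * g) + l) * cterm x m) by ring.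
    apply Rmult_le_compat_r; lra.
  - assert (S1 := sinh_le_cosh x).
    assert (A : sinh x / x + 2 / x ^ 2 * (cosh x - 1) <= cosh x * (/ x + 2 / x ^ 2)).
    { assert (sinh x / x <= cosh x * / x) by (apply Rmult_le_compat_r; [left; now apply Rinv_0_lt_compat|auto]).
      assert (0 < 2 / x ^ 2) by (apply Rdiv_lt_0_compat; lra). nra. }
    assert (D : / l * (2 / PI * (sinh x / x + 2 / x ^ 2 * (cosh x - 1))) <= / l * (cosh x * B)).
    { apply Rmult_le_compat_l; [left; now apply Rinv_0_lt_compat|].
      unfold B. replace (cosh x * (2 / PI * (/ x + 2 / x ^ 2))) with (2 / PI * (cosh x * (/ x + 2 / x ^ 2))) by ring.
      apply Rmult_le_compat_l; auto. apply Rdiv_le_0_compat; lra. }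
    rewrite <- Hll in D at 1. replace (/ l * (cosh x * (l * l))) with (cosh x * l) in D by (field; lra). lra.
Qed.

(** Jensen's inequality: [wallis m] is at least a multiple of [(2 m + 1)^(-1/2)], a convex function
    of [2 m + 1], and the mean of [2 m + 1] for the weights [cterm x m] is at most [x + 1]. *)
Lemma I0_lower x : 0 < x -> cosh x * (sqrt (2 / PI) / sqrt (x + 1)) <= I0 x.
Proof.
  intros Hx. destruct (cosh_sinh_series x ltac:(lra)) as [C Sh].
  assert (Q := PI_RGT_0). assert (Hc := cosh_pos x).
  set (k := sqrt (2 / PI)). assert (Hp : 0 < 2 / PI) by (apply Rdiv_lt_0_compat; lra).
  assert (Hk : 0 < k) by now apply sqrt_lt_R0.
  assert (Hkk : k * k = 2 / PI) by (apply sqrt_sqrt; lra).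
  set (T := x + 1). set (r := sqrt T). assert (Hr : 0 < r) by (apply sqrt_lt_R0; unfold T; lra).
  assert (Hrr : r * r = T) by (apply sqrt_sqrt; unfold T; lra).
  (* The first moment of the weights: [2 m * cterm x m] is [x^2] times the preceding [sinh] term. *)
  assert (M : is_series (fun m => (2 * INR m + 1) * cterm x m) (cosh x + x * sinh x)).
  { assert (K : is_series (fun m => 2 * INR m * cterm x m) (0 + x ^ 2 * (sinh x / x))).
    { replace 0 with (2 * INR 0 * cterm x 0) at 1 by (simpl; ring).
      apply (is_series_shift (fun m => 2 * INR m * cterm x m)).
      apply is_series_ext with (fun m => x ^ 2 * sterm x m).
      - intros m. unfold sterm, cterm. replace (2 * S m)%nat with (S (S (2 * m))) by lia.
        rewrite (fact_simpl (S (2 * m))), mult_INR, !S_INR, mult_INR. simpl (INR 2). rewrite <- !tech_pow_Rmult.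
        assert (F := INR_fact_neq_0 (S (2 * m))). assert (P := pos_INR m). simpl (x ^ 2). match goal with |- @eq _ ?a ?b => change (@eq R a b) end. field. split; auto; lra.
      - now apply (rseries_scal (x ^ 2)). }
    replace (cosh x + x * sinh x) with (0 + x ^ 2 * (sinh x / x) + cosh x) by (field; lra).
    apply is_series_ext with (fun m => 2 * INR m * cterm x m + cterm x m).
    { intros m. match goal with |- @eq _ ?a ?b => change (@eq R a b) end. ring. }
    exact (rseries_plus _ _ _ _ K C). }
  assert (U : is_series (fun m => k / r * (3 / 2 * cterm x m - / (2 * T) * ((2 * INR m + 1) * cterm x m)))
     (k / r * (3 / 2 * cosh x - / (2 * T) * (cosh x + x * sinh x)))).
  { apply (rseries_scal (k / r)). apply rseries_minus.
    - now apply (rseries_scal (3 / 2)).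
    - now apply (rseries_scal (/ (2 * T))). }
  eapply Rle_trans; [|refine (is_series_le_val _ _ _ _ _ U (I0_is x Hx))].
  - replace (cosh x * (k / r)) with (k / r * cosh x) by ring.
    apply Rmult_le_compat_l; [apply Rdiv_le_0_compat; lra|].
    assert (A : cosh x + x * sinh x <= T * cosh x) by (unfold T; generalize (sinh_le_cosh x); nra).
    assert (HT : 0 < T) by (unfold T; lra).
    assert (/ (2 * T) * (cosh x + x * sinh x) <= / (2 * T) * (T * cosh x)).
    { apply Rmult_le_compat_l; auto. left. apply Rinv_0_lt_compat. lra. }
    replace (/ (2 * T) * (T * cosh x)) with (cosh x / 2) in H by (field; lra). lra.
  - intros m. cbv beta. assert (Hcm := cterm_pos x m Hx). assert (W := wallis_lower m). assert (P := pos_INR m).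
    assert (Wp := wallis_pos m). set (wm := wallis m) in *. set (n := 2 * INR m + 1) in *.
    replace (k / r * (3 / 2 * cterm x m - / (2 * T) * (n * cterm x m))) with (k / r * (3 / 2 - n / (2 * T)) * cterm x m)
      by (field; unfold T; lra).
    apply Rmult_le_compat_r; [lra|].
    assert (Hn : 0 < n) by (unfold n; lra).
    set (u := sqrt n). assert (Hu : 0 < u) by now apply sqrt_lt_R0. assert (Huu : u * u = n) by (apply sqrt_sqrt; lra).
    assert (A : k <= wm * u).
    { apply Rsqr_incr_0_var; [|nra]. unfold Rsqr. rewrite Hkk. rewrite <- Huu in W. nra. }
    (* tangent line of the convex function [t |-> t^(-1/2)] at [T] *)
    assert (B : k / r * (3 / 2 - n / (2 * T)) <= k / u).
    { rewrite <- Hrr, <- Huu. apply Rmult_le_reg_l with (2 * (r * r * r) * u / k).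
      - apply Rdiv_lt_0_compat; auto. repeat apply Rmult_lt_0_compat; lra.
      - replace (2 * (r * r * r) * u / k * (k / u)) with (2 * (r * r * r)) by (field; lra).
        replace (2 * (r * r * r) * u / k * (k / r * (3 / 2 - u * u / (2 * (r * r))))) with (3 * (r * r) * u - u * u * u) by (field; lra).
        assert (0 <= (r - u) * (r - u) * (2 * r + u)); [|nra].
        apply Rmult_le_pos; [apply Rle_0_sqr|lra]. }
    eapply Rle_trans; [exact B|]. apply Rle_div_l; auto.
Qed.

Definition lim_inf (f : R -> R) (l : R) : Prop :=
  forall eps, 0 < eps -> exists X, 0 < X /\ forall x, X <= x -> Rabs (f x - l) < eps.

(** Both bounds are [cosh x * sqrt (2 / (PI x))] to leading order, and [exp (- x) * cosh x] tends to
    [1 / 2]. *)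
Lemma I0_asymp : lim_inf (fun x => sqrt x * exp (- x) * I0 x) (/ sqrt (2 * PI)).
Proof.
  assert (Q := PI_RGT_0).
  assert (E0 : / sqrt (2 * PI) = sqrt (2 / PI) / 2).
  { apply Rmult_eq_reg_l with (sqrt (2 * PI)); [|apply Rgt_not_eq, sqrt_lt_R0; lra].
    rewrite Rinv_r by (apply Rgt_not_eq, sqrt_lt_R0; lra).
    unfold Rdiv. rewrite <- Rmult_assoc, <- sqrt_mult by (try apply Rdiv_le_0_compat; lra).
    replace (2 * PI * (2 * / PI)) with (2 * 2) by (field; lra). rewrite sqrt_square by lra. lra. }
  set (k := sqrt (2 / PI)) in *.
  assert (Hp : 0 < 2 / PI) by (apply Rdiv_lt_0_compat; lra).
  assert (Hk : 0 < k) by now apply sqrt_lt_R0.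
  rewrite E0. intros eps He.
  (* A relative tolerance: for [x] beyond [4 / d + 4] each of the corrections, in [ee] and in
     [1 / x], is at most [d / 4]. *)
  set (d := Rmin (1 / 2) (eps / k)).
  assert (Hek : 0 < eps / k) by now apply Rdiv_lt_0_compat.
  assert (Hd : 0 < d) by (apply Rmin_pos; lra).
  assert (Hd1 : d <= 1 / 2) by apply Rmin_l. assert (Hd2 : d * k <= eps).
  { apply Rle_trans with (eps / k * k); [apply Rmult_le_compat_r; [lra|apply Rmin_r]|right; field; lra]. }
  assert (HX : 0 < 4 / d + 4) by (generalize (Rdiv_lt_0_compat 4 d ltac:(lra) Hd); lra).
  exists (4 / d + 4). split; auto. intros x Hx0.
  assert (Hx : 0 < x) by lra.
  assert (HxD : 4 <= d * x).
  { apply Rle_trans with (d * (4 / d)); [right; field; lra|]. apply Rmult_le_compat_l; lra. }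
  assert (Ec : exp (- x) * cosh x = (1 + exp (- x) * exp (- x)) / 2).
  { unfold cosh. assert (exp (- x) * exp x = 1) by (rewrite <- exp_plus; replace (- x + x) with 0 by ring; apply exp_0). lra. }
  assert (Hex : 0 < exp (- x)) by apply exp_pos.
  assert (Hexx : exp (- x) * exp (- x) <= / x).
  { rewrite exp_Ropp. assert (1 + x < exp x) by (apply exp_ineq1; lra).
    rewrite <- Rinv_mult. apply Rinv_le_contravar; auto. nra. }
  assert (Hix : / x <= d / 4).
  { apply Rmult_le_reg_l with x; auto. rewrite Rinv_r by lra. lra. }
  set (ee := exp (- x) * exp (- x)) in *.
  assert (Hee : 0 < ee) by (unfold ee; apply Rmult_lt_0_compat; auto).
  assert (Hsx : 0 < sqrt x) by now apply sqrt_lt_R0.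
  assert (Up : sqrt x * exp (- x) * I0 x <= (1 + ee) / 2 * (k * (1 + d / 4))).
  { apply Rle_trans with (sqrt x * exp (- x) * (cosh x * sqrt (2 / PI * (/ x + 2 / x ^ 2)))).
    - apply Rmult_le_compat_l; [apply Rmult_le_pos; lra|now apply I0_upper].
    - replace (sqrt x * exp (- x) * (cosh x * sqrt (2 / PI * (/ x + 2 / x ^ 2)))) with
        ((exp (- x) * cosh x) * (sqrt x * sqrt (2 / PI * (/ x + 2 / x ^ 2)))) by ring.
      rewrite Ec. apply Rmult_le_compat_l; [lra|].
      assert (Hx2 : 0 < x ^ 2) by (apply pow_lt; auto).
      rewrite <- sqrt_mult_alt by lra.
      replace (x * (2 / PI * (/ x + 2 / x ^ 2))) with (2 / PI * (1 + 2 * / x)) by (simpl; field; lra).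
      rewrite sqrt_mult_alt by lra. fold k. apply Rmult_le_compat_l; [lra|].
      apply Rsqr_incr_0_var; [|lra]. rewrite Rsqr_sqrt by (generalize (Rinv_0_lt_compat x Hx); lra).
      unfold Rsqr. assert (1 + 2 * / x <= 1 + d / 2) by lra. nra. }
  assert (Lo : (1 + ee) / 2 * (k * (1 - d / 4)) <= sqrt x * exp (- x) * I0 x).
  { apply Rle_trans with (sqrt x * exp (- x) * (cosh x * (k / sqrt (x + 1)))).
    2:{ apply Rmult_le_compat_l; [apply Rmult_le_pos; lra|now apply I0_lower]. }
    replace (sqrt x * exp (- x) * (cosh x * (k / sqrt (x + 1)))) with ((exp (- x) * cosh x) * (k * (sqrt x / sqrt (x + 1)))) by
      (unfold Rdiv; ring).
    rewrite Ec. apply Rmult_le_compat_l; [lra|]. apply Rmult_le_compat_l; [lra|].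
    rewrite <- sqrt_div_alt by lra. apply Rsqr_incr_0_var; [|apply sqrt_pos].
    rewrite Rsqr_sqrt by (apply Rdiv_le_0_compat; lra). unfold Rsqr.
    apply Rmult_le_reg_r with (x + 1); [lra|]. replace (x / (x + 1) * (x + 1)) with x by (field; lra). nra. }
  apply Rabs_def1.
  - eapply Rle_lt_trans; [apply Rplus_le_compat_r, Up|]. nra.
  - eapply Rlt_le_trans; [|apply Rplus_le_compat_r, Lo]. nra.
Qed.

Open Scope C_scope.

(** * Asymptotics on quarter circles *)

(* [u = sqrt w * J_q] solves [u'' = (bmu q / w^2 - 1) u], and [av], [bv] are
   [(u' + i u) / sqrt w] and [(u' - i u) / sqrt w]. Removing their oscillation
   [exp (i w)], [exp (- i w)] gives [pv] and [sv], which vary slowly along arcs. *)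
Definition bmu (q : nat) : R := (INR q * INR q - / 4)%R.

Definition av q (w : C) : C := J1 q w + J q w / (2 * w) + Ci * J q w.
Definition bv q (w : C) : C := J1 q w + J q w / (2 * w) - Ci * J q w.

Definition wv (r t : R) : C := RtoC r * cis t.
(* [exp (i w)] and a square root of [w] at [w = r exp (i t)]. *)
Definition ev (r t : R) : C := RtoC (exp (- (r * sin t))) * cis (r * cos t).
Definition hv (r t : R) : C := RtoC (sqrt r) * cis (t / 2).

Definition pv q r t : C := hv r t * av q (wv r t) / ev r t.
Definition sv q r t : C := hv r t * bv q (wv r t) * ev r t.

Lemma Ci_sqr : Ci * Ci = - (1).
Proof. unfold Ci, Cmult, Copp, RtoC; simpl; f_equal; ring. Qed.

Lemma rderiv_cis_comp (g : R -> R) (t l : R) : is_derive g t l ->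
  rderiv (fun s => cis (g s)) t (Ci * RtoC l * cis (g t)).
Proof.
  intros H. apply rderiv_ext with (fun s => RtoC (cos (g s)) + Ci * RtoC (sin (g s))).
  - intros s. now rewrite cis_alt.
  - replace (Ci * RtoC l * cis (g t)) with (RtoC (l * - sin (g t)) + Ci * RtoC (l * cos (g t)))%C.
    + apply cara_plus; [|apply cara_scal]; apply rderiv_RtoC.
      * apply (is_derive_comp cos g); auto. apply is_derive_cos.
      * apply (is_derive_comp sin g); auto. apply is_derive_sin.
    + rewrite cis_alt, !RtoC_mult, RtoC_opp.
      replace (Ci * l * (cos (g t) + Ci * sin (g t))) with ((Ci * Ci) * l * sin (g t) + Ci * (l * cos (g t))) by ring.
      rewrite Ci_sqr. ring.
Qed.

Lemma wv_rderiv r t : rderiv (wv r) t (Ci * wv r t).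
Proof.
  unfold wv. replace (Ci * (RtoC r * cis t)) with (RtoC r * (Ci * RtoC 1 * cis t)) by ring.
  apply cara_scal. apply (rderiv_cis_comp (fun s => s)). apply (is_derive_id t).
Qed.

Lemma ev_rderiv r t : rderiv (ev r) t (- wv r t * ev r t).
Proof.
  unfold ev.
  replace (- wv r t * (RtoC (exp (- (r * sin t))) * cis (r * cos t))) with
    (RtoC (- (r * cos t) * exp (- (r * sin t))) * cis (r * cos t) +
     RtoC (exp (- (r * sin t))) * (Ci * RtoC (- (r * sin t)) * cis (r * cos t))).
  - apply (rderiv_mult (fun s => RtoC (exp (- (r * sin s)))) (fun s => cis (r * cos s))).
    + apply rderiv_RtoC. auto_derive; auto. ring.
    + apply (rderiv_cis_comp (fun s => r * cos s)%R). auto_derive; auto. ring.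
  - unfold wv. rewrite (cis_alt t), !RtoC_mult, !RtoC_opp, !RtoC_mult. ring.
Qed.

Lemma hv_rderiv r t : rderiv (hv r) t (Ci / 2 * hv r t).
Proof.
  unfold hv. replace (Ci / 2 * (RtoC (sqrt r) * cis (t / 2))) with (RtoC (sqrt r) * (Ci * RtoC (/ 2) * cis (t / 2))).
  - apply cara_scal. apply (rderiv_cis_comp (fun s => s / 2)%R). auto_derive; auto. field.
  - rewrite RtoC_inv by lra. unfold Cdiv. ring.
Qed.

Lemma wv_neq_0 r t : (0 < r)%R -> wv r t <> 0.
Proof. intros H. apply Cmult_neq_0; [apply RtoC_neq_0; lra|apply cis_neq_0]. Qed.

Lemma ev_neq_0 r t : ev r t <> 0.
Proof. apply Cmult_neq_0; [apply RtoC_neq_0; generalize (exp_pos (- (r * sin t))); lra|apply cis_neq_0]. Qed.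

Lemma Cmod_wv r t : (0 < r)%R -> Cmod (wv r t) = r.
Proof. intros H. unfold wv. rewrite Cmod_mult, Cmod_cis, Cmod_R, Rabs_pos_eq; lra. Qed.

Lemma Cmod_ev r t : Cmod (ev r t) = exp (- (r * sin t)).
Proof. unfold ev. rewrite Cmod_mult, Cmod_cis, Cmod_R, Rabs_pos_eq; [ring|left; apply exp_pos]. Qed.

Lemma Cmod_hv r t : Cmod (hv r t) = sqrt r.
Proof. unfold hv. rewrite Cmod_mult, Cmod_cis, Cmod_R, Rabs_pos_eq; [ring|apply sqrt_pos]. Qed.

Lemma J2_eq q (w : C) : w <> 0 -> J2 q w = - (w * J1 q w + (w * w - RtoC (INR q) * RtoC (INR q)) * J q w) / (w * w).
Proof.
  intros N. assert (O := BesselJ_ode q w).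
  replace (J2 q w) with ((w * w * J2 q w) / (w * w)) by (field; auto). f_equal.
  replace (w * w * J2 q w) with (w * w * J2 q w + w * J1 q w + (w * w - RtoC (INR q) * RtoC (INR q)) * J q w
    - (w * J1 q w + (w * w - RtoC (INR q) * RtoC (INR q)) * J q w)) by ring.
  rewrite O. ring.
Qed.

Lemma C2_neq_0 : RtoC 2 <> 0.
Proof. apply RtoC_neq_0. lra. Qed.
Lemma C4_neq_0 : RtoC 4 <> 0.
Proof. apply RtoC_neq_0. lra. Qed.
#[global] Hint Resolve C2_neq_0 C4_neq_0 Ci_nz : core.

Lemma bmu_C q : RtoC (bmu q) = RtoC (INR q) * RtoC (INR q) - / 4.
Proof. unfold bmu. rewrite RtoC_minus, RtoC_mult, RtoC_inv by lra. reflexivity. Qed.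

Lemma half_J_cderiv q (w : C) : w <> 0 ->
  cderiv (fun u => J q u / (2 * u)) w ((J1 q w * (2 * w) - J q w * 2) / ((2 * w) * (2 * w))).
Proof.
  intros N. apply (cara_div _ (J q) (fun u => 2 * u)); auto.
  - apply BesselJ_cderiv.
  - assert (K := cara_scal _ _ _ 2 _ (@cara_id C_UniformSpace (fun u => u) w)). rewrite Cmult_1_r in K. exact K.
  - now apply Cmult_neq_0.
Qed.

Lemma av_cderiv q (w : C) : w <> 0 -> cderiv (av q) w (Ci * av q w - av q w / (2 * w) + RtoC (bmu q) * J q w / (w * w)).
Proof.
  intros N.
  replace (Ci * av q w - av q w / (2 * w) + RtoC (bmu q) * J q w / (w * w)) with
    (J2 q w + (J1 q w * (2 * w) - J q w * 2) / ((2 * w) * (2 * w)) + Ci * J1 q w).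
  - apply cara_plus; [apply cara_plus|apply cara_scal, BesselJ_cderiv].
    + apply (dBesselJ_cderiv q 1).
    + now apply half_J_cderiv.
  - rewrite J2_eq, bmu_C by auto. unfold av.
    replace (Ci * (J1 q w + J q w / (2 * w) + Ci * J q w)) with
      (Ci * (J1 q w + J q w / (2 * w)) + (Ci * Ci) * J q w) by ring.
    rewrite Ci_sqr. field. auto.
Qed.

Lemma bv_cderiv q (w : C) : w <> 0 -> cderiv (bv q) w (- Ci * bv q w - bv q w / (2 * w) + RtoC (bmu q) * J q w / (w * w)).
Proof.
  intros N.
  replace (- Ci * bv q w - bv q w / (2 * w) + RtoC (bmu q) * J q w / (w * w)) with
    (J2 q w + (J1 q w * (2 * w) - J q w * 2) / ((2 * w) * (2 * w)) - Ci * J1 q w).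
  - apply cara_minus; [apply cara_plus|apply cara_scal, BesselJ_cderiv].
    + apply (dBesselJ_cderiv q 1).
    + now apply half_J_cderiv.
  - rewrite J2_eq, bmu_C by auto. unfold bv.
    replace (- Ci * (J1 q w + J q w / (2 * w) - Ci * J q w)) with
      (- Ci * (J1 q w + J q w / (2 * w)) + (Ci * Ci) * J q w) by ring.
    rewrite Ci_sqr. field. auto.
Qed.

Lemma J_ab q w : 2 * Ci * J q w = av q w - bv q w.
Proof. unfold av, bv. ring. Qed.

(** The oscillating terms cancel, and only the perturbation [bmu / w^2] of [u'' = - u] survives. The
    derivative thus carries a factor [1 / r], with a cross term in the opposite exponential. *)
Lemma pv_rderiv q r t : (0 < r)%R ->
  rderiv (pv q r) t (RtoC (bmu q) / (2 * wv r t) * (pv q r t - sv q r t / (ev r t * ev r t))).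
Proof.
  intros Hr. assert (W := wv_neq_0 r t Hr). assert (E := ev_neq_0 r t).
  assert (Da := rderiv_comp _ _ _ _ _ (wv_rderiv r t) (av_cderiv q _ W)).
  assert (Dp := cara_div RtoC _ _ t _ _ (cont_RtoC t) (rderiv_mult _ _ _ _ _ (hv_rderiv r t) Da) (ev_rderiv r t) E).
  match type of Dp with cara _ _ _ ?l => replace (RtoC (bmu q) / (2 * wv r t) * (pv q r t - sv q r t / (ev r t * ev r t))) with l end.
  - exact Dp.
  - unfold pv, sv. set (w := wv r t) in *. set (e := ev r t) in *. set (h := hv r t).
    replace (RtoC (bmu q) / (2 * w) * (h * av q w / e - h * bv q w * e / (e * e))) with
      (RtoC (bmu q) / (2 * w) * (h * (av q w - bv q w) / e)) by (field; auto).
    rewrite <- J_ab.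
    replace (Ci / 2 * h * av q w + h * ((Ci * av q w - av q w / (2 * w) + RtoC (bmu q) * J q w / (w * w)) * (Ci * w)))
      with ((Ci * Ci) * h * w * av q w + h * Ci * RtoC (bmu q) * J q w / w) by (field; auto).
    rewrite Ci_sqr. field. auto.
Qed.

Lemma sv_rderiv q r t : (0 < r)%R ->
  rderiv (sv q r) t (RtoC (bmu q) / (2 * wv r t) * (pv q r t * (ev r t * ev r t) - sv q r t)).
Proof.
  intros Hr. assert (W := wv_neq_0 r t Hr). assert (E := ev_neq_0 r t).
  assert (Da := rderiv_comp _ _ _ _ _ (wv_rderiv r t) (bv_cderiv q _ W)).
  assert (Dp := rderiv_mult _ _ _ _ _ (rderiv_mult _ _ _ _ _ (hv_rderiv r t) Da) (ev_rderiv r t)).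
  match type of Dp with rderiv _ _ ?l => replace (RtoC (bmu q) / (2 * wv r t) * (pv q r t * (ev r t * ev r t) - sv q r t)) with l end.
  - exact Dp.
  - unfold pv, sv. set (w := wv r t) in *. set (e := ev r t) in *. set (h := hv r t).
    replace (RtoC (bmu q) / (2 * w) * (h * av q w / e * (e * e) - h * bv q w * e)) with
      (RtoC (bmu q) / (2 * w) * (h * (av q w - bv q w) * e)) by (field; auto).
    rewrite <- J_ab.
    replace (Ci / 2 * h * bv q w + h * ((- Ci * bv q w - bv q w / (2 * w) + RtoC (bmu q) * J q w / (w * w)) * (Ci * w)))
      with (- (Ci * Ci) * h * w * bv q w + h * Ci * RtoC (bmu q) * J q w / w) by (field; auto).
    rewrite Ci_sqr. field. auto.
Qed.

(** * Differential inequalities and bounds along arcs *)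

Lemma gronwall (f df : R -> R) (k T : R) : (0 <= T)%R ->
  (forall t, (0 <= t <= T)%R -> is_derive f t (df t)) ->
  (forall t, (0 <= t <= T)%R -> (df t <= k * f t)%R) -> (f T <= f 0 * exp (k * T))%R.
Proof.
  intros HT D H.
  assert (A : (- (f 0 * exp (- (k * 0))) <= - (f T * exp (- (k * T))))%R).
  { apply (mvt_incr (fun t => - (f t * exp (- (k * t))))%R (fun t => (k * f t - df t) * exp (- (k * t)))%R 0 T); auto.
    - intros t Ht. auto_derive; [eexists; apply D; auto|].
      replace (Derive (fun x => f x) t) with (df t) by (symmetry; apply is_derive_unique, D; auto). ring.
    - intros t Ht. apply Rmult_le_pos; [|left; apply exp_pos]. generalize (H t ltac:(lra)). lra. }
  rewrite Rmult_0_r, Ropp_0, exp_0, Rmult_1_r in A.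
  assert (E : (exp (- (k * T)) * exp (k * T) = 1)%R) by (rewrite <- exp_plus, Rplus_opp_l; apply exp_0).
  assert (P := exp_pos (k * T)).
  replace (f T) with (f T * exp (- (k * T)) * exp (k * T))%R by (rewrite Rmult_assoc, E; ring).
  apply Rmult_le_compat_r; lra.
Qed.

(** The scalar mean value theorem is applied to the component of [F] in the direction of
    [F T - F 0]. *)
Lemma curve_mvt (F dF : R -> C) (B T : R) : (0 <= T)%R ->
  (forall t, (0 <= t <= T)%R -> rderiv F t (dF t)) ->
  (forall t, (0 <= t <= T)%R -> (Cmod (dF t) <= B)%R) -> (Cmod (F T - F 0) <= B * T)%R.
Proof.
  intros HT D H. set (u := Cconj (F T - F 0)).
  assert (A : (B * Cmod u * 0 - Re (u * F 0) <= B * Cmod u * T - Re (u * F T))%R).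
  { apply (mvt_incr (fun t => B * Cmod u * t - Re (u * F t))%R (fun t => B * Cmod u - Re (u * dF t))%R 0 T); auto.
    - intros t Ht. apply (is_derive_minus (V := R_NormedModule) (fun t => B * Cmod u * t)%R (fun t => Re (u * F t))).
      + auto_derive; auto. ring.
      + apply (rderiv_Re (fun t => u * F t)). apply cara_scal. now apply D.
    - intros t Ht. assert (X := re_le_Cmod (u * dF t)). rewrite Cmod_mult in X.
      assert (Y : (Cmod u * Cmod (dF t) <= Cmod u * B)%R) by (apply Rmult_le_compat_l; [apply Cmod_ge_0|apply H; lra]).
      generalize (Rle_abs (Re (u * dF t))). lra. }
  assert (E : (Re (u * F T) - Re (u * F 0) = Cmod (F T - F 0) ^ 2)%R).
  { replace (Re (u * F T) - Re (u * F 0))%R with (Re (u * (F T - F 0))) by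
      (destruct u, (F T), (F 0%R); unfold Re, Cmult, Cminus, Cplus, Copp; simpl; ring).
    assert (K := Cmod2_conj (F T - F 0)). fold u in K. rewrite Cmult_comm, <- K. reflexivity. }
  assert (Eu : Cmod u = Cmod (F T - F 0)) by apply Cmod_conj. rewrite Eu in A.
  assert (P := Cmod_ge_0 (F T - F 0)). set (x := Cmod (F T - F 0)) in *.
  destruct (Req_EM_T x 0) as [Z|N]; [|nra].
  rewrite Z. assert (0 <= B)%R by (eapply Rle_trans; [apply Cmod_ge_0|apply (H 0%R); lra]). nra.
Qed.

(** This is [u'^2 + u^2] for [u = sqrt x * J_q]. *)
Definition energy q (x : R) : R := (x * ((rj1 q x + rj q x / (2 * x)) ^ 2 + rj q x ^ 2))%R.

(** From [u'' = (bmu / x^2 - 1) u] one has [|energy'| <= (m / x^2) energy], so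
    [energy * exp (m / x)] does not increase. *)
Lemma energy_bounded q : exists M : R, (0 < M)%R /\ forall x, (1 <= x)%R -> (energy q x <= M)%R.
Proof.
  set (m := Rabs (bmu q)). assert (Hm := Rabs_pos (bmu q)). fold m in Hm.
  assert (D : forall x, (0 < x)%R -> is_derive (energy q) x
     (2 * bmu q / x * (rj q x * (rj1 q x + rj q x / (2 * x))))%R).
  { intros x Hx. unfold energy. auto_derive.
    - assert (X1 : ex_derive (rj1 q) x) by (eexists; apply rj1_derive).
      assert (X2 : ex_derive (rj q) x) by (eexists; apply rj_derive).
      repeat match goal with |- _ /\ _ => split end; try exact I; try exact X1; try exact X2. lra.
    - replace (Derive (fun x => rj1 q x) x) with (rj2 q x) by (symmetry; apply is_derive_unique, rj1_derive).
      replace (Derive (fun x => rj q x) x) with (rj1 q x) by (symmetry; apply is_derive_unique, rj_derive).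
      assert (O := rj_ode q x).
      replace (rj2 q x) with (- (x * rj1 q x + (x * x - INR q * INR q) * rj q x) / (x * x))%R.
      + unfold bmu. field. lra.
      + apply Rmult_eq_reg_l with (x * x)%R; [|nra]. 
        replace (x * x * (- (x * rj1 q x + (x * x - INR q * INR q) * rj q x) / (x * x)))%R
          with (- (x * rj1 q x + (x * x - INR q * INR q) * rj q x))%R by (field; lra). lra. }
  exists (energy q 1 * exp m + 1)%R.
  assert (E0 : (0 <= energy q 1)%R).
  { unfold energy. generalize (pow2_ge_0 (rj1 q 1 + rj q 1 / (2 * 1))) (pow2_ge_0 (rj q 1)). nra. }
  assert (Em := exp_pos m). split; [nra|]. intros x Hx.
  assert (A : (- (energy q 1 * exp (m / 1)) <= - (energy q x * exp (m / x)))%R).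
  { apply (mvt_incr (fun y => - (energy q y * exp (m / y)))%R
     (fun y => (m / (y * y) * energy q y - 2 * bmu q / y * (rj q y * (rj1 q y + rj q y / (2 * y)))) * exp (m / y))%R 1 x); auto.
    - intros y Hy. auto_derive; [split; [eexists; apply D; lra|split; [lra|auto]]|].
      replace (Derive (fun x => energy q x) y) with (2 * bmu q / y * (rj q y * (rj1 q y + rj q y / (2 * y))))%R
        by (symmetry; apply is_derive_unique, D; lra). change (m * / y)%R with (m / y)%R. field. lra.
    - intros y Hy. apply Rmult_le_pos; [|left; apply exp_pos].
      unfold energy. set (u := (rj1 q y + rj q y / (2 * y))%R). set (v := rj q y).
      replace (m / (y * y) * (y * (u ^ 2 + v ^ 2)) - 2 * bmu q / y * (v * u))%R
        with (/ y * (m * (u ^ 2 + v ^ 2) - 2 * bmu q * (v * u)))%R by (field; lra).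
      apply Rmult_le_pos; [left; apply Rinv_0_lt_compat; lra|].
      assert (X : (bmu q * (2 * (v * u)) <= m * (u ^ 2 + v ^ 2))%R); [|lra].
      eapply Rle_trans; [apply Rle_abs|]. rewrite Rabs_mult. fold m. apply Rmult_le_compat_l; auto.
      apply Rabs_le. generalize (pow2_ge_0 (u - v)) (pow2_ge_0 (u + v)). nra. }
  rewrite Rdiv_1_r in A.
  assert (1 <= exp (m / x))%R.
  { rewrite <- exp_0. destruct (Req_EM_T m 0) as [->|N]; [right; f_equal; unfold Rdiv; ring|].
    left. apply exp_increasing. apply Rdiv_lt_0_compat; lra. }
  assert (0 <= energy q x)%R.
  { unfold energy. generalize (pow2_ge_0 (rj1 q x + rj q x / (2 * x))) (pow2_ge_0 (rj q x)). nra. }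
  nra.
Qed.

Lemma ev_0 r : ev r 0 = cis r.
Proof. unfold ev. rewrite sin_0, cos_0, Rmult_0_r, Ropp_0, exp_0, Rmult_1_r. ring. Qed.

Lemma wv_0 r : wv r 0 = RtoC r.
Proof. unfold wv. rewrite cis_0. ring. Qed.

Lemma hv_0 r : hv r 0 = RtoC (sqrt r).
Proof. unfold hv. replace (0 / 2)%R with 0%R by field. rewrite cis_0. ring. Qed.

Lemma Cmod_sqr_re_im (x y : R) : (Cmod (RtoC x + Ci * RtoC y) ^ 2 = x ^ 2 + y ^ 2)%R.
Proof.
  rewrite Cmod2_alt. unfold Re, Im, Ci, Cplus, Cmult, RtoC; simpl. ring.
Qed.

Lemma av_real q x : (0 < x)%R -> av q (RtoC x) = RtoC (rj1 q x + rj q x / (2 * x)) + Ci * RtoC (rj q x).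
Proof.
  intros H. unfold av. rewrite rj1_eq, rj_eq, RtoC_plus, RtoC_div, RtoC_mult by lra. reflexivity.
Qed.

Lemma bv_real q x : (0 < x)%R -> bv q (RtoC x) = RtoC (rj1 q x + rj q x / (2 * x)) + Ci * RtoC (- rj q x).
Proof.
  intros H. unfold bv. rewrite rj1_eq, rj_eq, RtoC_plus, RtoC_div, RtoC_mult, RtoC_opp by lra. ring.
Qed.

Lemma pv_0_energy q r : (0 < r)%R -> (Cmod (pv q r 0) ^ 2 = energy q r)%R.
Proof.
  intros H. unfold pv. rewrite ev_0, hv_0, wv_0, av_real by auto.
  rewrite Cmod_div, Cmod_cis, Cmod_mult, Cmod_R, Rabs_pos_eq by (apply sqrt_pos || apply cis_neq_0).
  rewrite Rdiv_1_r, Rpow_mult_distr, Cmod_sqr_re_im, pow2_sqrt by lra. unfold energy. ring.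
Qed.

Lemma sv_0_energy q r : (0 < r)%R -> (Cmod (sv q r 0) ^ 2 = energy q r)%R.
Proof.
  intros H. unfold sv. rewrite ev_0, hv_0, wv_0, bv_real by auto.
  rewrite !Cmod_mult, Cmod_cis, Cmod_R, Rabs_pos_eq by apply sqrt_pos.
  rewrite Rmult_1_r, Rpow_mult_distr, Cmod_sqr_re_im, pow2_sqrt by lra. unfold energy. ring.
Qed.

Definition decay (r t : R) : R := exp (- (2 * (r * sin t))).

Lemma Cmod_ev_sqr r t : Cmod (ev r t * ev r t) = decay r t.
Proof. rewrite Cmod_mult, Cmod_ev, <- exp_plus. unfold decay. f_equal. ring. Qed.

Lemma decay_pos r t : (0 < decay r t)%R.
Proof. apply exp_pos. Qed.

Lemma decay_decr r s t : (0 < r)%R -> (0 <= s)%R -> (s <= t)%R -> (t <= PI / 2)%R -> (decay r t <= decay r s)%R.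
Proof.
  intros Hr Hs Hst Ht. unfold decay.
  assert (sin s <= sin t)%R by (apply sin_incr_1; generalize PI_RGT_0; lra).
  destruct (Req_EM_T (sin s) (sin t)) as [->|N]; [lra|]. left. apply exp_increasing. nra.
Qed.

(** Above the real axis [pv] couples to [sv] through the large factor [1 / ev^2], so it is measured
    with the weight [decay]. Gronwall's inequality for [N = (|pv| decay)^2 + |sv|^2] has a rate
    [O(1/r)], harmless on an arc of bounded angle; the deviations then follow by integrating the
    derivatives. *)
Theorem arc_bounds q : exists C0 : R, (0 < C0)%R /\ forall r t, (1 <= r)%R -> (0 <= t <= PI / 2)%R ->
  (Cmod (pv q r t) * decay r t <= C0 /\ Cmod (sv q r t) <= C0 /\
   Cmod (pv q r t - pv q r 0) * decay r t <= C0 / r /\ Cmod (sv q r t - sv q r 0) <= C0 / r)%R.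
Proof.
  destruct (energy_bounded q) as [M [HM HE]].
  set (m := Rabs (bmu q)). assert (Hm := Rabs_pos (bmu q)). fold m in Hm.
  set (K := (2 * M * exp (2 * m * (PI / 2)))%R).
  assert (HK : (0 < K)%R) by (apply Rmult_lt_0_compat; [lra|apply exp_pos]).
  set (B := sqrt K). assert (HB : (0 < B)%R) by now apply sqrt_lt_R0.
  assert (HBB : (B * B = K)%R) by (apply sqrt_sqrt; lra).
  exists (B + m * B * (PI / 2))%R. assert (Q := PI_RGT_0).
  assert (HmB : (0 <= m * B)%R) by now (apply Rmult_le_pos; lra).
  split; [nra|]. intros r T Hr HT.
  assert (Hr0 : (0 < r)%R) by lra.
  assert (Dp := fun t => pv_rderiv q r t Hr0). assert (Ds := fun t => sv_rderiv q r t Hr0).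
  set (dp := fun t => RtoC (bmu q) / (2 * wv r t) * (pv q r t - sv q r t / (ev r t * ev r t))) in *.
  set (ds := fun t => RtoC (bmu q) / (2 * wv r t) * (pv q r t * (ev r t * ev r t) - sv q r t)) in *.
  set (P := fun t => (Cmod (pv q r t) * decay r t)%R). set (S := fun t => Cmod (sv q r t)).
  assert (Hcoef : forall t, (Cmod (RtoC (bmu q) / (2 * wv r t)) = m / (2 * r))%R).
  { intros t. rewrite Cmod_div, Cmod_mult, !Cmod_R, Cmod_wv, (Rabs_pos_eq 2) by (lra || (apply Cmult_neq_0; auto; now apply wv_neq_0)). reflexivity. }
  assert (Hmr : (0 <= m / (2 * r))%R) by (apply Rdiv_le_0_compat; lra).
  assert (Bp : forall t, (Cmod (dp t) * decay r t <= m / (2 * r) * (P t + S t))%R).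
  { intros t. unfold dp. rewrite Cmod_mult, Hcoef, Rmult_assoc. apply Rmult_le_compat_l; auto.
    assert (Pd := decay_pos r t).
    apply Rle_trans with ((Cmod (pv q r t) + Cmod (sv q r t / (ev r t * ev r t))) * decay r t)%R.
    - apply Rmult_le_compat_r; [lra|apply Cmod_triangle_sub].
    - rewrite Cmod_div, Cmod_ev_sqr by (apply Cmult_neq_0; apply ev_neq_0). unfold P, S. right. field. lra. }
  assert (Bs : forall t, (Cmod (ds t) <= m / (2 * r) * (P t + S t))%R).
  { intros t. unfold ds. rewrite Cmod_mult, Hcoef. apply Rmult_le_compat_l; auto.
    eapply Rle_trans; [apply Cmod_triangle_sub|]. rewrite Cmod_mult, Cmod_ev_sqr. unfold P, S. lra. }
  set (N := fun t => (P t ^ 2 + S t ^ 2)%R).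
  set (dN := fun t => (2 * Re (Cconj (pv q r t) * dp t) * decay r t ^ 2 - 4 * (r * cos t) * P t ^ 2 + 2 * Re (Cconj (sv q r t) * ds t))%R).
  assert (DN : forall t, is_derive N t (dN t)).
  { assert (Sq : forall F dF t, rderiv F t dF -> is_derive (fun s => Cmod (F s) ^ 2)%R t (2 * Re (Cconj (F t) * dF))%R).
    { intros F dF t H. assert (X := rderiv_Re _ _ _ (rderiv_mult _ _ _ _ _ (rderiv_conj _ _ _ H) H)).
      replace (2 * Re (Cconj (F t) * dF))%R with (Re (Cconj dF * F t + Cconj (F t) * dF)).
      - revert X. apply is_derive_ext. intros s. assert (Y := Cmod2_conj (F s)). rewrite Cmult_comm, <- Y. reflexivity.
      - destruct dF, (F t); unfold Re, Cconj, Cmult, Cplus; simpl; ring. }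
    intros t. unfold N.
    apply is_derive_ext with (fun s => (Cmod (pv q r s) ^ 2 * decay r s ^ 2 + Cmod (sv q r s) ^ 2)%R).
    { intros s. unfold P, S. match goal with |- @eq _ ?a ?b => change (@eq R a b) end. ring. }
    unfold dN. apply (is_derive_plus (V := R_NormedModule)); [|apply Sq, Ds].
    assert (X := is_derive_mult _ (fun s => (decay r s ^ 2)%R) t _ (- 4 * (r * cos t) * decay r t ^ 2)%R (Sq _ _ t (Dp t))).
    replace (2 * Re (Cconj (pv q r t) * dp t) * decay r t ^ 2 - 4 * (r * cos t) * P t ^ 2)%R with
      (2 * Re (Cconj (pv q r t) * dp t) * decay r t ^ 2 + Cmod (pv q r t) ^ 2 * (- 4 * (r * cos t) * decay r t ^ 2))%R by (unfold P; ring).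
    apply X; [|intros; apply Rmult_comm]. unfold decay. auto_derive; auto. ring. }
  assert (PS0 : forall t, (0 <= P t)%R /\ (0 <= S t)%R).
  { intros t. split; [apply Rmult_le_pos; [apply Cmod_ge_0|left; apply decay_pos]|apply Cmod_ge_0]. }
  assert (NB : forall t, (0 <= t <= PI / 2)%R -> (N t <= K)%R).
  { intros t Ht. eapply Rle_trans; [apply (gronwall N dN (2 * m / r) t)|]; try lra.
    - intros s _. apply DN.
    - intros s Hs. unfold dN, N. destruct (PS0 s) as [P1 S1]. specialize (Bp s). specialize (Bs s).
      assert (Pd := decay_pos r s).
      assert (R1 : (Re (Cconj (pv q r s) * dp s) * decay r s ^ 2 <= P s * (m / (2 * r) * (P s + S s)))%R).
      { apply Rle_trans with (Cmod (pv q r s) * Cmod (dp s) * decay r s ^ 2)%R.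
        - apply Rmult_le_compat_r; [apply pow2_ge_0|]. eapply Rle_trans; [apply Rle_abs|].
          eapply Rle_trans; [apply re_le_Cmod|]. rewrite Cmod_mult, Cmod_conj. lra.
        - replace (Cmod (pv q r s) * Cmod (dp s) * decay r s ^ 2)%R with (P s * (Cmod (dp s) * decay r s))%R by (unfold P; ring).
          apply Rmult_le_compat_l; auto. }
      assert (R2 : (Re (Cconj (sv q r s) * ds s) <= S s * (m / (2 * r) * (P s + S s)))%R).
      { eapply Rle_trans; [apply Rle_abs|]. eapply Rle_trans; [apply re_le_Cmod|]. rewrite Cmod_mult, Cmod_conj.
        apply Rmult_le_compat_l; auto. }
      (* Differentiating the weight costs a term of size [r], but with the favourable sign: [decay]
         decreases throughout the first quadrant. *)
      assert (R3 : (0 <= r * cos s * P s ^ 2)%R).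
      { apply Rmult_le_pos; [apply Rmult_le_pos; [lra|apply cos_ge_0; lra]|apply pow2_ge_0]. }
      assert (R4 : (m / (2 * r) * (P s + S s) ^ 2 <= m / r * (P s ^ 2 + S s ^ 2))%R).
      { replace (m / r)%R with (m / (2 * r) * 2)%R by (field; lra). rewrite Rmult_assoc. apply Rmult_le_compat_l; auto.
        generalize (pow2_ge_0 (P s - S s)). nra. }
      replace (2 * m / r * (P s ^ 2 + S s ^ 2))%R with (2 * (m / r * (P s ^ 2 + S s ^ 2)))%R by (field; lra).
      nra.
    - unfold K. replace (N 0%R) with (2 * energy q r)%R.
      + apply Rmult_le_compat.
        * unfold energy. generalize (pow2_ge_0 (rj1 q r + rj q r / (2 * r))) (pow2_ge_0 (rj q r)). nra.
        * left; apply exp_pos.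
        * generalize (HE r Hr). lra.
        * assert (X : (2 * m / r * t <= 2 * m * (PI / 2))%R).
          { apply Rmult_le_compat; try lra. apply Rdiv_le_0_compat; lra. apply Rle_div_l; nra. }
          destruct X as [X|X]; [left; now apply exp_increasing|rewrite X; lra].
      + unfold N, P, S, decay. rewrite Rpow_mult_distr, pv_0_energy, sv_0_energy, sin_0 by lra.
        rewrite !Rmult_0_r, Ropp_0, exp_0. ring. }
  assert (PSB : forall t, (0 <= t <= PI / 2)%R -> (P t <= B)%R /\ (S t <= B)%R).
  { intros t Ht. specialize (NB t Ht). destruct (PS0 t) as [P1 S1]. unfold N in NB. split; nra. }
  destruct (PSB T HT) as [X1 X2]. unfold P in X1. unfold S in X2.
  assert (Z : (0 <= m * B * (PI / 2))%R) by (apply Rmult_le_pos; lra).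
  assert (Z2 : (m * B / r * T <= (B + m * B * (PI / 2)) / r)%R).
  { replace (m * B / r * T)%R with (m * B * T / r)%R by (field; lra). apply Rmult_le_compat_r; [left; apply Rinv_0_lt_compat; lra|]. nra. }
  split; [|split; [|split]]; try lra.
  - apply Rle_trans with (m * B / r * T)%R; auto.
    assert (Pd := decay_pos r T).
    (* The derivative of [pv] at [t] is at most [m B / r] over [decay r t], hence over the smaller
       [decay r T]; the weight at the end point [T] cancels this. *)
    apply Rle_trans with (m * B / r / decay r T * T * decay r T)%R; [|right; field; lra].
    apply Rmult_le_compat_r; [lra|]. apply (curve_mvt (pv q r) dp); [lra|intros; apply Dp|].
    intros t Ht. apply Rle_mult_div; auto.
    apply Rle_trans with (Cmod (dp t) * decay r t)%R.
    + apply Rmult_le_compat_l; [apply Cmod_ge_0|]. apply decay_decr; lra.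
    + eapply Rle_trans; [apply Bp|]. destruct (PSB t ltac:(lra)). 
      apply Rle_trans with (m / (2 * r) * (B + B))%R; [apply Rmult_le_compat_l; lra|right; field; lra].
  - apply Rle_trans with (m * B / r * T)%R; auto.
    apply (curve_mvt (sv q r) ds); [lra|intros; apply Ds|].
    intros t Ht. eapply Rle_trans; [apply Bs|]. destruct (PSB t ltac:(lra)).
    apply Rle_trans with (m / (2 * r) * (B + B))%R; [apply Rmult_le_compat_l; lra|right; field; lra].
Qed.

(** * The connection constant *)

Lemma wv_PI2 r : wv r (PI / 2) = Ci * RtoC r.
Proof. unfold wv, cis. rewrite cos_PI2, sin_PI2. unfold Ci, RtoC, Cmult; simpl; f_equal; ring. Qed.

Lemma decay_PI2 r : decay r (PI / 2) = exp (- (2 * r)).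
Proof. unfold decay. rewrite sin_PI2. f_equal. ring. Qed.

Lemma decay_0 r : decay r 0 = 1%R.
Proof. unfold decay. rewrite sin_0, !Rmult_0_r, Ropp_0. apply exp_0. Qed.

Lemma Cmod_ev_PI2 r : Cmod (ev r (PI / 2)) = exp (- r).
Proof. rewrite Cmod_ev, sin_PI2. f_equal. ring. Qed.

Lemma exp_neg_le_inv x : (0 < x)%R -> (exp (- x) <= / x)%R.
Proof.
  intros H. rewrite exp_Ropp. apply Rinv_le_contravar; auto. generalize (exp_ineq1 x). lra.
Qed.

Lemma PI2_range : (0 <= PI / 2 <= PI / 2)%R /\ (0 <= 0 <= PI / 2)%R.
Proof. generalize PI_RGT_0. lra. Qed.

(** At [w = i r] the left side equals [|pv| * exp (- 2 r)]. The variation of [pv] contributes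
    [C0 / r] after weighting, and its value on the real axis is damped by [exp (- 2 r)]. *)
Lemma av_imag_small q : exists C0 : R, (0 < C0)%R /\ forall r, (1 <= r)%R ->
  (sqrt r * exp (- r) * Cmod (av q (Ci * RtoC r)) <= C0 / r)%R.
Proof.
  destruct (arc_bounds q) as [C0 [HC H]]. exists (2 * C0)%R. split; [lra|]. intros r Hr.
  destruct (H r (PI / 2)%R Hr (proj1 PI2_range)) as [_ [_ [A _]]].
  destruct (H r 0%R Hr (proj2 PI2_range)) as [B _]. rewrite decay_0, Rmult_1_r in B.
  rewrite decay_PI2 in A.
  assert (E : (sqrt r * exp (- r) * Cmod (av q (Ci * RtoC r)) = Cmod (pv q r (PI / 2)) * exp (- (2 * r)))%R).
  { unfold pv. rewrite wv_PI2, Cmod_div, Cmod_mult, Cmod_hv, Cmod_ev_PI2 by apply ev_neq_0.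
    replace (- (2 * r))%R with (- r + - r)%R by ring. rewrite exp_plus. generalize (exp_pos (- r)). intros. field. lra. }
  rewrite E. set (x := exp (- (2 * r))) in *. assert (Hx : (0 < x)%R) by apply exp_pos.
  assert (Hx2 : (x <= / r)%R).
  { unfold x. eapply Rle_trans; [apply exp_neg_le_inv; lra|]. apply Rinv_le_contravar; lra. }
  assert (T : (Cmod (pv q r (PI / 2)) <= Cmod (pv q r (PI / 2) - pv q r 0) + Cmod (pv q r 0))%R).
  { generalize (Cmod_triangle_inv (pv q r (PI / 2)) (pv q r 0)). lra. }
  apply Rle_trans with (Cmod (pv q r (PI / 2) - pv q r 0) * x + Cmod (pv q r 0) * x)%R; [nra|].
  assert (Cmod (pv q r 0) * x <= C0 * / r)%R by (apply Rmult_le_compat; try lra; apply Cmod_ge_0).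
  unfold Rdiv in *. lra.
Qed.

(* [(- i)^q J_q (i r)] is the modified Bessel function [I_q r]. *)
Definition Uv q (r : R) : C := RtoC (sqrt r * exp (- r)) * ((- Ci) ^ q * J q (Ci * RtoC r)).
(** The common limit of [Uv q] at infinity for all orders [q]. *)
Definition bk : R := (/ sqrt (2 * PI))%R.

(** The recurrence reads [J_(q+1) = i J_q - av + ((q + 1/2) / w) J_q], and the power of [- i] in
    [Uv] absorbs the factor [i]. As [av] is small there, [Uv] has the same limit for every order. *)
Lemma Uv_step q r : (0 < r)%R -> (Cmod (Uv (S q) r - Uv q r) <=
  (INR q + 1) / r * Cmod (Uv q r) + sqrt r * exp (- r) * Cmod (av q (Ci * RtoC r)))%R.
Proof.
  intros Hr. set (w := Ci * RtoC r).
  assert (Nr : RtoC r <> 0) by (apply RtoC_neq_0; lra).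
  assert (Nw : w <> 0) by (apply Cmult_neq_0; auto; apply Ci_nz).
  assert (E : J (S q) w = ((RtoC (INR q) + / 2) / w) * J q w - av q w + Ci * J q w).
  { assert (U := BesselJ_rec_up q w). unfold av.
    assert (V : J (S q) w = (RtoC (INR q) * J q w - w * J1 q w) / w) by (rewrite U; field; auto).
    rewrite V. field. auto. }
  assert (Mi : Cmod (- Ci) = 1%R) by (rewrite Cmod_opp; apply Cmod_Ci).
  assert (D : Uv (S q) r - Uv q r = (- Ci) * ((RtoC (INR q) + / 2) / w) * Uv q r
     + - (RtoC (sqrt r * exp (- r)) * ((- Ci) ^ S q * av q w))).
  { unfold Uv. fold w. rewrite E, !Cpow_S.
    replace (RtoC (sqrt r * exp (- r)) * (- Ci * (- Ci) ^ q * ((RtoC (INR q) + / 2) / w * J q w - av q w + Ci * J q w)))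
     with (- Ci * ((RtoC (INR q) + / 2) / w) * (RtoC (sqrt r * exp (- r)) * ((- Ci) ^ q * J q w))
       + - (RtoC (sqrt r * exp (- r)) * (- Ci * (- Ci) ^ q * av q w)) - (Ci * Ci) * (RtoC (sqrt r * exp (- r)) * ((- Ci) ^ q * J q w))) by ring.
    rewrite Ci_sqr. ring. }
  rewrite D. eapply Rle_trans; [apply Cmod_triangle|]. apply Rplus_le_compat.
  - rewrite !Cmod_mult, Mi, Rmult_1_l. apply Rmult_le_compat_r; [apply Cmod_ge_0|].
    rewrite <- RtoC_inv, <- RtoC_plus, Cmod_div, Cmod_R by (auto; lra). unfold w at 1. rewrite Cmod_mult, Cmod_Ci, Cmod_R, Rmult_1_l.
    rewrite !Rabs_pos_eq by (generalize (pos_INR q); lra). apply Rmult_le_compat_r; [left; now apply Rinv_0_lt_compat|lra].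
  - rewrite Cmod_opp, !Cmod_mult, Cmod_pow, Mi, pow1, Cmod_R, Rabs_pos_eq.
    + lra.
    + apply Rmult_le_pos; [apply sqrt_pos|left; apply exp_pos].
Qed.

Lemma Uv_lim q : forall eps, (0 < eps)%R -> exists X, (1 <= X)%R /\ forall r, (X <= r)%R -> (Cmod (Uv q r - RtoC bk) < eps)%R.
Proof.
  induction q as [|q IH]; intros eps He.
  - destruct (I0_asymp eps He) as [X [HX H]]. exists (Rmax 1 X). split; [apply Rmax_l|]. intros r Hr.
    assert (R1 := Rmax_l 1 X). assert (R2 := Rmax_r 1 X).
    unfold Uv. rewrite BesselJ_0_I0 by lra. simpl ((- Ci) ^ 0). rewrite Cmult_1_l, <- RtoC_mult, <- RtoC_minus, Cmod_R.
    apply H. lra.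
  - destruct (IH (Rmin 1 (eps / 2)))%R as [X [HX H]]; [apply Rmin_pos; lra|].
    destruct (av_imag_small q) as [C0 [HC A]].
    assert (Hb : (0 < bk)%R).
    { apply Rinv_0_lt_compat, sqrt_lt_R0. generalize PI_RGT_0. lra. }
    set (L := ((INR q + 1) * (bk + 1) + C0)%R).
    assert (HL : (0 < L)%R) by (unfold L; generalize (pos_INR q); nra).
    exists (X + 2 * L / eps)%R. assert (HLe : (0 < 2 * L / eps)%R) by (apply Rdiv_lt_0_compat; lra).
    split; [lra|]. intros r Hr.
    specialize (H r ltac:(lra)). specialize (A r ltac:(lra)).
    assert (St := Uv_step q r ltac:(lra)).
    assert (M1 := Rmin_l 1 (eps / 2)). assert (M2 := Rmin_r 1 (eps / 2)).
    assert (Bd : (Cmod (Uv q r) <= bk + 1)%R).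
    { generalize (Cmod_triangle_inv (Uv q r) (RtoC bk)). rewrite Cmod_R, Rabs_pos_eq by lra. lra. }
    assert (B2 : ((INR q + 1) / r * Cmod (Uv q r) <= (INR q + 1) / r * (bk + 1))%R).
    { apply Rmult_le_compat_l; auto. apply Rdiv_le_0_compat; [generalize (pos_INR q)|]; lra. }
    assert (B3 : ((INR q + 1) / r * (bk + 1) + C0 / r = L / r)%R) by (unfold L; field; lra).
    assert (B4 : (L / r < eps / 2)%R).
    { apply Rlt_div_l; [lra|]. apply Rlt_le_trans with (eps / 2 * (X + 2 * L / eps))%R; [|apply Rmult_le_compat_l; lra].
      replace (eps / 2 * (X + 2 * L / eps))%R with (L + eps / 2 * X)%R by (field; lra). nra. }
    generalize (Cmod_triangle (Uv (S q) r - Uv q r) (Uv q r - RtoC bk)).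
    replace (Uv (S q) r - Uv q r + (Uv q r - RtoC bk)) with (Uv (S q) r - RtoC bk) by ring. lra.
Qed.

(** Since [av] is negligible at [w = i r], the modulus of [bv] is about [2 |J_q|] there, so [|sv|]
    is close to [2 |Uv|]; from there to the real axis it changes by [O(1/r)] only. *)
Lemma sv_lim q : forall eps, (0 < eps)%R -> exists X, (1 <= X)%R /\ forall r, (X <= r)%R -> (Rabs (Cmod (sv q r 0) - 2 * bk) < eps)%R.
Proof.
  intros eps He. destruct (Uv_lim q (eps / 4)%R ltac:(lra)) as [X [HX H]].
  destruct (av_imag_small q) as [C0 [HC A]]. destruct (arc_bounds q) as [C1 [HC1 B]].
  set (L := (C0 + C1)%R). assert (HL : (0 < L)%R) by (unfold L; lra).
  assert (HLe : (0 < 2 * L / eps)%R) by (apply Rdiv_lt_0_compat; lra).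
  exists (X + 2 * L / eps)%R. split; [lra|]. intros r Hr.
  assert (Hr0 : (0 < r)%R) by lra.
  specialize (H r ltac:(lra)). specialize (A r ltac:(lra)).
  destruct (B r (PI / 2)%R ltac:(lra) (proj1 PI2_range)) as [_ [_ [_ B1]]].
  assert (Hb : (0 < bk)%R).
  { apply Rinv_0_lt_compat, sqrt_lt_R0. generalize PI_RGT_0. lra. }
  assert (Mi : Cmod (- Ci) = 1%R) by (rewrite Cmod_opp; apply Cmod_Ci).
  assert (Hse : (0 <= sqrt r * exp (- r))%R) by (apply Rmult_le_pos; [apply sqrt_pos|left; apply exp_pos]).
  set (w := Ci * RtoC r) in *.
  assert (E1 : Cmod (sv q r (PI / 2)) = (sqrt r * exp (- r) * Cmod (bv q w))%R).
  { unfold sv. rewrite wv_PI2, !Cmod_mult, Cmod_hv, Cmod_ev_PI2. fold w. ring. }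
  assert (E2 : (sqrt r * exp (- r) * Cmod (J q w) = Cmod (Uv q r))%R).
  { unfold Uv. fold w. rewrite !Cmod_mult, Cmod_pow, Mi, pow1, Cmod_R, Rabs_pos_eq; auto. ring. }
  assert (T1 : (Rabs (Cmod (bv q w) - 2 * Cmod (J q w)) <= Cmod (av q w))%R).
  { assert (E3 : bv q w = av q w - 2 * Ci * J q w) by (rewrite J_ab; ring).
    assert (E4 : Cmod (2 * Ci * J q w) = (2 * Cmod (J q w))%R) by (rewrite !Cmod_mult, Cmod_Ci, Cmod_R, Rabs_pos_eq; lra).
    rewrite <- E4, E3. apply Rabs_le. split.
    - generalize (Cmod_triangle_inv (2 * Ci * J q w) (av q w)). rewrite Cmod_sub_sym. lra.
    - generalize (Cmod_triangle_sub (av q w) (2 * Ci * J q w)). lra. }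
  assert (T2 : (Rabs (Cmod (sv q r (PI / 2)) - 2 * Cmod (Uv q r)) <= C0 / r)%R).
  { rewrite E1, <- E2. eapply Rle_trans; [|exact A].
    replace (sqrt r * exp (- r) * Cmod (bv q w) - 2 * (sqrt r * exp (- r) * Cmod (J q w)))%R
      with (sqrt r * exp (- r) * (Cmod (bv q w) - 2 * Cmod (J q w)))%R by ring.
    rewrite Rabs_mult, (Rabs_pos_eq (sqrt r * exp (- r))) by auto. apply Rmult_le_compat_l; auto. }
  assert (T3 : (Rabs (Cmod (Uv q r) - bk) <= Cmod (Uv q r - RtoC bk))%R).
  { assert (E5 : Cmod (RtoC bk) = bk) by (rewrite Cmod_R, Rabs_pos_eq; lra). apply Rabs_le. split.
    - generalize (Cmod_triangle_inv (RtoC bk) (Uv q r)). rewrite (Cmod_sub_sym (RtoC bk)), E5. lra.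
    - generalize (Cmod_triangle_inv (Uv q r) (RtoC bk)). rewrite E5. lra. }
  assert (T4 : (Rabs (Cmod (sv q r 0) - Cmod (sv q r (PI / 2))) <= C1 / r)%R).
  { apply Rabs_le. split.
    - generalize (Cmod_triangle_inv (sv q r (PI / 2)) (sv q r 0)). lra.
    - generalize (Cmod_triangle_inv (sv q r 0) (sv q r (PI / 2))). rewrite Cmod_sub_sym. lra. }
  assert (T5 : (C0 / r + C1 / r < eps / 2)%R).
  { replace (C0 / r + C1 / r)%R with (L / r)%R by (unfold L; field; lra).
    apply Rlt_div_l; [lra|]. apply Rlt_le_trans with (eps / 2 * (X + 2 * L / eps))%R; [|apply Rmult_le_compat_l; lra].
    replace (eps / 2 * (X + 2 * L / eps))%R with (L + eps / 2 * X)%R by (field; lra). nra. }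
  apply Rabs_le_between in T2. apply Rabs_le_between in T3. apply Rabs_le_between in T4.
  apply Rabs_def1; lra.
Qed.

(** On the real axis [energy] is [|sv|^2], and [(2 bk)^2 = 2 / PI]. *)
Lemma energy_lim q : lim_inf (energy q) (2 / PI).
Proof.
  intros eps He. assert (Q := PI_RGT_0).
  assert (Hs : (0 < sqrt (2 * PI))%R) by (apply sqrt_lt_R0; lra).
  assert (Hb : (0 < bk)%R) by now apply Rinv_0_lt_compat.
  assert (Eb : ((2 * bk) * (2 * bk) = 2 / PI)%R).
  { unfold bk. assert (E : (sqrt (2 * PI) * sqrt (2 * PI) = 2 * PI)%R) by (apply sqrt_sqrt; lra).
    replace (2 * / sqrt (2 * PI) * (2 * / sqrt (2 * PI)))%R with (4 / (sqrt (2 * PI) * sqrt (2 * PI)))%R by (field; lra).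
    rewrite E. field. lra. }
  set (d := Rmin 1 (eps / (4 * bk + 2))).
  assert (Hq : (0 < eps / (4 * bk + 2))%R) by (apply Rdiv_lt_0_compat; lra).
  assert (Hd : (0 < d)%R) by (apply Rmin_pos; lra).
  assert (Hd1 : (d <= 1)%R) by apply Rmin_l.
  assert (Hd2 : (d * (4 * bk + 2) <= eps)%R).
  { apply Rle_trans with (eps / (4 * bk + 2) * (4 * bk + 2))%R; [apply Rmult_le_compat_r; [lra|apply Rmin_r]|right; field; lra]. }
  destruct (sv_lim q d Hd) as [X [HX H]]. exists X. split; [lra|]. intros r Hr. specialize (H r Hr).
  rewrite <- sv_0_energy by lra. rewrite <- Eb. set (s := Cmod (sv q r 0)) in *.
  replace (s ^ 2 - 2 * bk * (2 * bk))%R with ((s - 2 * bk) * (s - 2 * bk + 4 * bk))%R by ring.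
  set (u := (s - 2 * bk)%R) in *. rewrite Rabs_mult.
  assert (Rabs (u + 4 * bk) <= 1 + 4 * bk)%R.
  { eapply Rle_trans; [apply Rabs_triang|]. rewrite (Rabs_pos_eq (4 * bk)) by lra. lra. }
  generalize (Rabs_pos u) (Rabs_pos (u + 4 * bk)). nra.
Qed.

(** * Circles through a zero of [J_q] *)

(* [exp (2 i (w - r))] at [w = r exp (i t)]. *)
Definition epsv (r t : R) : C := ev r t * ev r t * cis (- (2 * r)).

Lemma Cmod_epsv r t : Cmod (epsv r t) = decay r t.
Proof. unfold epsv. rewrite Cmod_mult, Cmod_ev_sqr, Cmod_cis. ring. Qed.

Lemma epsv_rderiv r t : rderiv (epsv r) t (- 2 * wv r t * epsv r t).
Proof.
  unfold epsv. replace (- 2 * wv r t * (ev r t * ev r t * cis (- (2 * r)))) with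
    (((- wv r t * ev r t) * ev r t + ev r t * (- wv r t * ev r t)) * cis (- (2 * r)) + ev r t * ev r t * 0) by ring.
  apply (rderiv_mult (fun s => ev r s * ev r s) (fun _ => cis (- (2 * r)))).
  - apply (rderiv_mult (ev r) (ev r)); apply ev_rderiv.
  - apply cara_const.
Qed.

Lemma epsv_0 r : epsv r 0 = 1.
Proof.
  unfold epsv. rewrite ev_0, <- !cis_plus. replace (r + r + - (2 * r))%R with 0%R by ring. apply cis_0.
Qed.

(** For [r sin t >= 1] the modulus of [epsv] is at most [1 / 2]. Closer to the real axis its
    argument lies in [[- PI / 2, 0]], so its real part is nonnegative and cancellation with 1 is
    impossible. *)
Lemma one_plus_epsv r t : (2 <= r)%R -> (0 <= t <= PI / 2)%R -> (1 / 2 <= Cmod (1 + epsv r t))%R.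
Proof.
  intros Hr Ht. assert (Q := PI_RGT_0).
  assert (Hs : (0 <= sin t)%R) by (apply sin_ge_0; lra).
  assert (Hc : (0 <= cos t)%R) by (apply cos_ge_0; lra).
  assert (SC := sin2_cos2 t). unfold Rsqr in SC.
  destruct (Rle_lt_dec 1 (r * sin t)) as [L|L].
  - assert (D : (decay r t <= 1 / 2)%R).
    { unfold decay. eapply Rle_trans; [apply exp_neg_le_inv; lra|].
      replace (1 / 2)%R with (/ 2)%R by field. apply Rinv_le_contravar; lra. }
    generalize (Cmod_triangle_inv 1 (- epsv r t)). rewrite Cmod_opp, Cmod_epsv, Cmod_1.
    replace (1 - - epsv r t) with (1 + epsv r t) by ring. lra.
  - assert (E : epsv r t = RtoC (decay r t) * cis (2 * r * (1 - cos t))%R * cis (- (2 * r * (1 - cos t)) + - (2 * r * (1 - cos t)))).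
    { unfold epsv, ev, decay.
      replace (RtoC (exp (- (r * sin t))) * cis (r * cos t) * (RtoC (exp (- (r * sin t))) * cis (r * cos t)) * cis (- (2 * r)))
        with ((RtoC (exp (- (r * sin t))) * RtoC (exp (- (r * sin t)))) * (cis (r * cos t) * cis (r * cos t) * cis (- (2 * r)))) by ring.
      rewrite <- RtoC_mult, <- exp_plus, <- !cis_plus. rewrite <- Cmult_assoc, <- cis_plus.
      f_equal; [f_equal; f_equal; ring|f_equal; ring]. }
    rewrite <- Cmult_assoc, <- cis_plus in E.
    set (a := (2 * r * (1 - cos t) + (- (2 * r * (1 - cos t)) + - (2 * r * (1 - cos t))))%R) in *.
    (* Here [a = - 2 r (1 - cos t)], and [2 r (1 - cos t) <= r^2 sin^2 t <= 1 < PI / 2]; the first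
       step uses [r >= 2]. *)
    assert (Ha : (- (PI / 2) <= a <= 0)%R).
    { unfold a. assert (C1 := COS_bound t).
      assert (X : (1 - cos t <= sin t * sin t)%R) by nra.
      assert (Y : (r * (r * (1 - cos t)) <= 1)%R).
      { apply Rle_trans with ((r * sin t) * (r * sin t))%R.
        - replace (r * sin t * (r * sin t))%R with (r * (r * (sin t * sin t)))%R by ring.
          apply Rmult_le_compat_l; [lra|]. apply Rmult_le_compat_l; lra.
        - assert (0 <= r * sin t)%R by (apply Rmult_le_pos; lra). nra. }
      assert (P4 : (1 < PI / 2)%R) by apply PI2_1.
      assert (Z0 : (0 <= r * (1 - cos t))%R) by (apply Rmult_le_pos; lra).
      assert (Z : (2 * (r * (1 - cos t)) <= r * (r * (1 - cos t)))%R) by (apply Rmult_le_compat_r; lra).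
      replace (2 * r * (1 - cos t))%R with (2 * (r * (1 - cos t)))%R by ring. lra. }
    assert (Hca : (0 <= cos a)%R) by (apply cos_ge_0; lra).
    assert (X := re_le_Cmod (1 + epsv r t)). generalize (Rle_abs (Re (1 + epsv r t))).
    assert (Y : Re (1 + epsv r t) = (1 + decay r t * cos a)%R).
    { rewrite E. unfold Re, cis, RtoC, Cplus, Cmult; simpl. ring. }
    assert (D := decay_pos r t). nra.
Qed.

(** The part [64 * C0] makes the error [2 C0 / r] at most [1 / 32]; the additional 2 gives [r >= 2]
    for [one_plus_epsv]. *)
Definition qC (C0 : R) := (64 * C0 + 2)%R.

Section Circle.
Variables (q : nat) (r C0 : R).
Hypothesis HC0 : (0 < C0)%R.
Hypothesis Harc : forall r t, (1 <= r)%R -> (0 <= t <= PI / 2)%R ->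
  (Cmod (pv q r t) * decay r t <= C0 /\ Cmod (sv q r t) <= C0 /\
   Cmod (pv q r t - pv q r 0) * decay r t <= C0 / r /\ Cmod (sv q r t - sv q r 0) <= C0 / r)%R.
Hypothesis Hr : (qC C0 <= r)%R.
Hypothesis Hzero : rj q r = 0%R.
Let v : R := (sqrt r * rj1 q r)%R.
Hypothesis Hv : (/ 4 <= v * v <= 1)%R.

Let Hr1 : (1 <= r)%R.
Proof. unfold qC in Hr. lra. Qed.
Let Hr0 : (0 < r)%R.
Proof. lra. Qed.

(* [sqrt w * J_q' w * exp (i (w - r))] is [Dv], that is
   [v cos (w - r) exp (i (w - r))] up to an error [O(1/r)]: see [J1_identity]. *)
Definition errv (t : R) : C := / 2 * ((pv q r t - pv q r 0) * (ev r t * ev r t) * cis (- r) + (sv q r t - sv q r 0) * cis (- r))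
  - (pv q r t * (ev r t * ev r t) - sv q r t) * cis (- r) / (4 * Ci * wv r t).

Definition Dv (t : R) : C := / 2 * RtoC v * (1 + epsv r t) + errv t.

Lemma cis_neg_sqr : cis (- (2 * r)) = cis (- r) * cis (- r).
Proof. rewrite <- cis_plus. f_equal. ring. Qed.

Lemma J1_identity t : hv r t * J1 q (wv r t) * (ev r t * cis (- r)) = Dv t.
Proof.
  assert (W := wv_neq_0 r t Hr0). assert (E := ev_neq_0 r t). assert (K := cis_neq_0 r).
  unfold Dv, errv, epsv. rewrite cis_neg_sqr.
  (* As [J_q r = 0], [av] and [bv] both reduce to [J_q' r], so the two starting values are known
     together with their phases. *)
  assert (P0 : pv q r 0 = RtoC v * cis (- r)).
  { unfold pv. rewrite hv_0, wv_0, ev_0, av_real, Hzero by auto.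
    replace (rj1 q r + 0 / (2 * r))%R with (rj1 q r) by (field; lra).
    rewrite cis_opp. unfold v. rewrite RtoC_mult. field. auto. }
  assert (S0 : sv q r 0 = RtoC v * cis r).
  { unfold sv. rewrite hv_0, wv_0, ev_0, bv_real, Hzero by auto.
    replace (rj1 q r + 0 / (2 * r))%R with (rj1 q r) by (field; lra).
    unfold v. rewrite RtoC_mult, Ropp_0. ring. }
  rewrite P0, S0, cis_opp. unfold pv, sv.
  set (w := wv r t) in *. set (e := ev r t) in *. set (h := hv r t). set (c := cis r) in *.
  assert (JJ : J1 q w = (av q w + bv q w) / 2 - (av q w - bv q w) / (2 * Ci) / (2 * w)).
  { unfold av, bv. field. auto. }
  rewrite JJ. field. auto 10.
Qed.

(** The first half of [errv] is the variation of [pv] and [sv] along the arc; the second comes from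
    the term [J_q / (2 w)] in [av] and [bv]. Each is at most [C0 / r]. *)
Lemma errv_bound t : (0 <= t <= PI / 2)%R -> (Cmod (errv t) <= 2 * C0 / r)%R.
Proof.
  intros Ht. destruct (Harc r t Hr1 Ht) as [B1 [B2 [B3 B4]]].
  assert (W := wv_neq_0 r t Hr0).
  assert (N4 : 4 * Ci * wv r t <> 0) by (apply Cmult_neq_0; [apply Cmult_neq_0|]; auto).
  unfold errv. eapply Rle_trans; [apply Cmod_triangle_sub|].
  replace (2 * C0 / r)%R with (C0 / r + C0 / r)%R by (field; lra). apply Rplus_le_compat.
  - rewrite Cmod_mult, Cmod_inv, Cmod_R, Rabs_pos_eq by (lra || auto).
    assert (X : (Cmod ((pv q r t - pv q r 0) * (ev r t * ev r t) * cis (- r) + (sv q r t - sv q r 0) * cis (- r)) <= C0 / r + C0 / r)%R).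
    { eapply Rle_trans; [apply Cmod_triangle|]. rewrite (Cmod_mult _ (cis (- r))), (Cmod_mult _ (ev r t * ev r t)), Cmod_ev_sqr, (Cmod_mult (sv q r t - sv q r 0)), Cmod_cis. lra. }
    lra.
  - rewrite Cmod_div, !(Cmod_mult _ (wv r t)), Cmod_wv, Cmod_mult, Cmod_cis, (Cmod_mult 4), Cmod_Ci, Cmod_R, (Rabs_pos_eq 4) by (auto || lra).
    assert (X : (Cmod (pv q r t * (ev r t * ev r t) - sv q r t) <= C0 + C0)%R).
    { eapply Rle_trans; [apply Cmod_triangle_sub|]. rewrite Cmod_mult, Cmod_ev_sqr. lra. }
    apply Rle_div_l; [lra|]. replace (C0 / r * (4 * 1 * r))%R with (4 * C0)%R by (field; lra). lra.
Qed.

Lemma err_small : (2 * C0 / r <= 1 / 32)%R.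
Proof. apply Rle_div_l; [lra|]. unfold qC in Hr. lra. Qed.

Lemma main_lower t : (0 <= t <= PI / 2)%R -> (1 / 8 <= Cmod (/ 2 * RtoC v * (1 + epsv r t)))%R.
Proof.
  intros Ht. rewrite !Cmod_mult, Cmod_inv, !Cmod_R, (Rabs_pos_eq 2) by (auto || lra).
  assert (X := one_plus_epsv r t ltac:(unfold qC in Hr; lra) Ht).
  assert (Y : (/ 2 <= Rabs v)%R).
  { apply Rsqr_incr_0_var; [|apply Rabs_pos]. rewrite <- Rsqr_abs. unfold Rsqr. lra. }
  nra.
Qed.

Lemma main_upper t : (0 <= t <= PI / 2)%R -> (Cmod (/ 2 * RtoC v * (1 + epsv r t)) <= 1)%R.
Proof.
  intros Ht. rewrite !Cmod_mult, Cmod_inv, !Cmod_R, (Rabs_pos_eq 2) by (auto || lra).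
  assert (X : (Cmod (1 + epsv r t) <= 2)%R).
  { eapply Rle_trans; [apply Cmod_triangle|]. rewrite Cmod_1, Cmod_epsv.
    assert (Y : (decay r t <= decay r 0)%R) by (apply decay_decr; lra). rewrite decay_0 in Y. lra. }
  assert (Y : (Rabs v <= 1)%R).
  { apply Rsqr_incr_0_var; [|lra]. rewrite <- Rsqr_abs. unfold Rsqr. lra. }
  generalize (Rabs_pos v) (Cmod_ge_0 (1 + epsv r t)). nra.
Qed.

Lemma Dv_lower t : (0 <= t <= PI / 2)%R -> (1 / 16 <= Cmod (Dv t))%R.
Proof.
  intros Ht. assert (A := main_lower t Ht). assert (B := errv_bound t Ht). assert (E := err_small).
  unfold Dv. generalize (Cmod_triangle_inv (/ 2 * RtoC v * (1 + epsv r t)) (- errv t)).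
  rewrite Cmod_opp. replace (/ 2 * RtoC v * (1 + epsv r t) - - errv t) with (/ 2 * RtoC v * (1 + epsv r t) + errv t) by ring. lra.
Qed.

Lemma Cmod_pos_neq_0 (x : C) (m : R) : (0 < m)%R -> (m <= Cmod x)%R -> x <> 0.
Proof. intros Hm H E. rewrite E, Cmod_0 in H. lra. Qed.

Lemma hv_sqr t : hv r t * hv r t = wv r t.
Proof.
  unfold hv, wv. replace (RtoC (sqrt r) * cis (t / 2) * (RtoC (sqrt r) * cis (t / 2))) with
    ((RtoC (sqrt r) * RtoC (sqrt r)) * (cis (t / 2) * cis (t / 2))) by ring.
  rewrite <- RtoC_mult, sqrt_sqrt, <- cis_plus by lra. f_equal. f_equal. field.
Qed.

(** The square of [J1_identity]: [hv^2] is [w], and the square of [ev r t * cis (- r)] is [epsv]. *)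
Lemma den_formula t : (0 <= t <= PI / 2)%R -> den_fun q (wv r t) = wv r t * epsv r t / (Dv t * Dv t).
Proof.
  intros Ht. assert (ND := Cmod_pos_neq_0 (Dv t) (1 / 16) ltac:(lra) (Dv_lower t Ht)).
  assert (K := J1_identity t). assert (W := wv_neq_0 r t Hr0). assert (E := ev_neq_0 r t).
  assert (Cn := cis_neq_0 (- r)). unfold den_fun, epsv. rewrite cis_neg_sqr, <- hv_sqr.
  assert (Nh : hv r t <> 0) by (intro Z; apply W; rewrite <- hv_sqr, Z; ring).
  assert (NJ : J1 q (wv r t) <> 0) by (intro Z; apply ND; rewrite <- K, Z; ring).
  rewrite hv_sqr, <- K. rewrite <- hv_sqr in *. field. auto.
Qed.

Lemma Dv_sqr_inv t : (0 <= t <= PI / 2)%R -> (/ (Cmod (Dv t) * Cmod (Dv t)) <= 256)%R.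
Proof.
  intros Ht. assert (A := Dv_lower t Ht). replace 256%R with (/ (1 / 16 * (1 / 16)))%R by field.
  apply Rinv_le_contravar; nra.
Qed.

Lemma den_bound t : (0 <= t <= PI / 2)%R -> (Cmod (den_fun q (wv r t)) <= 256 * r * decay r t)%R.
Proof.
  intros Ht. assert (ND := Cmod_pos_neq_0 (Dv t) (1 / 16) ltac:(lra) (Dv_lower t Ht)).
  rewrite den_formula, Cmod_div, !Cmod_mult, Cmod_wv, Cmod_epsv by (auto; now apply Cmult_neq_0).
  unfold Rdiv. assert (P := decay_pos r t). assert (D := Dv_sqr_inv t Ht).
  assert (0 <= r * decay r t)%R by (apply Rmult_le_pos; lra). nra.
Qed.

(** The difference of the inverse squares is [errv * (2 D0 + errv)] over both squares, up to sign.
    The factor [w] cancels the [1 / r] of the error, and [98304 = 2 * 3 * 256 * 64]. What remains is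
    bounded by [decay], whose integral is [O(1/r)]. *)
Lemma den_main t : (0 <= t <= PI / 2)%R ->
  (Cmod (den_fun q (wv r t) - 4 * wv r t * epsv r t / (RtoC (v * v) * ((1 + epsv r t) * (1 + epsv r t))))
    <= 98304 * C0 * decay r t)%R.
Proof.
  intros Ht. rewrite den_formula by auto.
  set (D0 := / 2 * RtoC v * (1 + epsv r t)).
  assert (L0 := main_lower t Ht). assert (U0 := main_upper t Ht). fold D0 in L0, U0.
  assert (L := Dv_lower t Ht). assert (EB := errv_bound t Ht). assert (ES := err_small).
  assert (N0 := Cmod_pos_neq_0 D0 (1 / 8) ltac:(lra) L0).
  assert (N := Cmod_pos_neq_0 (Dv t) (1 / 16) ltac:(lra) L).
  assert (Ne := Cmod_pos_neq_0 (1 + epsv r t) (1 / 2) ltac:(lra) (one_plus_epsv r t ltac:(unfold qC in Hr; lra) Ht)).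
  assert (Nv : RtoC v <> 0) by (apply RtoC_neq_0; intro Z; rewrite Z in Hv; lra).
  replace (4 * wv r t * epsv r t / (RtoC (v * v) * ((1 + epsv r t) * (1 + epsv r t)))) with (wv r t * epsv r t / (D0 * D0)).
  2:{ unfold D0. rewrite RtoC_mult. field. auto. }
  replace (wv r t * epsv r t / (Dv t * Dv t) - wv r t * epsv r t / (D0 * D0)) with
    (- (wv r t * epsv r t) * (errv t * (2 * D0 + errv t)) / ((Dv t * Dv t) * (D0 * D0))).
  2:{ assert (Eq : errv t = Dv t - D0) by (unfold Dv; fold D0; ring). rewrite Eq. field. auto. }
  rewrite Cmod_div by (apply Cmult_neq_0; apply Cmult_neq_0; auto). rewrite !Cmod_mult, Cmod_opp, Cmod_mult, Cmod_wv, Cmod_epsv by auto.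
  assert (T : (Cmod (2 * D0 + errv t) <= 3)%R).
  { eapply Rle_trans; [apply Cmod_triangle|]. rewrite Cmod_mult, Cmod_R, Rabs_pos_eq by lra. lra. }
  assert (I1 := Dv_sqr_inv t Ht).
  assert (I2 : (/ (Cmod D0 * Cmod D0) <= 64)%R).
  { replace 64%R with (/ (1 / 8 * (1 / 8)))%R by field. apply Rinv_le_contravar; nra. }
  assert (Pd := decay_pos r t).
  assert (J1' : (0 < / (Cmod (Dv t) * Cmod (Dv t)))%R) by (apply Rinv_0_lt_compat; nra).
  assert (J2' : (0 < / (Cmod D0 * Cmod D0))%R) by (apply Rinv_0_lt_compat; nra).
  assert (X1 : (Cmod (errv t) * Cmod (2 * D0 + errv t) <= 2 * C0 / r * 3)%R).
  { apply Rmult_le_compat; auto; apply Cmod_ge_0. }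
  assert (X2 : (/ (Cmod (Dv t) * Cmod (Dv t)) * / (Cmod D0 * Cmod D0) <= 256 * 64)%R) by (apply Rmult_le_compat; lra).
  unfold Rdiv. rewrite Rinv_mult.
  apply Rle_trans with (r * decay r t * (2 * C0 / r * 3) * (256 * 64))%R.
  - apply Rmult_le_compat; auto.
    + apply Rmult_le_pos; [apply Rmult_le_pos; lra|]. apply Rmult_le_pos; apply Cmod_ge_0.
    + apply Rmult_le_pos; lra.
    + apply Rmult_le_compat_l; auto. apply Rmult_le_pos; lra.
  - right. field. lra.
Qed.

(** [J_q] grows at most like [exp (r sin t) / sqrt r], while [1 / J_q'^2] is
    [O(r exp (- 2 r sin t))]. *)
Lemma num_bound t : (0 <= t <= PI / 2)%R ->
  (Cmod (num_fun q (wv r t)) <= 256 * C0 * sqrt r * exp (- (r * sin t)))%R.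
Proof.
  intros Ht. destruct (Harc r t Hr1 Ht) as [B1 [B2 _]].
  assert (W := wv_neq_0 r t Hr0). assert (E := ev_neq_0 r t).
  assert (Hs : (0 < sqrt r)%R) by now apply sqrt_lt_R0.
  assert (X : (Cmod (J q (wv r t)) * (sqrt r * exp (- (r * sin t))) <= C0)%R).
  { assert (Y : 2 * Ci * J q (wv r t) * (hv r t * ev r t) = pv q r t * (ev r t * ev r t) - sv q r t).
    { rewrite J_ab. unfold pv, sv. field. auto. }
    assert (Z : (Cmod (2 * Ci * J q (wv r t) * (hv r t * ev r t)) <= C0 + C0)%R).
    { rewrite Y. eapply Rle_trans; [apply Cmod_triangle_sub|]. rewrite Cmod_mult, Cmod_ev_sqr. lra. }
    rewrite !Cmod_mult, Cmod_Ci, Cmod_R, Rabs_pos_eq, Cmod_hv, Cmod_ev in Z by lra. lra. }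
  assert (Y := den_bound t Ht).
  replace (num_fun q (wv r t)) with (J q (wv r t) * den_fun q (wv r t)) by (unfold num_fun, den_fun, Cdiv; ring).
  rewrite Cmod_mult.
  assert (Ed : decay r t = (exp (- (r * sin t)) * exp (- (r * sin t)))%R) by (rewrite <- exp_plus; unfold decay; f_equal; ring).
  rewrite Ed in Y. set (x := exp (- (r * sin t))) in *. assert (Hx : (0 < x)%R) by apply exp_pos.
  assert (Er : (sqrt r * sqrt r = r)%R) by (apply sqrt_sqrt; lra).
  apply Rle_trans with (Cmod (J q (wv r t)) * (256 * r * (x * x)))%R; [apply Rmult_le_compat_l; auto; apply Cmod_ge_0|].
  replace (256 * r * (x * x))%R with (256 * (sqrt r * sqrt r) * (x * x))%R by (rewrite Er; ring).
  replace (Cmod (J q (wv r t)) * (256 * (sqrt r * sqrt r) * (x * x)))%R with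
    (Cmod (J q (wv r t)) * (sqrt r * x) * (256 * (sqrt r * x)))%R by ring.
  replace (256 * C0 * sqrt r * x)%R with (C0 * (256 * (sqrt r * x)))%R by ring.
  apply Rmult_le_compat_r; auto. apply Rmult_le_pos; [lra|apply Rmult_le_pos; lra].
Qed.
End Circle.

(** * Limits of the contour integrals *)

Lemma CI_Chasles g a b c : (a <= b)%R -> (b <= c)%R -> (forall t, Rcont g t) -> CI g a c = CI g a b + CI g b c.
Proof.
  intros Hab Hbc H. symmetry. apply (@RInt_Chasles C_R_CompleteNormedModule g a b c); apply CI_ex; auto; intros t _; auto.
Qed.

Lemma CI_reflect g a b c : (a <= b)%R -> (forall t, Rcont g t) ->
  CI g (c - b) (c - a) = CI (fun t => g (c - t)%R) a b.
Proof.
  intros Hab H.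
  assert (Hc : con a b (fun t => g (c - t)%R)).
  { intros t _. apply cont_continuous. apply (continuous_comp (fun s => c - s)%R g).
    - apply (ex_derive_continuous (fun s => c - s)%R). auto_derive. auto.
    - apply cont_continuous, H. }
  assert (E := @RInt_comp_lin C_R_CompleteNormedModule g (-1)%R c a b).
  assert (X : @ex_RInt C_R_CompleteNormedModule g (-1 * a + c)%R (-1 * b + c)%R).
  { apply (@ex_RInt_continuous C_R_CompleteNormedModule). intros t _. now apply cont_continuous. }
  specialize (E X).
  assert (X' : @ex_RInt C_R_CompleteNormedModule g (c - b)%R (c - a)%R).
  { apply CI_ex; [lra|]. intros t _. apply H. }
  replace (-1 * b + c)%R with (c - b)%R in E by ring. replace (-1 * a + c)%R with (c - a)%R in E by ring.
  assert (Sw := @opp_RInt_swap C_R_CompleteNormedModule g (c - b)%R (c - a)%R X').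
  assert (E2 : CI (fun t => (-1) * g (c - t)%R) a b = - CI g (c - b) (c - a)).
  { transitivity (@RInt C_R_CompleteNormedModule (fun y => scal (-1)%R (g (-1 * y + c)%R)) a b); [|etransitivity; [exact E|symmetry; exact Sw]].
    apply CI_ext; auto. intros t _. replace (-1 * t + c)%R with (c - t)%R by ring.
    destruct (g (c - t)%R) as [x y]. apply injective_projections.
    - change (-1 * x - 0 * y = -1 * x)%R. ring.
    - change (-1 * y + 0 * x = -1 * y)%R. ring. }
  rewrite CI_scal in E2 by auto.
  replace (CI g (c - b) (c - a)) with (- - CI g (c - b) (c - a)) by ring. rewrite <- E2. ring.
Qed.

Lemma CI_translate g a b c : (a <= b)%R -> (forall t, Rcont g t) -> CI g (a + c) (b + c) = CI (fun t => g (c + t)%R) a b.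
Proof.
  intros Hab H.
  assert (E := @RInt_comp_lin C_R_CompleteNormedModule g 1%R c a b).
  assert (X : @ex_RInt C_R_CompleteNormedModule g (1 * a + c)%R (1 * b + c)%R).
  { apply (@ex_RInt_continuous C_R_CompleteNormedModule). intros t _. now apply cont_continuous. }
  specialize (E X). rewrite !Rmult_1_l in E. unfold CI at 1. etransitivity; [symmetry; exact E|].
  apply CI_ext; auto. intros t _. rewrite (scal_one (V := C_R_ModuleSpace)). f_equal. ring.
Qed.

Lemma con_reflect g a b c : (forall t, Rcont g t) -> con a b (fun t => g (c - t)%R).
Proof.
  intros H t _. apply cont_continuous. apply (continuous_comp (fun s => c - s)%R g).
  - apply (ex_derive_continuous (fun s => c - s)%R). auto_derive. auto.
  - apply cont_continuous, H.
Qed.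

Lemma con_translate g a b c : (forall t, Rcont g t) -> con a b (fun t => g (c + t)%R).
Proof.
  intros H t _. apply cont_continuous. apply (continuous_comp (fun s => c + s)%R g).
  - apply (ex_derive_continuous (fun s => c + s)%R). auto_derive. auto.
  - apply cont_continuous, H.
Qed.

Lemma CI_quarters g : (forall t, Rcont g t) ->
  CI g 0 (2 * PI) = CI (fun t => g t + g (PI - t)%R + g (PI + t)%R + g (2 * PI - t)%R) 0 (PI / 2).
Proof.
  intros H. assert (Q := PI_RGT_0). assert (Q2 : (0 <= PI / 2)%R) by lra.
  rewrite (CI_Chasles g 0 PI (2 * PI)), (CI_Chasles g 0 (PI / 2) PI), (CI_Chasles g PI (PI / 2 + PI) (2 * PI)) by (lra || auto).
  assert (E1 := CI_reflect g 0 (PI / 2) PI Q2 H). rewrite Rminus_0_r in E1. replace (PI - PI / 2)%R with (PI / 2)%R in E1 by field.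
  assert (E2 := CI_translate g 0 (PI / 2) PI Q2 H). rewrite Rplus_0_l in E2.
  assert (E3 := CI_reflect g 0 (PI / 2) (2 * PI) Q2 H). rewrite Rminus_0_r in E3. replace (2 * PI - PI / 2)%R with (PI / 2 + PI)%R in E3 by field.
  rewrite E1, E2, E3.
  assert (C1 := con_reflect g 0 (PI / 2) PI H). assert (C2 := con_translate g 0 (PI / 2) PI H).
  assert (C3 := con_reflect g 0 (PI / 2) (2 * PI) H).
  assert (C0 : con 0 (PI / 2) g) by (intros t _; auto).
  rewrite !CI_plus; auto; try ring; repeat apply con_plus; auto.
Qed.

Lemma wv_reflect r t : wv r (PI - t) = - Cconj (wv r t).
Proof.
  unfold wv, cis. rewrite Rtrigo_facts.cos_pi_minus, Rtrigo_facts.sin_pi_minus.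
  unfold Cconj, Copp, Cmult, RtoC; simpl. f_equal; ring.
Qed.

Lemma wv_opp r t : wv r (PI + t) = - wv r t.
Proof.
  unfold wv, cis. rewrite (Rplus_comm PI), neg_cos, neg_sin. unfold Copp, Cmult, RtoC; simpl. f_equal; ring.
Qed.

Lemma wv_conj r t : wv r (2 * PI - t) = Cconj (wv r t).
Proof.
  replace (2 * PI - t)%R with (PI + (PI - t))%R by ring. rewrite wv_opp, wv_reflect. ring.
Qed.

(** * Kernel estimates and reduction to the first quadrant *)

Section Kernels.
Variables (r : R) (z : C).
Hypothesis Hz : (2 * Cmod z + 1 <= r)%R.

Lemma kernel_den w : Cmod w = r -> w - z <> 0 /\ (r / 2 <= Cmod (w - z))%R.
Proof.
  intros Hw. assert (A := Cmod_triangle_inv w z). assert (P := Cmod_ge_0 z).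
  assert (B : (r / 2 <= Cmod (w - z))%R) by lra. split; auto.
  apply (Cmod_pos_neq_0 _ (r / 2)); auto; lra.
Qed.

Lemma kernel_sub_1 w : Cmod w = r -> (Cmod (w / (w - z) - 1) <= 2 * Cmod z / r)%R.
Proof.
  intros Hw. destruct (kernel_den w Hw) as [N B]. assert (P := Cmod_ge_0 z).
  replace (w / (w - z) - 1) with (z / (w - z)) by (field; auto). rewrite Cmod_div by auto.
  apply Rle_div_l; [lra|]. apply Rle_trans with (2 * Cmod z / r * (r / 2))%R; [right; field; lra|].
  apply Rmult_le_compat_l; auto. apply Rdiv_le_0_compat; lra.
Qed.

Lemma kernel_le_2 w : Cmod w = r -> (Cmod (w / (w - z)) <= 2)%R.
Proof.
  intros Hw. destruct (kernel_den w Hw) as [N B]. assert (P := Cmod_ge_0 z). rewrite Cmod_div by auto.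
  apply Rle_div_l; lra.
Qed.
End Kernels.

(** A majorant of [exp (- k sin t)] with the elementary primitive [(t - exp (- k sin t)) / k]; its
    integral is therefore at most [(1 + PI / 2) / k], below [3 / k]. *)
Definition gfun (k t : R) : R := (cos t * exp (- (k * sin t)) + / k)%R.

(* [1 <= cos t + sin t] on the first quadrant and [x exp (-x) <= 1]. *)
Lemma exp_sin_le_gfun k t : (0 < k)%R -> (0 <= t <= PI / 2)%R -> (exp (- (k * sin t)) <= gfun k t)%R.
Proof.
  intros Hk Ht. unfold gfun.
  assert (Hs : (0 <= sin t)%R) by (apply sin_ge_0; generalize PI_RGT_0; lra).
  assert (Hc : (0 <= cos t)%R) by (apply cos_ge_0; lra).
  assert (SC := sin2_cos2 t). unfold Rsqr in SC.
  assert (X : (1 <= cos t + sin t)%R) by nra.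
  set (e := exp (- (k * sin t))). assert (He : (0 < e)%R) by apply exp_pos.
  assert (Y : (k * sin t * e <= 1)%R).
  { unfold e. rewrite exp_Ropp. assert (P := exp_pos (k * sin t)).
    apply Rmult_le_reg_r with (exp (k * sin t)); auto. rewrite Rmult_assoc, Rinv_l, Rmult_1_l, Rmult_1_r by lra.
    generalize (exp_ineq1_le (k * sin t)). lra. }
  assert (Z : (sin t * e <= / k)%R).
  { apply Rmult_le_reg_l with k; auto. rewrite Rinv_r by lra. lra. }
  nra.
Qed.

Lemma gfun_RInt k : (0 < k)%R -> exists I, is_RInt (gfun k) 0 (PI / 2) I /\ (I <= 3 / k)%R.
Proof.
  intros Hk. exists (- / k * exp (- (k * sin (PI / 2))) + / k * (PI / 2) - (- / k * exp (- (k * sin 0)) + / k * 0))%R. split.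
  - apply (is_RInt_derive (V := R_CompleteNormedModule) (fun t => - / k * exp (- (k * sin t)) + / k * t)%R).
    + intros t _. unfold gfun. auto_derive; auto. field. lra.
    + intros t _. unfold gfun. apply (ex_derive_continuous (fun t => cos t * exp (- (k * sin t)) + / k)%R). auto_derive. auto.
  - rewrite sin_PI2, sin_0, !Rmult_0_r, Rmult_1_r, Ropp_0, exp_0.
    assert (Q := PI2_3_2). assert (P4 := PI_4). assert (E := exp_pos (- k)). assert (I := Rinv_0_lt_compat k Hk).
    unfold Rdiv. nra.
Qed.

(** A quarter-circle form of Jordan's lemma; [k] is [r] for the numerator and [2 r] for the
    denominator. *)
Lemma CI_gfun_bound F c k : (0 < k)%R -> (0 <= c)%R -> con 0 (PI / 2) F ->
  (forall t, (0 <= t <= PI / 2)%R -> (Cmod (F t) <= c * exp (- (k * sin t)))%R) ->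
  (Cmod (CI F 0 (PI / 2)) <= c * (3 / k))%R.
Proof.
  intros Hk Hc HF H. destruct (gfun_RInt k Hk) as [I [HI HI2]].
  apply Rle_trans with (c * I)%R; [|now apply Rmult_le_compat_l].
  apply CI_norm with (fun t => c * gfun k t)%R; auto.
  - apply PI2_pos.
  - intros t Ht. eapply Rle_trans; [apply H; auto|]. apply Rmult_le_compat_l; auto. now apply exp_sin_le_gfun.
  - exact (is_RInt_scal (V := R_NormedModule) _ 0 (PI / 2) c I HI).
Qed.

Section Symmetric.
Variables (q : nat) (r : R) (z sg : C) (f : C -> C).
Hypothesis Hz : (2 * Cmod z + 1 <= r)%R.
Hypothesis Hsg : Cmod sg = 1%R.
Hypothesis Hopp : forall w, Cmod w = r -> f (- w) = sg * f w.
Hypothesis Hconj : forall w, Cmod w = r -> f (Cconj w) = Cconj (f w).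
Hypothesis Hcont : forall w, Cmod w = r -> @cont C_UniformSpace f w.

Let Hr0 : (0 < r)%R.
Proof. generalize (Cmod_ge_0 z). lra. Qed.

Let Ka w := w / (w - z).

Lemma wv_cont t : Rcont (wv r) t.
Proof. exact (rderiv_cont _ _ _ (wv_rderiv r t)). Qed.

Lemma f_wv_cont t : Rcont (fun s => f (wv r s)) t.
Proof. apply (cont_comp (wv r) t f); [apply wv_cont|]. apply Hcont. now apply Cmod_wv. Qed.

Lemma Kf_wv_cont t : Rcont (fun s => Ka (wv r s) * f (wv r s)) t.
Proof.
  apply cont_mult; [|apply f_wv_cont]. apply cont_div; [apply wv_cont|apply cont_minus; [apply wv_cont|apply cont_const]|].
  apply (kernel_den r z Hz). now apply Cmod_wv.
Qed.

Lemma oint_wv : oint (fun w => w / (w - z) * f w) r = CI (fun t => Ka (wv r t) * f (wv r t)) 0 (2 * PI).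
Proof. unfold oint, circ. apply CI_ext; auto. intros t _. unfold wv, Ka. now rewrite Rmult_1_l. Qed.

Lemma Cmod_sym t : Cmod (- Cconj (wv r t)) = r /\ Cmod (- wv r t) = r /\ Cmod (Cconj (wv r t)) = r.
Proof. rewrite !Cmod_opp, !Cmod_conj, !Cmod_wv; auto. Qed.

(** The contributions of [wv r t] and of its reflections in the axes and the origin. Parity and
    conjugation express [f] at all four through [f (wv r t)], so asymptotics are required in the
    first quadrant only. *)
Definition quad (t : R) : C := Ka (wv r t) * f (wv r t) + Ka (- Cconj (wv r t)) * f (- Cconj (wv r t)) +
  Ka (- wv r t) * f (- wv r t) + Ka (Cconj (wv r t)) * f (Cconj (wv r t)).

Lemma oint_quad : oint (fun w => w / (w - z) * f w) r = CI quad 0 (PI / 2).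
Proof.
  rewrite oint_wv, CI_quarters by apply Kf_wv_cont. apply CI_ext; [apply PI2_pos|]. intros t _. unfold quad.
  now rewrite wv_reflect, wv_opp, wv_conj.
Qed.

Lemma quad_con : con 0 (PI / 2) quad.
Proof.
  intros t Ht.
  apply cont_ext_loc with (fun t => Ka (wv r t) * f (wv r t) + Ka (wv r (PI - t)) * f (wv r (PI - t)) +
    Ka (wv r (PI + t)) * f (wv r (PI + t)) + Ka (wv r (2 * PI - t)) * f (wv r (2 * PI - t))).
  - apply filter_forall. intros s. unfold quad. now rewrite wv_reflect, wv_opp, wv_conj.
  - apply cont_plus; [apply cont_plus; [apply cont_plus|]|].
    + apply Kf_wv_cont.
    + exact (con_reflect (fun t => Ka (wv r t) * f (wv r t)) 0 (PI / 2) PI Kf_wv_cont t Ht).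
    + exact (con_translate (fun t => Ka (wv r t) * f (wv r t)) 0 (PI / 2) PI Kf_wv_cont t Ht).
    + exact (con_reflect (fun t => Ka (wv r t) * f (wv r t)) 0 (PI / 2) (2 * PI) Kf_wv_cont t Ht).
Qed.

Lemma f_values t : f (- Cconj (wv r t)) = sg * Cconj (f (wv r t)) /\ f (- wv r t) = sg * f (wv r t) /\
  f (Cconj (wv r t)) = Cconj (f (wv r t)).
Proof.
  assert (W := Cmod_wv r t Hr0). destruct (Cmod_sym t) as [_ [_ W2]].
  rewrite !Hopp, !Hconj by auto. auto.
Qed.

Lemma quad_bound t : (Cmod (quad t) <= 8 * Cmod (f (wv r t)))%R.
Proof.
  destruct (f_values t) as [E1 [E2 E3]]. unfold quad. rewrite E1, E2, E3.
  destruct (Cmod_sym t) as [W1 [W2 W3]]. assert (W0 := Cmod_wv r t Hr0).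
  assert (K0 := kernel_le_2 r z Hz _ W0). assert (K1 := kernel_le_2 r z Hz _ W1).
  assert (K2 := kernel_le_2 r z Hz _ W2). assert (K3 := kernel_le_2 r z Hz _ W3).
  eapply Rle_trans; [apply Cmod_triangle|]. eapply Rle_trans; [apply Rplus_le_compat_r, Cmod_triangle|].
  eapply Rle_trans; [apply Rplus_le_compat_r, Rplus_le_compat_r, Cmod_triangle|].
  unfold Ka. rewrite !Cmod_mult, Hsg, Cmod_conj. assert (P := Cmod_ge_0 (f (wv r t))). nra.
Qed.

(** Replacing the kernel by 1 costs [2 |z| / r] at each of the four points. With [sg = 1] the four
    values of [f] pair off into twice a real quantity. *)
Lemma quad_main t : sg = 1 -> (Cmod (quad t - 2 * (f (wv r t) + Cconj (f (wv r t)))) <= 8 * Cmod z / r * Cmod (f (wv r t)))%R.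
Proof.
  intros Es. destruct (f_values t) as [E1 [E2 E3]]. unfold quad. rewrite E1, E2, E3, Es, !Cmult_1_l.
  destruct (Cmod_sym t) as [W1 [W2 W3]]. assert (W0 := Cmod_wv r t Hr0).
  assert (K0 := kernel_sub_1 r z Hz _ W0). assert (K1 := kernel_sub_1 r z Hz _ W1).
  assert (K2 := kernel_sub_1 r z Hz _ W2). assert (K3 := kernel_sub_1 r z Hz _ W3).
  set (F := f (wv r t)). set (G := Cconj F).
  assert (MG : Cmod G = Cmod F) by apply Cmod_conj.
  replace (Ka (wv r t) * F + Ka (- Cconj (wv r t)) * G + Ka (- wv r t) * F + Ka (Cconj (wv r t)) * G - 2 * (F + G))
    with ((Ka (wv r t) - 1) * F + (Ka (- Cconj (wv r t)) - 1) * G + (Ka (- wv r t) - 1) * F + (Ka (Cconj (wv r t)) - 1) * G) by ring.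
  eapply Rle_trans; [apply Cmod_triangle|]. eapply Rle_trans; [apply Rplus_le_compat_r, Cmod_triangle|].
  eapply Rle_trans; [apply Rplus_le_compat_r, Rplus_le_compat_r, Cmod_triangle|].
  unfold Ka. rewrite !Cmod_mult, MG. assert (P := Cmod_ge_0 F).
  replace (8 * Cmod z / r)%R with (4 * (2 * Cmod z / r))%R by (field; lra).
  set (m := (2 * Cmod z / r)%R) in *. nra.
Qed.
End Symmetric.

(** * The two limits *)

Lemma den_sym q r : (forall w, Cmod w = r -> J1 q w <> 0) ->
  (forall w, Cmod w = r -> den_fun q (- w) = 1 * den_fun q w) /\
  (forall w, Cmod w = r -> den_fun q (Cconj w) = Cconj (den_fun q w)) /\
  (forall w, Cmod w = r -> @cont C_UniformSpace (den_fun q) w).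
Proof.
  intros H. split; [|split]; intros w Hw; specialize (H w Hw).
  - unfold den_fun. rewrite dBesselJ_opp, Cpow_mult_l, <- Cpow_mult_r, Nat.mul_comm, Cpow_mult_r.
    replace ((-1) ^ 2) with (RtoC 1) by (simpl; ring). rewrite Cpow_1_l. field. auto.
  - unfold den_fun. rewrite dBesselJ_conj, Cdiv_conj, Cpow_conj by now apply Cpow_nz.
    f_equal. unfold Cconj, RtoC; simpl; f_equal; ring.
  - apply hol_cont, (An_hol 0), den_An; auto.
Qed.

Lemma num_sym q r : (forall w, Cmod w = r -> J1 q w <> 0) ->
  (forall w, Cmod w = r -> num_fun q (- w) = (-1) ^ q * num_fun q w) /\
  (forall w, Cmod w = r -> num_fun q (Cconj w) = Cconj (num_fun q w)) /\
  (forall w, Cmod w = r -> @cont C_UniformSpace (num_fun q) w).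
Proof.
  intros H. split; [|split]; intros w Hw; specialize (H w Hw).
  - unfold num_fun. rewrite BesselJ_opp, dBesselJ_opp, Cpow_mult_l, <- Cpow_mult_r, Nat.mul_comm, Cpow_mult_r.
    replace ((-1) ^ 2) with (RtoC 1) by (simpl; ring). rewrite Cpow_1_l.
    generalize ((-1) ^ q). intros. field. auto.
  - unfold num_fun. rewrite dBesselJ_conj, Cdiv_conj, Cpow_conj by now apply Cpow_nz.
    f_equal. apply (dBesselJ_conj q 0).
  - apply hol_cont, (An_hol 0), num_An; auto.
Qed.

Lemma contour_setup q : exists (C0 X : R), (0 < C0)%R /\ (1 <= X)%R /\
  (forall r t, (1 <= r)%R -> (0 <= t <= PI / 2)%R ->
   (Cmod (pv q r t) * decay r t <= C0 /\ Cmod (sv q r t) <= C0 /\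
   Cmod (pv q r t - pv q r 0) * decay r t <= C0 / r /\ Cmod (sv q r t - sv q r 0) <= C0 / r)%R) /\
  forall r, (X <= r)%R -> rj q r = 0%R -> (qC C0 <= r)%R /\
    (/ 4 <= (sqrt r * rj1 q r) * (sqrt r * rj1 q r) <= 1)%R.
Proof.
  destruct (arc_bounds q) as [C0 [HC H]].
  assert (Q := PI_RGT_0). assert (P4 := PI_4). assert (P2 := PI2_1).
  destruct (energy_lim q (/ 8)%R ltac:(lra)) as [X [HX HE]].
  exists C0, (Rmax 1 (Rmax X (qC C0))). split; auto. split; [apply Rmax_l|]. split; auto.
  intros r Hr Z. assert (M1 := Rmax_r 1 (Rmax X (qC C0))). assert (M0 := Rmax_l 1 (Rmax X (qC C0))).
  assert (M2 := Rmax_l X (qC C0)). assert (M3 := Rmax_r X (qC C0)). split; [lra|].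
  specialize (HE r ltac:(lra)).
  assert (E : energy q r = (sqrt r * rj1 q r * (sqrt r * rj1 q r))%R).
  { unfold energy. rewrite Z. transitivity ((sqrt r * sqrt r) * (rj1 q r * rj1 q r))%R; [|ring].
    rewrite sqrt_sqrt by lra. field. lra. }
  rewrite <- E. apply Rabs_def2 in HE.
  assert (L1 : (1 / 2 <= 2 / PI)%R) by (apply Rle_mult_div; lra).
  assert (PI3 : (3 <= PI)%R) by (generalize PI2_3_2; lra).
  assert (L2 : (2 / PI <= 2 / 3)%R) by (apply Rmult_le_compat_l; [lra|apply Rinv_le_contravar; lra]). lra.
Qed.

Theorem num_limit q (z : C) : forall eps, (0 < eps)%R -> exists X, forall r, (X <= r)%R -> rj q r = 0%R ->
  (forall w, Cmod w = r -> J1 q w <> 0) ->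
  (Cmod (/ RtoC (2 * PI) * oint (fun w : C => w / (w - z) * num_fun q w)%C r)%C < eps)%R.
Proof.
  intros eps He. destruct (contour_setup q) as [C0 [X0 [HC [HX [Harc Hset]]]]].
  assert (P := Cmod_ge_0 z). assert (Q := PI_RGT_0).
  (* [6144 = 8 * 256 * 3]: the quadrant factor, the constant of [num_bound], and the [3 / r] of the
     integral, which leave [6144 C0 / sqrt r]. Hence [r] must exceed [L^2]. *)
  set (L := (6144 * C0 / eps)%R). assert (HL : (0 < L)%R) by (apply Rdiv_lt_0_compat; lra).
  exists (X0 + 2 * Cmod z + 1 + L * L)%R. intros r Hr Z Hc.
  assert (HLL : (0 < L * L)%R) by nra.
  destruct (Hset r ltac:(lra) Z) as [Hq Hv].
  destruct (num_sym q r Hc) as [S1 [S2 S3]].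
  assert (Hz : (2 * Cmod z + 1 <= r)%R) by lra. assert (Hr0 : (0 < r)%R) by lra.
  assert (Hsg : Cmod ((-1) ^ q) = 1%R).
  { rewrite Cmod_pow. replace (Cmod (-1)) with 1%R by (rewrite Cmod_R, Rabs_m1; auto). apply pow1. }
  assert (Hs : (0 < sqrt r)%R) by now apply sqrt_lt_R0.
  rewrite (oint_quad r z _ Hz S3).
  assert (B : (Cmod (CI (quad r z (num_fun q)) 0 (PI / 2)) <= 2048 * C0 * sqrt r * (3 / r))%R).
  { apply CI_gfun_bound; auto.
    - apply Rmult_le_pos; lra.
    - now apply quad_con.
    - intros t Ht. eapply Rle_trans; [apply (quad_bound r z _ _ Hz Hsg S1 S2 t)|].
      assert (NB := num_bound q r C0 HC Harc Hq Z Hv t Ht). lra. }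
  assert (Er : (sqrt r * sqrt r = r)%R) by (apply sqrt_sqrt; lra).
  assert (E2 : (2048 * C0 * sqrt r * (3 / r) = 6144 * C0 / sqrt r)%R).
  { replace (3 / r)%R with (3 / (sqrt r * sqrt r))%R by now rewrite Er. field. lra. }
  rewrite E2 in B.
  assert (LS : (L < sqrt r)%R).
  { apply Rsqr_incrst_0; [unfold Rsqr; lra|lra|lra]. }
  assert (B3 : (6144 * C0 / sqrt r < eps)%R).
  { apply Rlt_div_l; auto. unfold L in LS. apply Rlt_div_l in LS; lra. }
  rewrite Cmod_mult, <- RtoC_inv, Cmod_R, Rabs_pos_eq by (lra || (left; apply Rinv_0_lt_compat; lra)).
  assert (I : (/ (2 * PI) <= 1)%R).
  { rewrite <- Rinv_1. apply Rinv_le_contravar; generalize PI2_1; lra. }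
  assert (I0 : (0 < / (2 * PI))%R) by (apply Rinv_0_lt_compat; lra).
  generalize (Cmod_ge_0 (CI (quad r z (num_fun q)) 0 (PI / 2))). nra.
Qed.

(** Since [epsv' = - 2 w epsv], the integrand is the derivative of [2 / (v^2 (1 + epsv))], and
    [epsv = 1] at [t = 0]. *)
Lemma f0_integral r (v : R) : (2 <= r)%R -> v <> 0%R ->
  CI (fun t => 4 * wv r t * epsv r t / (RtoC (v * v) * ((1 + epsv r t) * (1 + epsv r t)))) 0 (PI / 2)
  = / RtoC (v * v) * (2 / (1 + epsv r (PI / 2)) - 1).
Proof.
  intros Hr Nv. assert (Q := PI2_pos).
  assert (Nvv : RtoC (v * v) <> 0) by (apply RtoC_neq_0; now apply Rmult_integral_contrapositive_currified).
  assert (N : forall t, (0 <= t <= PI / 2)%R -> 1 + epsv r t <> 0).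
  { intros t Ht. apply (Cmod_pos_neq_0 _ (1 / 2)); [lra|]. now apply one_plus_epsv. }
  rewrite (CI_FTC 0 (PI / 2) Q (fun t => / RtoC (v * v) * (2 / (1 + epsv r t)))).
  - rewrite epsv_0. replace (2 / (1 + 1)) with (RtoC 1) by (rewrite <- RtoC_plus, <- RtoC_div by lra; f_equal; field). ring.
  - intros t Ht. specialize (N t Ht).
    assert (D : rderiv (fun s => 2 / (1 + epsv r s)) t ((0 * (1 + epsv r t) - 2 * (0 + - 2 * wv r t * epsv r t)) / ((1 + epsv r t) * (1 + epsv r t)))).
    { apply (cara_div RtoC (fun _ => RtoC 2) (fun s => 1 + epsv r s)); auto.
      - apply cara_const.
      - apply cara_plus; [apply cara_const|apply epsv_rderiv]. }
    replace (4 * wv r t * epsv r t / (RtoC (v * v) * ((1 + epsv r t) * (1 + epsv r t)))) with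
      (/ RtoC (v * v) * ((0 * (1 + epsv r t) - 2 * (0 + - 2 * wv r t * epsv r t)) / ((1 + epsv r t) * (1 + epsv r t)))).
    + now apply cara_scal.
    + replace (RtoC 4) with (2 * 2) by (rewrite <- RtoC_mult; f_equal; lra). field. auto.
  - intros t Ht. assert (Ce : Rcont (epsv r) t) by exact (rderiv_cont _ _ _ (epsv_rderiv r t)).
    assert (Cw : Rcont (wv r) t) by exact (rderiv_cont _ _ _ (wv_rderiv r t)).
    assert (C1 : Rcont (fun s => 1 + epsv r s) t) by (apply cont_plus; auto; apply cont_const).
    apply cont_div.
    + apply cont_mult; auto. apply cont_mult; auto. apply cont_const.
    + apply cont_mult; [apply cont_const|now apply cont_mult].
    + apply Cmult_neq_0; auto. apply Cmult_neq_0; auto.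
Qed.

Theorem den_limit q (z : C) : forall eps, (0 < eps)%R -> exists X, forall r, (X <= r)%R -> rj q r = 0%R ->
  (forall w, Cmod w = r -> J1 q w <> 0) ->
  (Cmod (/ RtoC (2 * PI) * oint (fun w : C => w / (w - z) * den_fun q w)%C r - 1)%C < eps)%R.
Proof.
  intros eps He. destruct (contour_setup q) as [C0 [X0 [HC [HX [Harc Hset]]]]].
  assert (P := Cmod_ge_0 z). assert (Q := PI_RGT_0). assert (Q4 := PI_4).
  (* The error in [v^2] enters [A0] with a factor at most 8 and the mean with a further 4:
     [4 * 8 * eps / 64 = eps / 2]. *)
  destruct (energy_lim q (eps / 64)%R ltac:(lra)) as [X1 [HX1 HE]].
  (* [L / r] collects the kernel error [3072 |z| / r], four times the arc error [147456 C0 / r], and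
     four times the [8 / r] left by [epsv] at the imaginary axis. *)
  set (L := (3072 * Cmod z + 589824 * C0 + 32)%R). assert (HL : (0 < L)%R) by (unfold L; lra).
  assert (HLe : (0 < 2 * L / eps)%R) by (apply Rdiv_lt_0_compat; lra).
  exists (X0 + X1 + 2 * Cmod z + 2 + 2 * L / eps)%R. intros r Hr Z Hc.
  destruct (Hset r ltac:(lra) Z) as [Hq Hv].
  destruct (den_sym q r Hc) as [S1 [S2 S3]].
  assert (Hz : (2 * Cmod z + 1 <= r)%R) by lra. assert (Hr0 : (0 < r)%R) by lra.
  specialize (HE r ltac:(lra)).
  set (v := (sqrt r * rj1 q r)%R) in *.
  assert (Ev : energy q r = (v * v)%R).
  { unfold energy, v. rewrite Z. transitivity ((sqrt r * sqrt r) * (rj1 q r * rj1 q r))%R; [|ring].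
    rewrite sqrt_sqrt by lra. field. lra. }
  rewrite Ev in HE.
  assert (Nv : v <> 0%R) by (intro E; rewrite E in Hv; lra).
  set (f := den_fun q). set (F := fun t => f (wv r t)).
  set (F0 := fun t => 4 * wv r t * epsv r t / (RtoC (v * v) * ((1 + epsv r t) * (1 + epsv r t)))).
  assert (CF : con 0 (PI / 2) F) by (intros t _; now apply f_wv_cont with z).
  assert (CF0 : con 0 (PI / 2) F0).
  { intros t Ht. assert (Ce : Rcont (epsv r) t) by exact (rderiv_cont _ _ _ (epsv_rderiv r t)).
    assert (Cw : Rcont (wv r) t) by exact (rderiv_cont _ _ _ (wv_rderiv r t)).
    assert (C1 : Rcont (fun s => 1 + epsv r s) t) by (apply cont_plus; auto; apply cont_const).
    apply cont_div.
    - apply cont_mult; auto. apply cont_mult; auto. apply cont_const.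
    - apply cont_mult; [apply cont_const|now apply cont_mult].
    - apply Cmult_neq_0; [apply RtoC_neq_0; now apply Rmult_integral_contrapositive_currified|].
      assert (N : 1 + epsv r t <> 0) by (apply (Cmod_pos_neq_0 _ (1 / 2)); [lra|]; apply one_plus_epsv; auto; lra).
      now apply Cmult_neq_0. }
  assert (CFc : con 0 (PI / 2) (fun t => Cconj (F t))) by (intros t Ht; apply cont_conj; now apply CF).
  assert (Q2 := PI2_pos).
  set (T := CI (quad r z f) 0 (PI / 2)). set (A := CI F 0 (PI / 2)). set (A0 := CI F0 0 (PI / 2)).
  assert (B1 : (Cmod (T - 2 * (A + Cconj A)) <= 3072 * Cmod z / r)%R).
  { assert (E : T - 2 * (A + Cconj A) = CI (fun t => quad r z f t - 2 * (F t + Cconj (F t))) 0 (PI / 2)).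
    { rewrite CI_minus, CI_scal, CI_plus, CI_conj; auto.
      - now apply con_plus.
      - now apply quad_con.
      - apply con_mult; [apply con_const|now apply con_plus]. }
    (* [8 |z| / r] from the kernel times [256 r] from [den_bound], integrated against [decay], that
       is with [k = 2 r]. *)
    rewrite E. replace (3072 * Cmod z / r)%R with (2048 * Cmod z * (3 / (2 * r)))%R by (field; lra).
    apply CI_gfun_bound; try lra.
    - apply con_minus; [now apply quad_con|]. apply con_mult; [apply con_const|now apply con_plus].
    - intros t Ht. eapply Rle_trans; [apply (quad_main r z 1 f Hz S1 S2 t eq_refl)|].
      assert (DB := den_bound q r C0 HC Harc Hq Z Hv t Ht).
      apply Rle_trans with (8 * Cmod z / r * (256 * r * decay r t))%R.
      + apply Rmult_le_compat_l; auto. apply Rdiv_le_0_compat; lra.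
      + right. unfold decay. replace (2 * (r * sin t))%R with (2 * r * sin t)%R by ring. field. lra. }
  assert (B2 : (Cmod (A - A0) <= 147456 * C0 / r)%R).
  { unfold A, A0. rewrite <- CI_minus by auto.
    replace (147456 * C0 / r)%R with (98304 * C0 * (3 / (2 * r)))%R by (field; lra).
    apply CI_gfun_bound; try lra.
    - now apply con_minus.
    - intros t Ht. eapply Rle_trans; [apply (den_main q r C0 HC Harc Hq Z Hv t Ht)|].
      right. unfold decay. now replace (2 * (r * sin t))%R with (2 * r * sin t)%R by ring. }
  assert (EA0 : A0 = / RtoC (v * v) * (2 / (1 + epsv r (PI / 2)) - 1)) by (apply f0_integral; auto; lra).
  assert (Nvv : RtoC (v * v) <> 0) by (apply RtoC_neq_0; now apply Rmult_integral_contrapositive_currified).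
  (* [A0] tends to [PI / 2], because [v^2] tends to [2 / PI] and [2 / (1 + e1) - 1] to 1; hence
     [2 (A + conj A)] tends to [2 PI] and the mean to 1. *)
  assert (B3 : (Cmod (A0 - RtoC (PI / 2)) <= 8 * (eps / 64) + 8 / r)%R).
  { set (e1 := epsv r (PI / 2)) in *.
    assert (N1 : (1 / 2 <= Cmod (1 + e1))%R) by (apply one_plus_epsv; lra).
    assert (Ne : 1 + e1 <> 0) by (apply (Cmod_pos_neq_0 _ (1 / 2)); lra).
    assert (M1 : (Cmod e1 <= / (2 * r))%R).
    { unfold e1. rewrite Cmod_epsv, decay_PI2. apply exp_neg_le_inv. lra. }
    rewrite EA0. replace (/ RtoC (v * v) * (2 / (1 + e1) - 1) - RtoC (PI / 2)) with
      (RtoC (/ (v * v) - PI / 2) - RtoC (/ (v * v)) * (2 * e1 / (1 + e1))).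
    2:{ rewrite RtoC_minus, RtoC_inv by nra. field. auto. }
    eapply Rle_trans; [apply Cmod_triangle_sub|].
    assert (Iv : (/ (v * v) <= 4)%R).
    { replace 4%R with (/ / 4)%R by field. apply Rinv_le_contravar; lra. }
    assert (Iv0 : (0 < / (v * v))%R) by (apply Rinv_0_lt_compat; lra).
    apply Rplus_le_compat.
    - rewrite Cmod_R. replace (/ (v * v) - PI / 2)%R with (- (v * v - 2 / PI) * (PI / 2 * / (v * v)))%R by (field; split; lra || nra).
      rewrite Rabs_mult, Rabs_Ropp, (Rabs_pos_eq (PI / 2 * / (v * v))) by (apply Rmult_le_pos; lra).
      rewrite (Rmult_comm 8). apply Rmult_le_compat; [apply Rabs_pos|apply Rmult_le_pos; lra|lra|]. nra.
    - rewrite Cmod_mult, Cmod_R, Rabs_pos_eq, Cmod_div, Cmod_mult, Cmod_R, (Rabs_pos_eq 2) by (auto; lra).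
      assert (X : (2 * Cmod e1 / Cmod (1 + e1) <= 2 / r)%R).
      { apply Rle_div_l; [lra|]. apply Rle_trans with (2 / r * (1 / 2))%R.
        - replace (2 / r * (1 / 2))%R with (2 * / (2 * r))%R by (field; lra). lra.
        - apply Rmult_le_compat_l; auto. apply Rdiv_le_0_compat; lra. }
      assert (X0' : (0 <= 2 * Cmod e1 / Cmod (1 + e1))%R) by (apply Rdiv_le_0_compat; [generalize (Cmod_ge_0 e1)|]; lra).
      apply Rle_trans with (4 * (2 / r))%R; [apply Rmult_le_compat; lra|right; field; lra]. }
  rewrite (oint_quad r z f Hz S3). fold T.
  replace (/ RtoC (2 * PI) * T - 1) with (/ RtoC (2 * PI) * (T - 2 * (A + Cconj A) + 2 * ((A - A0) + (A0 - RtoC (PI / 2)) + Cconj ((A - A0) + (A0 - RtoC (PI / 2)))))).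
  2:{ replace (A - A0 + (A0 - RtoC (PI / 2))) with (A - RtoC (PI / 2)) by ring. rewrite Cminus_conj.
      replace (Cconj (RtoC (PI / 2))) with (RtoC (PI / 2)) by (unfold Cconj, RtoC; simpl; f_equal; ring).
      rewrite RtoC_mult, RtoC_div by lra. field. apply RtoC_neq_0; lra. }
  rewrite Cmod_mult, <- RtoC_inv, Cmod_R, Rabs_pos_eq by (lra || (left; apply Rinv_0_lt_compat; lra)).
  assert (B4 : (Cmod (T - 2 * (A + Cconj A) + 2 * (A - A0 + (A0 - RtoC (PI / 2)) + Cconj (A - A0 + (A0 - RtoC (PI / 2))))) < eps)%R).
  { set (D := A - A0 + (A0 - RtoC (PI / 2))).
    assert (BD : (Cmod D <= 147456 * C0 / r + (8 * (eps / 64) + 8 / r))%R).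
    { unfold D. eapply Rle_trans; [apply Cmod_triangle|]. lra. }
    eapply Rle_lt_trans; [apply Cmod_triangle|]. rewrite (Cmod_mult 2), Cmod_R, (Rabs_pos_eq 2) by lra.
    assert (X : (Cmod (D + Cconj D) <= Cmod D + Cmod D)%R) by (eapply Rle_trans; [apply Cmod_triangle|rewrite Cmod_conj; lra]).
    assert (Y : (3072 * Cmod z / r + 4 * (147456 * C0 / r + 8 / r) = L / r)%R) by (unfold L; field; lra).
    assert (Y2 : (L / r < eps / 2)%R).
    { apply Rlt_div_l; [lra|]. apply Rlt_le_trans with (eps / 2 * (X0 + X1 + 2 * Cmod z + 2 + 2 * L / eps))%R; [|apply Rmult_le_compat_l; lra].
      replace (eps / 2 * (X0 + X1 + 2 * Cmod z + 2 + 2 * L / eps))%R with (L + eps / 2 * (X0 + X1 + 2 * Cmod z + 2))%R by (field; lra). nra. }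
    lra. }
  assert (I : (/ (2 * PI) <= 1)%R).
  { rewrite <- Rinv_1. apply Rinv_le_contravar; generalize PI2_1; lra. }
  assert (I0' : (0 < / (2 * PI))%R) by (apply Rinv_0_lt_compat; lra).
  match goal with |- (_ * ?x < _)%R => generalize (Cmod_ge_0 (T - 2 * (A + Cconj A) + 2 * (A - A0 + (A0 - RtoC (PI / 2)) + Cconj (A - A0 + (A0 - RtoC (PI / 2)))))) end. nra.
Qed.

(** * Assembly of the expansions *)

Lemma dBesselJ_simple_zero q (a : C) : a <> 0 -> J1 q a = 0 -> J2 q a <> 0.
Proof.
  intros Na Z. assert (I := dBesselJ_zero_real q a Na Z).
  assert (E : a = RtoC (Re a)) by (destruct a as [x y]; unfold Im, Re, RtoC in *; simpl in *; now subst).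
  assert (H : forall x : R, (0 < x)%R -> J1 q x = 0 -> J2 q x <> 0).
  { intros x Hx Zx. rewrite rj1_eq in Zx. apply RtoC_inj in Zx. rewrite rj2_eq. apply RtoC_neq_0.
    now apply rj1_zero. }
  destruct (Rtotal_order (Re a) 0) as [L|[L|L]].
  - assert (Hm := H (- Re a)%R ltac:(lra)). rewrite RtoC_opp, <- E in Hm.
    specialize (Hm (dBesselJ_zero_opp q a Z)). intro Z2. apply Hm. rewrite dBesselJ_opp, Z2. ring.
  - exfalso. apply Na. now rewrite E, L.
  - rewrite E. apply H; auto. now rewrite <- E.
Qed.

(* The radii of the contours are zeros of [J q], which separate those of its derivative. *)
Theorem bi_infinite_sum_of_contours q (zk : Z -> R) (f A0 A2 A1 : C -> C) (l z : C) :
  enumerates_zeros (J1 q) zk -> (forall a, J1 q a <> 0 -> An 1 f a) -> A0_spec q f A0 ->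
  (forall a : C, a <> 0 -> J1 q a = 0 -> regular (fun w => f w - (A2 a / (w - a) ^ 2 + A1 a / (w - a))) a) ->
  (forall eps, (0 < eps)%R -> exists X, forall r, (X <= r)%R -> rj q r = 0%R ->
    (forall w, Cmod w = r -> J1 q w <> 0) ->
    (Cmod (/ RtoC (2 * PI) * oint (fun w : C => w / (w - z) * f w)%C r - l)%C < eps)%R) ->
  J1 q z <> 0 ->
  is_bi_infinite_sum (fun k => A2 (zk k) / (z - zk k) ^ 2 + A1 (zk k) / (z - zk k)) (f z - A0 z - l).
Proof.
  intros Hzk Hf HA0 Hpole Hlim Nz.
  assert (Z1 : forall k, (1 <= k)%Z -> rj1 q (zk k) = 0%R).
  { intros k Hk. apply RtoC_inj. rewrite <- rj1_eq. now apply (zk_zero q zk Hzk). }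
  assert (HR : forall K, exists r, (1 <= K)%nat ->
    (zk (Z.of_nat K) < r < zk (Z.of_nat (S K)))%R /\ rj q r = 0%R).
  { intros K. destruct (le_lt_dec 1 K) as [L|L]; [|exists 0%R; lia].
    destruct (rj_zero_between q (zk (Z.of_nat K)) (zk (Z.of_nat (S K)))) as [c Hc].
    - apply rj1_zero; [apply (zk_pos q zk Hzk)|apply Z1]; lia.
    - apply (zk_lt q zk Hzk); lia.
    - apply Z1; lia.
    - apply Z1; lia.
    - now exists c. }
  destruct (functional_choice _ HR) as [rr Hrr]. clear HR.
  assert (U := zeros_unbounded q (fun k => zk (Z.of_nat (S k)))
    (zk_pos q zk Hzk 1 ltac:(lia)) (fun k => zk_lt q zk Hzk (Z.of_nat (S k)) (Z.of_nat (S (S k))) ltac:(lia) ltac:(lia))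
    (fun k => Z1 (Z.of_nat (S k)) ltac:(lia))).
  apply filterlim_Cseq. intros eps He. destruct (Hlim eps He) as [X HX].
  (* The contour must exceed both the threshold of the limit and [|z|]. Zeros are counted from 1, so
     the sum up to [S K] goes with the contour just beyond the zero of index [S K]. *)
  destruct (U (Rmax X (Cmod z))) as [K0 HK0]. exists (S K0). intros [|K] HK; [lia|].
  destruct (Hrr (S K) ltac:(lia)) as [[R1 R2] R3]. set (r := rr (S K)) in *.
  specialize (HK0 K ltac:(lia)). assert (M1 := Rmax_l X (Cmod z)). assert (M2 := Rmax_r X (Cmod z)).
  assert (Pz := Cmod_ge_0 z).
  assert (Hin : forall k, (1 <= k <= Z.of_nat (S K))%Z -> (zk k < r)%R).
  { intros k Hk. destruct (Z.eq_dec k (Z.of_nat (S K))) as [->|N]; auto.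
    generalize (zk_lt q zk Hzk k (Z.of_nat (S K)) ltac:(lia) ltac:(lia)). lra. }
  assert (S := partial_fraction_step q zk f A0 A2 A1 Hzk Hf HA0 Hpole (S K) r z Hin R2 ltac:(lra) Nz).
  assert (B := HX r ltac:(lra) R3 (dBesselJ_circle_neq_0 q zk Hzk (Datatypes.S K) r ltac:(lra) Hin R2)).
  rewrite <- S in B. rewrite Cmod_sub_sym. unfold term in B.
  match goal with |- (Cmod ?a < _)%R => match type of B with (Cmod ?b < _)%R => replace a with b; auto end end.
  ring.
Qed.

Theorem mainTheorem6 :
  forall (q : nat) (zk : Z -> R),
    enumerates_zeros (dBesselJ q 1) zk ->
    forall z : C, dBesselJ q 1 z <> 0 ->
      exists Snum Sden : C,
        is_bi_infinite_sum
          (fun k : Z => a2_num q (zk k) / (z - zk k) ^ 2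
                        + a1_num q (zk k) / (z - zk k)) Snum /\
        is_bi_infinite_sum
          (fun k : Z => a2_den q (zk k) / (z - zk k) ^ 2
                        + a1_den q (zk k) / (z - zk k)) Sden /\
        1 + A0_den q z + Sden <> 0 /\
        BesselJ q z = (A0_num q z + Snum) / (1 + A0_den q z + Sden).
Proof.
  intros q zk Hzk z Nz.
  (* The limits of the means, 0 and 1, are what is subtracted; the full denominator is then exactly
     [1 / J_q'^2], which does not vanish. *)
  exists (num_fun q z - A0_num q z - 0), (den_fun q z - A0_den q z - 1).
  assert (E : 1 + A0_den q z + (den_fun q z - A0_den q z - 1) = 1 / J1 q z ^ 2) by (unfold den_fun; ring).
  split; [|split; [|split]].
  - apply (bi_infinite_sum_of_contours q zk (num_fun q) (A0_num q) (a2_num q) (a1_num q)); auto.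
    + intros a Ha. now apply num_An.
    + apply A0_num_spec.
    + intros a Na Z. apply (double_pole q (J q) a (J1 q a)); auto.
      * apply (dBesselJ_An 3 q 0).
      * apply BesselJ_cderiv.
      * now apply dBesselJ_simple_zero.
    + intros eps He. destruct (num_limit q z eps He) as [X HX]. exists X. intros r Hr Z Hc.
      specialize (HX r Hr Z Hc).
      match goal with |- (Cmod (?a - _) < _)%R => replace (a - 0) with a by ring end. exact HX.
  - apply (bi_infinite_sum_of_contours q zk (den_fun q) (A0_den q) (a2_den q) (a1_den q)); auto.
    + intros a Ha. now apply den_An.
    + apply A0_den_spec.
    + intros a Na Z. assert (N2 := dBesselJ_simple_zero q a Na Z).
      (* The numerator is the constant 1, with derivative 0, which leaves the single term of
         [a1_den]. *)
      assert (D := double_pole q (fun _ => 1) a 0 (An_const 3 1 a) (cara_const _ _ _) Z N2).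
      replace (a1_den q a) with (0 / J2 q a ^ 2 - 1 * J3 q a / J2 q a ^ 3); [exact D|].
      unfold a1_den. field. auto.
    + apply den_limit.
  - rewrite E. intro Z. apply (C1_nz). rewrite <- (Cmult_0_l (J1 q z ^ 2)), <- Z. field. auto.
  - rewrite E. unfold num_fun. field. auto.
Qed.
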